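(* For every constant $\epsilon>0$, every finite family of graphs $\mathcal{F}$ and every fixed graph $T$, there is a deterministic polynomial time algorithm that, given an input graph $G$ on $n$ vertices, approximates $\mathrm{ex}(G,T,\mathcal{F})$ within an additive error of $\epsilon n^{v(T)}$ (that is, it outputs a number $x$ with $|x-\mathrm{ex}(G,T,\mathcal{F})|\le \epsilon n^{v(T)}$).
   Context: Graphs are finite and simple; $v(T)$ denotes the number of vertices of $T$. A copy of $T$ in a graph $H$ is a (not necessarily induced) subgraph of $H$ isomorphic to $T$. A graph is $\mathcal{F}$-free if it contains no copy of any $F\in\mathcal{F}$. For graphs $G,T$ and a family of graphs $\mathcal{F}$, $\mathrm{ex}(G,T,\mathcal{F})$ denotes the maximum number of copies of $T$ in an $\mathcal{F}$-free subgraph of $G$. The parameters $\epsilon,\mathcal{F},T$ are fixed, the input is $G$, and ''polynomial time'' means polynomial in $n$. *)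

(* Defs.v *)
From HB Require Import structures.
From mathcomp Require Import all_boot all_order all_algebra.
From mathcomp Require Import reals.

Set Implicit Arguments.
Unset Strict Implicit.
Unset Printing Implicit Defensive.

Import Order.TTheory GRing.Theory Num.Theory.

Record sgraph := SGraph {
  vert :> finType;
  adj : rel vert;
  adj_sym : symmetric adj;
  adj_irr : irreflexive adj
}.

Definition edges (G : sgraph) : {set {set G}} :=
  [set [set p.1; p.2] | p : G * G & adj p.1 p.2].

(* Subgraphs of a graph with vertex type V are pairs (vertex set, edge set),
   so that vertex sets may be proper subsets and copies of graphs with
   isolated vertices are counted as subgraphs. *)
Definition subg (V : finType) : finType := ({set V} * {set {set V}})%type.

Definition whole (G : sgraph) : subg G := ([set: G], edges G).

Definition subgraphs (V : finType) (H : subg V) : {set subg V} :=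
  [set S : subg V | [&& S.1 \subset H.1, S.2 \subset H.2
                      & [forall e in S.2, e \subset S.1]]].

Definition isomorphic_to (T : sgraph) (V : finType) (S : subg V) : bool :=
  [exists f : {ffun T -> V},
    [&& injectiveb f, f @: [set: T] == S.1
      & [forall x, forall y, adj x y == ([set f x; f y] \in S.2)]]].

Definition copies (T : sgraph) (V : finType) (H : subg V) : {set subg V} :=
  [set S in subgraphs H | isomorphic_to T S].

Definition family_free (Fs : seq sgraph) (V : finType) (H : subg V) : bool :=
  all (fun F => copies F H == set0) Fs.

(* The maximum is 0 if there is no Fs-free subgraph at all, which happens only
   when Fs contains the graph without vertices. *)
Definition ex_count (G T : sgraph) (Fs : seq sgraph) : nat :=
  \max_(H in subgraphs (whole G) | family_free Fs H) #|copies T H|.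

(* Random access machines in the style of Cook and Reckhow, with a separate
   bank of directly addressed registers.  There is no multiplication, so the
   bit length of the largest stored number grows by at most a constant per
   step; hence counting each instruction as one step agrees with Turing
   machine time up to a polynomial. *)
Inductive instr : Type :=
| IConst of nat & nat           (* IConst r c   : R[r] := c                   *)
| IAdd of nat & nat & nat       (* IAdd r s t   : R[r] := R[s] + R[t]         *)
| ISub of nat & nat & nat       (* ISub r s t   : R[r] := max(R[s] - R[t], 0) *)
| IRead of nat & nat            (* IRead r s    : R[r] := M[R[s]]             *)
| IWrite of nat & nat           (* IWrite r s   : M[R[r]] := R[s]             *)
| IJz of nat & nat.             (* IJz r l      : if R[r] = 0 then goto l     *)

Definition program := seq instr.

Record config := Config {
  pc : nat;
  reg : nat -> nat;
  memory : nat -> nat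
}.

Definition exec_instr (i : instr) (s : config) : config :=
  let: Config l R M := s in
  match i with
  | IConst r c => Config l.+1 [eta R with r |-> c] M
  | IAdd r a b => Config l.+1 [eta R with r |-> R a + R b] M
  | ISub r a b => Config l.+1 [eta R with r |-> R a - R b] M
  | IRead r a => Config l.+1 [eta R with r |-> M (R a)] M
  | IWrite r a => Config l.+1 R [eta M with R r |-> R a]
  | IJz r l' => Config (if R r == 0 then l' else l.+1) R M
  end.

Definition step (P : program) (s : config) : config :=
  if onth P (pc s) is Some i then exec_instr i s else s.

Definition halted (P : program) (s : config) : bool := size P <= pc s.

(* The input is n = #|G| in register 0 and the n x n adjacency matrix, stored
   row by row in memory cells 0, ..., n ^ 2 - 1; all the rest is 0. *)
Definition init (G : sgraph) : config :=
  Config 0 [eta (fun=> 0) with 0 |-> #|G|]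
    (fun a => [exists x : G, exists y : G,
                 (a == enum_rank x * #|G| + enum_rank y) && adj x y] : nat).

Local Open Scope ring_scope.

(* The output is the rational number R[0] / R[1]. *)
Definition poly_time_computable (f : sgraph -> rat) : Prop :=
  exists (P : program) (p : {poly nat}), forall G : sgraph,
    exists2 t : nat, (t <= p.[#|G|])%N &
      let s := iter t (step P) (init G) in
      [/\ halted P s, (0 < reg s 1)%N & f G = (reg s 0)%:R / (reg s 1)%:R].

(* Main.v *)
Require Import Defs.
From mathcomp Require Import all_boot all_order all_algebra.
From mathcomp Require Import reals.
From mathcomp Require Import zify ring lra.

(* Write n, t for the numbers of vertices of G, T. By Szemeredi's regularity
   lemma and the embedding lemma, an F-free graph H with many vertices has a
   colouring c with boundedly many colours and a relation Q on the colours
   admitting no homomorphism from a member of the family, such that all but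
   eps n^2 edges uv of H satisfy Q (c u) (c v). Conversely, for any c and any
   such Q the edges uv of G with Q (c u) (c v) form an F-free graph. Hence
   ex(G,T,F) |Aut T| is, up to eps n^t, the maximum over c and Q of the number
   of homomorphisms from T to G that respect Q: a dense constraint satisfaction
   problem, whose optimum is estimated by its mean optimum over the samples
   x in V(G)^q for a constant q. Restricting c to x shows that the mean is
   not too small. For the converse, approximate the adjacency matrix of G in
   the cut norm by a matrix which is constant on the pairs of cells of a
   bounded partition; this approximation survives on most samples, because
   the number of four-cycles of the difference controls its cut norm and is
   preserved by sampling, and so do the sizes of the cells; the colours of
   the sample can then be dealt out evenly to the vertices of every cell.
   The mean over all n^q samples is computed by nested loops around a decision
   tree. *)

(** The best colouring of a sample may exploit accidents of that sample, so an estimate for one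
    fixed colouring is useless. The cut norm removes this obstacle: its effect on homomorphism
    counts is bounded for all colourings at once, at the price of a factor [#|C| ^ 2]. The resulting
    loss on a sample is affine in two statistics, the four-cycle count of the difference and the l1
    deviation of the cell sizes, so first moments suffice, and both come from functions of at most
    four sample points. [Q] must exclude homomorphisms and not merely copies, because many vertices
    share a colour. Conversely [opt] counts all homomorphisms while copies are injective; the
    difference is of order [n ^ (t - 1)]. The estimates hold only for large [n]. For smaller inputs
    the exact answers are constants built into the program. The machine cannot multiply, so the
    output [n ^ t * E / (n ^ q * q ^ t * #|Aut T|)], with [E] the sum of the optima over all
    samples, is produced by adding constants inside nested loops, some of which only serve as
    factors [n]. *)

Set Implicit Arguments.
Unset Strict Implicit.
Unset Printing Implicit Defensive.

Import Order.TTheory GRing.Theory Num.Theory.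

(** * Random access machines *)

(* A code block is a function of its load address, because jumps are absolute. *)
Definition block := nat -> program.

(** Total correctness with a step bound. Quantifying over the surrounding code lets a block be
    verified once for every load address; [M] stays fixed because the generated code only reads
    memory. *)
Definition tri (M : nat -> nat) (c : block) (R : nat -> nat) (b : nat)
    (Q : (nat -> nat) -> Prop) : Prop :=
  forall P1 P2, exists k R',
    [/\ (k <= b)%N,
        iter k (step (P1 ++ c (size P1) ++ P2)) (Config (size P1) R M) =
          Config (size P1 + size (c (size P1))) R' M
      & Q R'].

Definition single (i : instr) : block := fun _ => [:: i].

Definition seqc (c1 c2 : block) : block :=
  fun o => c1 o ++ c2 (o + size (c1 o)).

(* Register 4 always holds 0, so IJz 4 is an unconditional jump. *)
Definition ifc (r : nat) (c1 c2 : block) : block := fun o =>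
  let p1 := c1 o.+1 in
  let o2 := o.+1 + size p1 + 1 in
  let p2 := c2 o2 in
  IJz r o2 :: p1 ++ IJz 4 (o2 + size p2) :: p2.

Definition whilec (r : nat) (c : block) : block := fun o =>
  let p := c o.+1 in
  IJz r (o.+1 + size p + 1) :: p ++ [:: IJz 4 o].

Section Triples.
Variable M : nat -> nat.
Implicit Types (R : nat -> nat) (c : block) (b : nat) (Q : (nat -> nat) -> Prop).

Lemma onth_mid (P1 P2 : program) i : onth (P1 ++ i :: P2) (size P1) = Some i.
Proof. by rewrite onth_cat ltnn subnn. Qed.

Lemma step_mid (P1 P2 : program) i R :
  step (P1 ++ i :: P2) (Config (size P1) R M) = exec_instr i (Config (size P1) R M).
Proof. by rewrite /step /= onth_mid. Qed.

Lemma tri_weaken c R b b' Q Q' :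
  tri M c R b Q -> (b <= b')%N -> (forall R', Q R' -> Q' R') -> tri M c R b' Q'.
Proof.
move=> H Hb HQ P1 P2; have [k [R' [H1 H2 H3]]] := H P1 P2.
by exists k, R'; split; [exact: leq_trans H1 Hb | | exact: HQ].
Qed.

Lemma tri_const r a R Q :
  Q [eta R with r |-> a] -> tri M (single (IConst r a)) R 1 Q.
Proof.
move=> H P1 P2; exists 1, [eta R with r |-> a]; split => //=.
by rewrite step_mid /= addn1.
Qed.

Lemma tri_add r s t R Q :
  Q [eta R with r |-> R s + R t] -> tri M (single (IAdd r s t)) R 1 Q.
Proof.
move=> H P1 P2; exists 1, [eta R with r |-> R s + R t]; split => //=.
by rewrite step_mid /= addn1.
Qed.

Lemma tri_sub r s t R Q :
  Q [eta R with r |-> R s - R t] -> tri M (single (ISub r s t)) R 1 Q.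
Proof.
move=> H P1 P2; exists 1, [eta R with r |-> R s - R t]; split => //=.
by rewrite step_mid /= addn1.
Qed.

Lemma tri_read r s R Q :
  Q [eta R with r |-> M (R s)] -> tri M (single (IRead r s)) R 1 Q.
Proof.
move=> H P1 P2; exists 1, [eta R with r |-> M (R s)]; split => //=.
by rewrite step_mid /= addn1.
Qed.

Lemma tri_seq c1 c2 R b1 b2 Q :
  tri M c1 R b1 (fun R1 => tri M c2 R1 b2 Q) -> tri M (seqc c1 c2) R (b1 + b2) Q.
Proof.
move=> H P1 P2.
have [k1 [R1 [Hk1 E1 H1]]] := H P1 (c2 (size P1 + size (c1 (size P1))) ++ P2).
have [k2 [R2 [Hk2 E2 H2]]] := H1 (P1 ++ c1 (size P1)) P2.
exists (k2 + k1), R2; split => //; first by rewrite addnC leq_add.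
rewrite /seqc iterD -!catA E1.
by move: E2; rewrite size_cat -!catA => ->; rewrite size_cat addnA.
Qed.

(** The [+ 2] pays for the test and for the jump over the second branch. Only the first branch ends
    in that jump, so only there must register 4 be 0 again. *)
Lemma tri_if r c1 c2 R b Q :
  (R r != 0 -> tri M c1 R b (fun R' => R' 4 = 0 /\ Q R')) ->
  (R r = 0 -> tri M c2 R b Q) ->
  tri M (ifc r c1 c2) R (b + 2) Q.
Proof.
move=> H1 H2 P1 P2; rewrite /ifc.
set p1 := c1 _; set o2 := (_ + 1)%N; set p2 := c2 _.
have [r0|rn0] := eqVneq (R r) 0.
  have [k [R' [Hk E HQ]]] := H2 r0 (P1 ++ IJz r o2 :: p1 ++ [:: IJz 4 (o2 + size p2)]) P2.
  exists k.+1, R'; split => //; first lia.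
  have Esz : size (P1 ++ IJz r o2 :: p1 ++ [:: IJz 4 (o2 + size p2)]) = o2.
    by rewrite /o2 size_cat /= size_cat /=; lia.
  move: E; rewrite Esz -/p2 iterSr.
  rewrite step_mid /= r0 eqxx -!catA /= -!catA /= => ->; congr Config.
  by rewrite size_cat /= /o2; lia.
have [k [R' [Hk E [R40 HQ]]]] :=
  H1 rn0 (P1 ++ [:: IJz r o2]) (IJz 4 (o2 + size p2) :: p2 ++ P2).
exists k.+2, R'; split => //; first lia.
rewrite size_cat addn1 -/p1 -!catA /= in E.
rewrite iterS iterSr.
rewrite cat_cons -catA cat_cons.
rewrite step_mid /= (negPf rn0) E.
have -> : P1 ++ IJz r o2 :: p1 ++ IJz 4 (o2 + size p2) :: p2 ++ P2 =
          (P1 ++ IJz r o2 :: p1) ++ IJz 4 (o2 + size p2) :: p2 ++ P2.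
  by rewrite -catA.
have -> : ((size P1).+1 + size p1)%N = size (P1 ++ IJz r o2 :: p1).
  by rewrite size_cat /=; lia.
rewrite step_mid /= R40 eqxx; congr Config.
by rewrite size_cat /= /o2; lia.
Qed.

(** The tested register is the variant: it holds the number [j] of remaining rounds. A round costs
    two jumps besides its body, and the final test costs one step. *)
Lemma tri_while r c b (I : nat -> (nat -> nat) -> Prop) n R :
  (forall j R', I j R' -> R' r = j) ->
  (forall j R', I j.+1 R' -> tri M c R' b (fun R'' => R'' 4 = 0 /\ I j R'')) ->
  I n R ->
  tri M (whilec r c) R (n * (b + 2) + 1) (I 0).
Proof.
move=> Hr Hc; elim: n R => [|n IH] R HI P1 P2; rewrite /whilec.
  exists 1, R; split => //=; rewrite step_mid /= (Hr _ _ HI) eqxx.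
  by congr Config; rewrite size_cat /=; lia.
set p := c _; set o2 := ((size P1).+1 + size p + 1)%N.
have [k [R' [Hk E [R40 HI']]]] :=
  Hc _ _ HI (P1 ++ [:: IJz r o2]) (IJz 4 (size P1) :: P2).
have [k' [R'' [Hk' E' HI'']]] := IH _ HI' P1 P2.
exists (k' + k.+2), R''; split => //; first by clear -Hk Hk'; lia.
rewrite size_cat addn1 -/p -!catA /= in E.
rewrite -E' /whilec -/p -/o2.
rewrite iterD; congr iter.
rewrite iterS iterSr cat_cons -catA cat_cons.
rewrite step_mid /= (Hr _ _ HI) -?catA /= E.
have -> : P1 ++ IJz r o2 :: p ++ IJz 4 (size P1) :: P2 =
          (P1 ++ IJz r o2 :: p) ++ IJz 4 (size P1) :: P2 by rewrite -catA.
have -> : ((size P1).+1 + size p)%N = size (P1 ++ IJz r o2 :: p).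
  by rewrite size_cat /=; lia.
by rewrite step_mid /= R40 eqxx.
Qed.

End Triples.

(** * Decision trees reading the adjacency matrix *)

Definition upd_bit (b : nat -> nat -> bool) (p : nat * nat) (v : bool) :=
  fun i j => if (i, j) == p then v else b i j.

Definition read_bits (m : nat -> nat -> bool) :=
  foldl (fun b p => upd_bit b p (m p.1 p.2)).

Lemma read_bits_in m L b i j :
  (i, j) \in L -> read_bits m b L i j = m i j.
Proof.
(* Generalised for the induction: the entry is still to be read or is already correct. Reading it
   again does no harm. *)
move=> ijL; have: ((i, j) \in L) || (b i j == m i j) by rewrite ijL.
elim: L b {ijL} => [|p L IH] b /=; first by move/eqP.
rewrite inE -orbA => /or3P[/eqP <-|ijL|/eqP E]; apply: IH.
- by rewrite /upd_bit eqxx eqxx orbT.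
- by rewrite ijL.
- by rewrite /upd_bit; case: ifP => [/eqP <-|_] /=; rewrite ?E eqxx orbT.
Qed.

Section DecisionTree.
Variables (M : nat -> nat) (addr : nat -> nat -> block).
Variables (w : (nat -> nat -> bool) -> nat) (a : nat).

(** At a leaf all queried bits are known from the path, so [w b] is a literal of the program: an
    arbitrary function of boundedly many bits takes constant time. The value is added to register
    [a], so that surrounding loops accumulate a sum. *)
Fixpoint dtree (L : seq (nat * nat)) (b : nat -> nat -> bool) : block :=
  if L is p :: L' then
    seqc (addr p.1 p.2) (seqc (single (IRead 5 5))
      (ifc 5 (dtree L' (upd_bit b p true)) (dtree L' (upd_bit b p false))))
  else seqc (single (IConst 5 (w b))) (single (IAdd a a 5)).

Lemma tri_dtree (m : nat -> nat -> bool) (A : nat -> nat -> nat) L b R :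
  (a < 2)%N -> R 4 = 0 ->
  (forall p, p \in L -> M (A p.1 p.2) = m p.1 p.2) ->
  (forall p R', p \in L -> (forall r, r <> 5 -> R' r = R r) ->
     tri M (addr p.1 p.2) R' 1 (fun R'' => R'' = [eta R' with 5 |-> A p.1 p.2])) ->
  tri M (dtree L b) R (4 * size L + 2)
    (fun R' => R' a = (R a + w (read_bits m b L))%N /\
               forall r, r <> 5 -> r <> a -> R' r = R r).
Proof.
move=> a2 R4 HM; elim: L b R R4 HM => [|p L IH] b R R4 HM Haddr /=.
  apply: (@tri_seq _ _ _ _ 1 1); apply: tri_const; apply: tri_add => /=.
  rewrite eqxx; split; first by case: a a2 => [|[|]].
  by move=> r r5 ra /=; case: eqP => // _; case: eqP.
have -> : 4 * (size L).+1 + 2 = 1 + (1 + (4 * size L + 2 + 2)) by lia.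
apply: tri_seq; apply: tri_weaken (leqnn _) _; first exact: Haddr (mem_head _ _) _.
move=> R1 ->; apply: tri_seq; apply: tri_read => /=.
set R2 := [eta _ with 5 |-> _].
have R2E r : r <> 5 -> R2 r = R r by rewrite /R2 /=; case: eqP => //.
have R25 : R2 5 = m p.1 p.2 by rewrite /R2 /= HM ?mem_head.
have IH' v : tri M (dtree L (upd_bit b p v)) R2 (4 * size L + 2)
    (fun R' => R' a = (R2 a + w (read_bits m (upd_bit b p v) L))%N /\
               forall r, r <> 5 -> r <> a -> R' r = R2 r).
  apply: IH; first by rewrite R2E.
    by move=> q qL; rewrite HM // inE qL orbT.
  move=> q R' qL HR'; apply: Haddr; first by rewrite inE qL orbT.
  by move=> r r5; rewrite HR' // R2E.
have a5 : a <> 5 by lia.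
apply: tri_if; rewrite R25; case: (m p.1 p.2) => // _; apply: tri_weaken (IH' _) (leqnn _) _.
  move=> R' [H1 H2]; split; [|split]; rewrite ?H1 ?H2 ?R2E //; try lia.
  by move=> r r5 ra; rewrite H2 ?R2E.
move=> R' [H1 H2]; split; rewrite ?H1 ?R2E //.
by move=> r r5 ra; rewrite H2 ?R2E.
Qed.

End DecisionTree.

(** * Nested loops *)

Fixpoint nsum (n k : nat) (F : seq nat -> nat) (s : seq nat) : nat :=
  if k is k'.+1 then \sum_(v < n) nsum n k' F (rcons s v) else F s.

(* Loop number i keeps its counter v, the product v * n and the number of
   remaining iterations in registers 10 + 3i, 11 + 3i and 12 + 3i; registers 2
   and 3 hold n and 1. *)
Fixpoint loops (leaf : block) (k i : nat) : block :=
  if k is k'.+1 then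
    seqc (single (IConst (10 + 3 * i) 0)) (seqc (single (IConst (11 + 3 * i) 0))
   (seqc (single (IAdd (12 + 3 * i) 2 4)) (whilec (12 + 3 * i)
   (seqc (loops leaf k' i.+1) (seqc (single (IAdd (10 + 3 * i) (10 + 3 * i) 3))
   (seqc (single (IAdd (11 + 3 * i) (11 + 3 * i) 2))
         (single (ISub (12 + 3 * i) (12 + 3 * i) 3))))))))
  else leaf.

(** The 5 counts three register updates and two jumps per round, the 4 three initialisations and the
    final test. *)
Fixpoint loop_time (b0 k : nat) : {poly nat} :=
  if k is k'.+1 then ('X * (loop_time b0 k' + (5%N)%:P) + (4%N)%:P)%R else (b0%:P)%R.

Definition env (n : nat) (s : seq nat) (R : nat -> nat) : Prop :=
  [/\ R 2 = n, R 3 = 1, R 4 = 0 &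
      forall j, j < size s ->
        R (10 + 3 * j) = nth 0 s j /\ R (11 + 3 * j) = (nth 0 s j * n)%N].

(** Registers from [10 + 3 * i] on belong to loop [i] and the loops inside it; 5 is scratch and [a]
    the accumulator. *)
Definition same (a i : nat) (R R' : nat -> nat) : Prop :=
  forall r, r < 10 + 3 * i -> r <> 5 -> r <> a -> R' r = R r.

Lemma env_same n s a R R' :
  (a < 2)%N -> env n s R -> same a (size s) R R' -> env n s R'.
Proof.
move=> a2 [H2 H3 H4 Hj] S; split; try by rewrite S //; lia.
by move=> j js; have [<- <-] := Hj j js; rewrite !S //; lia.
Qed.

Lemma tri_loops M leaf n k0 a b0 F :
  (a < 2)%N ->
  (forall s R, size s = k0 -> all (ltn^~ n) s -> env n s R ->
     tri M leaf R b0 (fun R' => R' a = (R a + F s)%N /\ same a (size s) R R')) ->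
  forall k s R, (size s + k)%N = k0 -> all (ltn^~ n) s -> env n s R ->
  tri M (loops leaf k (size s)) R (loop_time b0 k).[n]%R
    (fun R' => R' a = (R a + nsum n k F s)%N /\ same a (size s) R R').
Proof.
move=> a2 Hleaf; elim=> [|k IH] s R sk sn E.
  by rewrite /= hornerC; apply: Hleaf => //; lia.
rewrite /= !(hornerD, hornerM, hornerX, hornerC); set bk := horner _ _.
set i := size s; set rx := (10 + 3 * i)%N; set ry := (11 + 3 * i)%N.
set rc := (12 + 3 * i)%N.
(* The counter runs down while the loop variable runs up: with [j] rounds left the variable is
   [n - j] and the values below it have been summed. *)
pose Inv j R' := [/\ R' rc = j, (j <= n)%N, R' rx = (n - j)%N, R' ry = ((n - j) * n)%N &
  R' a = (R a + \sum_(v < n | v < n - j) nsum n k F (rcons s v))%N /\ same a i R R'].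
have bE : (n * (bk + 5) + 4)%R = 1 + (1 + (1 + (n * ((bk + (1 + (1 + 1))) + 2) + 1))).
  by clearbody bk; rewrite -[LHS]/(n * (bk + 5) + 4)%N; move: (bk : nat) => z; clear; lia.
rewrite bE; have [E2 E3 E4 Ej] := E.
apply: tri_seq; apply: tri_const; apply: tri_seq; apply: tri_const.
apply: tri_seq; apply: tri_add.
set R0 := [eta _ with rc |-> _].
have R0E r : r < 10 + 3 * i -> R0 r = R r.
  move=> ri; rewrite /R0 /=; do 3 (case: eqP => [?|_]; first by lia).
  by [].
have Inv0 : Inv n R0.
  split=> //; rewrite ?subnn //.
  - by rewrite /R0 /= eqxx E2 E4 addn0.
  - by rewrite /R0 /=; do 2 (case: eqP => [?|_]; first by lia); rewrite eqxx.
  - by rewrite /R0 /=; do 1 (case: eqP => [?|_]; first by lia); rewrite eqxx.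
  split; first by rewrite big_pred0 // addn0 R0E //; lia.
  by move=> r ri r5 ra; rewrite R0E.
apply: tri_weaken (tri_while _ _ Inv0) (leqnn _) _; first by move=> j R' [].
  move=> j R1 [H1 H2 H3 H4 [H5 H6]].
  have E1 : env n (rcons s (n - j.+1)) R1.
    have [F2 F3 F4 Fj] := env_same a2 E H6.
    split=> // l; rewrite size_rcons ltnS leq_eqVlt nth_rcons => /orP[/eqP->|ls].
      by rewrite ltnn eqxx.
    by rewrite ls; apply: Fj.
  have jn : n - j.+1 < n by lia.
  apply: tri_seq; apply: tri_weaken (leqnn _) _.
    rewrite -[i.+1](size_rcons s (n - j.+1)); apply: IH E1.
      by rewrite size_rcons; lia.
    by rewrite all_rcons sn andbT.
  rewrite size_rcons => R2 [G1 G2].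
  have [F2 F3 F4 Fj] : env n (rcons s (n - j.+1)) R2.
    by apply: env_same a2 E1 _; rewrite size_rcons.
  apply: tri_seq; apply: tri_add; apply: tri_seq; apply: tri_add; apply: tri_sub.
  set R3 := [eta _ with rc |-> _].
  have R3E r : r < 10 + 3 * i -> R3 r = R2 r.
    move=> ri; rewrite /R3 /=; do 3 (case: eqP => [?|_]; first by lia).
    by [].
  have G r : r < 10 + 3 * i.+1 -> r <> 5 -> r <> a -> R2 r = R1 r by apply: G2.
  have Ex : R3 rx = (R2 rx + R2 3)%N.
    by rewrite /R3 /=; do 2 (case: eqP => [?|_]; first by lia); rewrite eqxx.
  have Ey : R3 ry = (R2 ry + R2 2)%N.
    rewrite /R3 /=; case: eqP => [?|_]; first by lia.
    by rewrite eqxx; case: eqP => [?|_] //; lia.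
  have Ec : R3 rc = (R2 rc - R2 3)%N.
    rewrite /R3 /= eqxx; do 2 (case: eqP => [?|_]; first by lia).
    by [].
  clearbody R3; split; first by rewrite R3E.
  split.
  - by rewrite Ec F3 G ?H1; lia.
  - by lia.
  - by rewrite Ex F3 G ?H3; lia.
  - by rewrite Ey F2 G ?H4; [nia | lia..].
  split.
    rewrite R3E ?G1 ?H5; last by lia.
    rewrite -addnA; congr (_ + _)%N.
    have jlt : n - j.+1 < n by lia.
    rewrite [RHS](bigD1 (Ordinal jlt)) /=; last by lia.
    rewrite addnC; congr (_ + _)%N; apply: eq_bigl => v.
    by rewrite -val_eqE /=; lia.
  by move=> r ri r5 ra; rewrite R3E // G // ?H6 //; lia.
by move=> R' [_ _ _ _ [-> HS]]; split=> //; rewrite subn0; congr (_ + _)%N;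
  apply: eq_bigl => v; rewrite ltn_ord.
Qed.

Definition adj_matrix (G : sgraph) (i j : nat) : bool :=
  [exists x : G, exists y : G,
     [&& i == enum_rank x, j == enum_rank y & adj x y]].

Lemma init_memory (G : sgraph) i j :
  (i < #|G|)%N -> (j < #|G|)%N ->
  memory (init G) (i * #|G| + j) = adj_matrix G i j.
Proof.
move=> iG jG /=; congr nat_of_bool.
apply/existsP/existsP => -[x /existsP[y]].
  move=> /andP[/eqP E xy]; exists x; apply/existsP; exists y; rewrite xy andbT.
  have yG := ltn_ord (enum_rank y); have G0 : (0 < #|G|)%N by lia.
  have Ej : j = enum_rank y :> nat.
    by rewrite -(modn_small jG) -(modn_small yG) -(modnMDl i) E modnMDl.
  rewrite Ej eqxx andbT -(eqn_pmul2r G0).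
  by apply/eqP; move: E; rewrite Ej => /addIn.
move=> /and3P[/eqP -> /eqP -> xy]; exists x; apply/existsP; exists y.
by rewrite eqxx.
Qed.

Definition ord_pairs (m : nat) : seq (nat * nat) :=
  [seq (i, j) | i <- iota 0 m, j <- iota 0 m].

Lemma mem_ord_pairs m i j : ((i, j) \in ord_pairs m) = (i < m)%N && (j < m)%N.
Proof.
apply/allpairsP/andP => [[[x y] /= []]|[im jm]].
  by rewrite !mem_iota /= !add0n => xm ym [-> ->].
by exists (i, j); rewrite /= !mem_iota.
Qed.

(** * The complete program and its running time *)

Section Program.
Variables (N q k D : nat) (small : nat -> (nat -> nat -> bool) -> nat).
Variable (w : (nat -> nat -> bool) -> nat).
Let b0 : nat -> nat -> bool := fun _ _ => false.

Definition addr_const (n i j : nat) : block := single (IConst 5 (i * n + j)).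
(** Keeping [v * n] beside each loop variable [v] makes a row-major address a single addition. *)
Definition addr_loop (i j : nat) : block :=
  single (IAdd 5 (11 + 3 * i) (10 + 3 * j)).

Definition small_block (n : nat) : block :=
  seqc (dtree (addr_const n) (small n) 0 (ord_pairs n) b0) (single (IConst 1 1)).

(** The tree looks only at the first [q] loop variables, so the [k] inner loops multiply the
    numerator by [n ^ k]. The second nest computes the denominator [n ^ q * D] by repeated
    addition. *)
Definition large_block : block :=
  seqc (loops (dtree addr_loop w 0 (ord_pairs q) b0) (q + k) 0)
       (loops (dtree addr_loop (fun _ => D) 1 [::] b0) q 0).

(** Sizes below [n] have been excluded before, so a zero truncated difference means that the input
    has exactly [n] vertices. *)
Fixpoint dispatch (m n : nat) : block :=
  if m is m'.+1 then
    seqc (single (IConst 5 n)) (seqc (single (ISub 5 2 5))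
      (ifc 5 (dispatch m' n.+1) (small_block n)))
  else large_block.

Definition main_block : block :=
  seqc (single (IAdd 2 0 4)) (seqc (single (IConst 3 1))
    (seqc (single (IConst 0 0)) (dispatch N 0))).

Definition large_time : {poly nat} :=
  (loop_time (4 * size (ord_pairs q) + 2) (q + k) + loop_time 2 q)%R.

(** The costs of all branches are added, which bounds their maximum by a polynomial. *)
Fixpoint dispatch_time (m n : nat) : {poly nat} :=
  if m is m'.+1 then
    (dispatch_time m' n.+1 + (4 * size (ord_pairs n) + 7)%N%:P)%R
  else large_time.

Definition num_value (m : nat -> nat -> bool) (n : nat) : nat :=
  if (n < N)%N then small n m
  else nsum n (q + k) (fun s => w (fun i j => m (nth 0 s i) (nth 0 s j))) [::].

Definition den_value (n : nat) : nat :=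
  if (n < N)%N then 1%N else nsum n q (fun=> D) [::].

Hypothesis small_ext : forall n b b',
  (forall i j, (i < n)%N -> (j < n)%N -> b i j = b' i j) -> small n b = small n b'.
Hypothesis w_ext : forall b b',
  (forall i j, (i < q)%N -> (j < q)%N -> b i j = b' i j) -> w b = w b'.

Variables (M : nat -> nat) (m : nat -> nat -> bool) (n : nat).
Hypothesis Mm : forall i j, (i < n)%N -> (j < n)%N -> M (i * n + j) = m i j.

Lemma tri_small R :
  R 0 = 0 -> R 4 = 0 ->
  tri M (small_block n) R (4 * size (ord_pairs n) + 3)
    (fun R' => [/\ R' 0 = small n m, R' 1 = 1 & R' 4 = 0]).
Proof.
move=> R0 R4; have -> : 4 * size (ord_pairs n) + 3 = 4 * size (ord_pairs n) + 2 + 1 by lia.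
apply: tri_seq; apply: tri_weaken (leqnn _) _.
  apply: (tri_dtree _ (m := m) (A := fun i j => i * n + j)) => //.
  - by move=> [i j]; rewrite mem_ord_pairs /= => /andP[? ?]; apply: Mm.
  - by move=> p R' _ _; apply: tri_const.
move=> R' [H1 H2]; apply: tri_const => /=; split=> //; last by rewrite H2.
rewrite H1 R0 add0n; apply: small_ext => i j iN jN.
by apply: read_bits_in; rewrite mem_ord_pairs iN jN.
Qed.

Lemma tri_large R :
  R 0 = 0 -> R 1 = 0 -> env n [::] R ->
  tri M large_block R large_time.[n]%R
    (fun R' => [/\ R' 0 = nsum n (q + k)
                   (fun s => w (fun i j => m (nth 0 s i) (nth 0 s j))) [::],
                   R' 1 = nsum n q (fun=> D) [::] & R' 4 = 0]).
Proof.
move=> R0 R1 E; rewrite hornerD; apply: tri_seq.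
apply: tri_weaken (leqnn _) _.
  apply: (tri_loops (n := n) (k0 := q + k) (a := 0)
    (F := fun s => w (fun i j => m (nth 0 s i) (nth 0 s j))) _ _ (s := [::])) => //.
  move=> s R2 sz sn [E2 E3 E4 Ej].
  have szq i : i < q -> i < size s by rewrite sz; lia.
  have nths i : i < q -> nth 0 s i < n by move=> iq; apply: (all_nthP 0 sn); apply: szq.
  apply: tri_weaken (leqnn _) _.
    apply: (tri_dtree _ (m := fun i j => m (nth 0 s i) (nth 0 s j))
      (A := fun i j => nth 0 s i * n + nth 0 s j)) => //.
  - by move=> [i j]; rewrite mem_ord_pairs /= => /andP[? ?]; rewrite Mm ?nths.
  - move=> [i j] R'; rewrite mem_ord_pairs /= => /andP[iq jq] HR'; apply: tri_add.
    have [_ Ei] := Ej _ (szq _ iq); have [Ej' _] := Ej _ (szq _ jq).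
    by rewrite !HR' ?Ei ?Ej' //; lia.
  move=> R' [-> H2]; split; last by move=> r _ r5 r0; apply: H2.
  congr (_ + _)%N; apply: w_ext => i j iq jq.
  by apply: read_bits_in; rewrite mem_ord_pairs iq jq.
move=> R' [H1 H2]; have E' : env n [::] R' by apply: env_same E H2.
apply: tri_weaken (leqnn _) _.
  apply: (tri_loops (n := n) (k0 := q) (a := 1) (F := fun=> D) _ _ (s := [::])) => //.
  move=> s R2 sz sn [E2 E3 E4 Ej].
  apply: tri_weaken (leqnn _) _.
    exact: (tri_dtree _ (m := m) (A := fun _ _ => 0)).
  by move=> R'' [-> H3]; split=> // r _ r5 r1; apply: H3.
move=> R'' [-> H4]; split=> //; last by rewrite H4 //; case: E'.
  by rewrite H4 // H1 R0.
by rewrite H2 // R1.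
Qed.

Lemma tri_dispatch l j R :
  (l + j = N)%N -> (j <= n)%N -> R 0 = 0 -> R 1 = 0 -> env n [::] R ->
  tri M (dispatch l j) R (dispatch_time l j).[n]%R
    (fun R' => [/\ R' 0 = num_value m n, R' 1 = den_value n & R' 4 = 0]).
Proof.
elim: l j R => [|l IH] j R /= jN jn R0 R1 E.
  have nN : (n < N)%N = false by lia.
  by rewrite /num_value /den_value nN; apply: tri_large.
rewrite hornerD hornerC; set t := horner _ _; set z := size _.
have -> : (t + (4 * z + 7))%R = 1 + (1 + (t + (4 * z + 3) + 2)) :> nat.
  by rewrite -[LHS]/(t + (4 * z + 7))%N; clearbody t z; move: (t : nat) => t'; clear; lia.
have [E2 E3 E4 _] := E.
apply: tri_seq; apply: tri_const; apply: tri_seq; apply: tri_sub.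
set R' := [eta _ with 5 |-> _].
have R'E r : r <> 5 -> R' r = R r by rewrite /R' /=; case: eqP.
have R'5 : R' 5 = n - j by rewrite /R' /= E2.
have E' : env n [::] R' by split; rewrite ?R'E.
clearbody R'; apply: tri_if; rewrite R'5 => jn'.
  apply: tri_weaken (leq_addr _ _) _.
    by apply: IH E'; rewrite ?R'E //; lia.
  by move=> R'' [].
have nj : n = j by lia.
have nN : (n < N)%N by lia.
rewrite /num_value /den_value nN /z -nj.
apply: tri_weaken (leq_addl _ _) _.
  by apply: tri_small; rewrite R'E.
by [].
Qed.

Lemma tri_main R :
  R 0 = n -> R 1 = 0 -> R 4 = 0 ->
  tri M main_block R (dispatch_time N 0 + (3%N)%:P)%R.[n]%R
    (fun R' => R' 0 = num_value m n /\ R' 1 = den_value n).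
Proof.
move=> R0 R1 R4; rewrite hornerD hornerC; set t := horner _ _.
have -> : (t + 3%N)%R = 1 + (1 + (1 + t)) :> nat.
  by rewrite -[LHS]/(t + 3)%N; clearbody t; move: (t : nat) => t'; clear; lia.
apply: tri_seq; apply: tri_add; apply: tri_seq; apply: tri_const.
apply: tri_seq; apply: tri_const; apply: tri_weaken (leqnn _) _.
  apply: tri_dispatch => //=.
- by rewrite addn0.
- by split; rewrite /= ?R0 ?R4 ?addn0.
- by move=> R' [].
Qed.

End Program.

Lemma computable_quotient N q k D small w :
  (forall n b b', (forall i j, (i < n)%N -> (j < n)%N -> b i j = b' i j) ->
     small n b = small n b') ->
  (forall b b', (forall i j, (i < q)%N -> (j < q)%N -> b i j = b' i j) ->
     w b = w b') ->
  (forall n, 0 < den_value N q D n)%N ->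
  poly_time_computable (fun G =>
    (num_value N q k small w (adj_matrix G) #|G|)%:R / (den_value N q D #|G|)%:R)%R.
Proof.
move=> Hs Hw HD; exists (main_block N q k D small w 0).
exists (dispatch_time q k N 0 + (3%N)%:P)%R => G.
have /= := tri_main N k D Hs Hw (@init_memory G) (R := reg (init G)) erefl erefl erefl.
move=> /(_ [::] [::]) [t [R' [Ht E [H0 H1]]]].
exists t; first exact: Ht.
rewrite cats0 !cat0s add0n in E.
rewrite -[init G]/(Config 0 _ _) E /= /halted /= leqnn H0 H1.
by split.
Qed.

Local Open Scope ring_scope.

(** * Sums over finite product spaces *)

Section Resampling.
Variables (R : realFieldType).

Definition upd (I V : finType) (x : {ffun I -> V}) (i : I) (a : V) :
  {ffun I -> V} := [ffun j => if j == i then a else x j].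

Definition wt (I V : finType) (mu : I -> V -> R) (x : {ffun I -> V}) : R :=
  \prod_i mu i (x i).

Lemma wt_upd (I V : finType) (mu : I -> V -> R) x (i : I) a :
  wt mu (upd x i a) * mu i (x i) = wt mu x * mu i a.
Proof.
rewrite /wt (bigD1 i) //= [in RHS](bigD1 i) //= ffunE eqxx.
rewrite (eq_bigr (fun j => mu j (x j))); first by ring.
by move=> j /negPf ji; rewrite ffunE ji.
Qed.

(* (x, a) |-> (upd x i a, x i) is a weight-preserving involution. *)
Lemma sum_resample (I V : finType) (mu : I -> V -> R) i (Y : {ffun I -> V} -> R) :
  \sum_a mu i a = 1 ->
  \sum_x wt mu x * Y x = \sum_x wt mu x * \sum_a mu i a * Y (upd x i a).
Proof.
move=> mu1; under [RHS]eq_bigr do rewrite mulr_sumr.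
rewrite [RHS]pair_big /=.
pose h (p : {ffun I -> V} * V) := (upd p.1 i p.2, p.1 i).
have hK : cancel h h.
  move=> [x a]; rewrite /h /=; congr pair; last by rewrite ffunE eqxx.
  by apply/ffunP => j; rewrite !ffunE; case: eqP => // ->.
rewrite (reindex h) /=; last by apply: onW_bij; exists h.
transitivity (\sum_x \sum_a mu i a * (wt mu x * Y x)).
  by apply: eq_bigr => x _; rewrite -mulr_suml mu1 mul1r.
rewrite pair_big; apply: eq_bigr => -[x a] _ /=.
have -> : upd (upd x i a) i (x i) = x.
  by apply/ffunP => j; rewrite !ffunE; case: eqP => // ->.
by rewrite [RHS]mulrA wt_upd; ring.
Qed.

Lemma sum_wt (I V : finType) (mu : I -> V -> R) :
  (forall i, \sum_a mu i a = 1) -> \sum_x wt mu x = 1.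
Proof.
move=> mu1; rewrite /wt -(bigA_distr_bigA (fun i a => mu i a)) /=.
by apply: big1 => i _; apply: mu1.
Qed.

(** For uniform [x] the composite of [x] with [f] is uniform: exchanging [y] with the values of [x]
    along [f] is an involution on the pairs [(x, y)]. *)
Lemma sum_comp_inj (I J V : finType) (f : J -> I) (Y : {ffun J -> V} -> R) :
  injective f ->
  #|V|%:R ^+ #|J| * (\sum_(x : {ffun I -> V}) Y [ffun j => x (f j)]) =
  #|V|%:R ^+ #|I| * \sum_y Y y.
Proof.
move=> finj.
pose mix (x : {ffun I -> V}) (y : {ffun J -> V}) : {ffun I -> V} :=
  [ffun i => if [pick j | f j == i] is Some j then y j else x i].
have mixE x y j : mix x y (f j) = y j.
  rewrite ffunE; case: pickP => [k /eqP/finj-> //|/(_ j)].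
  by rewrite eqxx.
pose h (p : {ffun I -> V} * {ffun J -> V}) := (mix p.1 p.2, [ffun j => p.1 (f j)]).
have hK : cancel h h.
  move=> [x y]; rewrite /h /=; congr pair; apply/ffunP.
    move=> i; rewrite ffunE; case: pickP => [k /eqP<-|kN]; first by rewrite ffunE.
    by rewrite ffunE; case: pickP => // k; rewrite kN.
  by move=> j; rewrite ffunE mixE.
have cardF (K : finType) : #|V|%:R ^+ #|K| = \sum_(y : {ffun K -> V}) 1 :> R.
  by rewrite sumr_const card_ffun natrX.
rewrite !cardF !mulr_suml.
under eq_bigr do rewrite mul1r; under [RHS]eq_bigr do rewrite mul1r.
rewrite exchange_big /= !pair_big /= (reindex h) /=; last by apply: onW_bij; exists h.
apply: eq_bigr => -[x y] _ /=; congr Y; apply/ffunP => j.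
by rewrite ffunE mixE.
Qed.

(** Exchanging the coordinate [x i] with a free value [a] is an involution that turns the event
    [x i = x j] into [a = x j], where [x] determines [a]. *)
Lemma card_ffun_eq (I V : finType) (i j : I) : i != j ->
  (#|V| * #|[set x : {ffun I -> V} | x i == x j]| = #|V| ^ #|I|)%N.
Proof.
move=> ij.
pose h (p : V * {ffun I -> V}) := (p.2 i, upd p.2 i p.1).
have hK : cancel h h.
  move=> [a x]; rewrite /h /= ffunE eqxx; congr pair.
  by apply/ffunP => k; rewrite !ffunE; case: eqP => // ->.
have him : h @: setX [set: V] [set x : {ffun I -> V} | x i == x j] =
           [set p : V * {ffun I -> V} | p.1 == p.2 j].
  apply/setP => -[a x]; rewrite inE -[in LHS](hK (a, x)) mem_imset; last exact: can_inj hK.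
  rewrite in_setX in_setT inE /= !ffunE eqxx.
  by rewrite [j == i]eq_sym (negPf ij).
transitivity #|setX [set: V] [set x : {ffun I -> V} | x i == x j]|.
  by rewrite cardsX cardsT.
rewrite -(card_imset _ (can_inj hK)) him -card_ffun.
rewrite -[RHS](card_imset _ (f := fun x : {ffun I -> V} => (x j, x))); last by move=> x y [].
apply: eq_card => -[a x]; rewrite inE /=.
by apply/eqP/imsetP => [->|[y _ [-> ->]]] //; exists x.
Qed.

(** The birthday estimate: a union bound over the ordered pairs of coordinates. *)
Lemma card_noninj (I V : finType) :
  (#|V| * #|[set x : {ffun I -> V} | ~~ injectiveb x]| <= #|I| ^ 2 * #|V| ^ #|I|)%N.
Proof.
have sub : [set x : {ffun I -> V} | ~~ injectiveb x] \subset
    \bigcup_(p : I * I | p.1 != p.2) [set x : {ffun I -> V} | x p.1 == x p.2].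
  apply/subsetP => x; rewrite inE => /injectivePn[i [j ij E]].
  by apply/bigcupP; exists (i, j) => //; rewrite inE /= E.
apply: leq_trans (_ : #|V| * \sum_(p : I * I | p.1 != p.2)
    #|[set x : {ffun I -> V} | x p.1 == x p.2]| <= _)%N.
  rewrite leq_mul2l; apply/orP; right; apply: leq_trans (subset_leq_card sub) _.
  by elim/big_ind2: _ => [|A m B n Am Bn|p _];
    rewrite ?cards0 // (leq_trans (leq_card_setU _ _)) ?leq_add.
rewrite big_distrr /= (eq_bigr (fun=> #|V| ^ #|I|)%N) => [|[i j] ij]; last exact: card_ffun_eq.
rewrite sum_nat_const leq_mul2r; apply/orP; right.
by apply: leq_trans (max_card _) _; rewrite card_prod expnS expn1.
Qed.

End Resampling.

(** * Sampling averages and the counting lemma *)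

Section Counting.
Variables (R : realFieldType).

(** An injective [f] contributes no error by [sum_comp_inj]. At most a fraction [#|J| ^ 2 / #|I|] of
    the maps [f] is not injective, and each of these errs by at most 2. Every estimate of a mean
    over samples rests on this, with [J] equal to [T], [bool] or ['I_4]. *)
Lemma sampling_average (I J V : finType) (Y : {ffun J -> V} -> R) :
  (0 < #|I|)%N -> (0 < #|V|)%N -> (forall y, `|Y y| <= 1) ->
  `|(\sum_(x : {ffun I -> V}) \sum_(f : {ffun J -> I}) Y [ffun j => x (f j)])
      / (#|V|%:R ^+ #|I| * #|I|%:R ^+ #|J|)
    - (\sum_y Y y) / #|V|%:R ^+ #|J| | <= 2 * #|J|%:R ^+ 2 / #|I|%:R.
Proof.
move=> I0 V0 Y1.
have q0 : 0 < #|I|%:R :> R by rewrite ltr0n.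
have n0 : 0 < #|V|%:R :> R by rewrite ltr0n.
have qJ : 0 < #|I|%:R ^+ #|J| :> R by apply: exprn_gt0.
have nI : 0 < #|V|%:R ^+ #|I| :> R by apply: exprn_gt0.
have nJ : 0 < #|V|%:R ^+ #|J| :> R by apply: exprn_gt0.
have sumle (K : finType) (Z : {ffun K -> V} -> R) : (forall x, `|Z x| <= 1) ->
    `|(\sum_x Z x) / #|V|%:R ^+ #|K| | <= 1.
  move=> Z1; have nK : 0 < #|V|%:R ^+ #|K| :> R by apply: exprn_gt0.
  rewrite normrM normfV (gtr0_norm nK) ler_pdivrMr // mul1r.
  apply: le_trans (ler_norm_sum _ _ _) _; apply: le_trans (ler_sum _ (fun x _ => Z1 x)) _.
  by rewrite sumr_const card_ffun natrX.
pose D (f : {ffun J -> I}) := (\sum_(x : {ffun I -> V}) Y [ffun j => x (f j)]) / #|V|%:R ^+ #|I|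
  - (\sum_y Y y) / #|V|%:R ^+ #|J|.
have -> : (\sum_(x : {ffun I -> V}) \sum_(f : {ffun J -> I}) Y [ffun j => x (f j)])
      / (#|V|%:R ^+ #|I| * #|I|%:R ^+ #|J|)
    - (\sum_y Y y) / #|V|%:R ^+ #|J| = (\sum_f D f) / #|I|%:R ^+ #|J|.
  rewrite sumrB -mulr_suml sumr_const card_ffun exchange_big /=.
  rewrite -[_ *+ (_ ^ _)%N]mulr_natr natrX mulrBl; congr (_ - _); last by rewrite mulfK // gt_eqF.
  by rewrite invfM mulrA.
have D0 (f : {ffun J -> I}) : injectiveb f -> D f = 0.
  move=> /injectiveP /(sum_comp_inj Y) E; apply/eqP; rewrite subr_eq0; apply/eqP.
  apply/eqP; rewrite eqr_div ?lt0r_neq0 //; apply/eqP.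
  by rewrite [LHS]mulrC E [RHS]mulrC.
have D2 f : `|D f| <= 2.
  apply: le_trans (ler_normB _ _) _; rewrite -[2]/(1 + 1); apply: lerD; exact: sumle.
rewrite normrM normfV (gtr0_norm qJ) ler_pdivrMr // mulrAC.
rewrite ler_pdivlMr //.
apply: le_trans (_ : (\sum_(f : {ffun J -> I} | ~~ injectiveb f) 2) * #|I|%:R <= _).
  rewrite ler_pM2r //; apply: le_trans (ler_norm_sum _ _ _) _.
  rewrite [leRHS]big_mkcond /=; apply: ler_sum => f _.
  by case: ifPn => [_|/negbNE /D0 ->] //; rewrite normr0.
rewrite sumr_const -[2 *+ #|_|]mulr_natr -!mulrA ler_pM2l //.
have := card_noninj J I; have -> : #|[set x : {ffun J -> I} | ~~ injectiveb x]| = #|[pred x :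
  {ffun J -> I} | ~~ injectiveb x]|.
  by apply: eq_card => x; rewrite inE.
by move=> H; rewrite [in leRHS]mulrA -expr2 -!natrX -!natrM ler_nat mulnC.
Qed.

Lemma sum_ffun_bool (O : finType) (g : O -> O -> R) :
  \sum_(y : {ffun bool -> O}) g (y true) (y false) = \sum_a \sum_b g a b.
Proof.
rewrite [RHS]pair_big /=.
rewrite (reindex (fun p : O * O => [ffun b : bool => if b then p.1 else p.2])) /=.
  by apply: eq_bigr => p _; rewrite !ffunE.
apply: onW_bij; exists (fun y : {ffun bool -> O} => (y true, y false)).
  by move=> [a b]; rewrite !ffunE.
by move=> y; apply/ffunP => -[]; rewrite ffunE.
Qed.

Definition simple_pairs (F : finType) (L : seq (F * F)) : bool :=
  all (fun e => e.1 != e.2) L &&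
  pairwise (fun e e' => (e' != e) && (e' != (e.2, e.1))) L.

(** For the 0/1 kernel of a symmetric relation and the edge list of a graph this is the indicator of
    a homomorphism; general kernels allow densities as well. *)
Definition kprod (F O : finType) (g : F -> F -> O -> O -> R) (L : seq (F * F))
    (x : {ffun F -> O}) : R :=
  \prod_(e <- L) g e.1 e.2 (x e.1) (x e.2).

Lemma prod01 (T : Type) (r : seq T) (P : pred T) (f : T -> R) :
  (forall i, 0 <= f i <= 1) -> 0 <= \prod_(i <- r | P i) f i <= 1.
Proof.
move=> H; elim/big_rec: _ => [|i x _ /andP[x0 x1]]; first by rewrite ler01 lexx.
have /andP[f0 f1] := H i; by rewrite mulr_ge0 //= mulr_ile1.
Qed.

Section CountingLemma.
Variables (F O : finType) (mu : F -> O -> R).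
Hypothesis mu_ge0 : forall i a, 0 <= mu i a.
Hypothesis mu_sum : forall i, \sum_a mu i a = 1.
Variable eta : R.

Lemma wt_ge0 x : 0 <= wt mu x.
Proof. by apply: prodr_ge0. Qed.

(** When all coordinates except [u] and [v] are fixed, the product splits into a function of [x u]
    and a function of [x v], because no edge of [L] joins [u] and [v]. These are test functions for
    the cut norm of [z]. *)
Lemma kprod_edge (g : F -> F -> O -> O -> R) (z : O -> O -> R) (u v : F) L :
  (forall u v i j, 0 <= g u v i j <= 1) -> u != v ->
  all (fun e => (e != (u, v)) && (e != (v, u))) L ->
  (forall a b : O -> R, (forall i, 0 <= a i <= 1) -> (forall i, 0 <= b i <= 1) ->
    `|\sum_i \sum_j mu u i * mu v j * z i j * a i * b j| <= eta) ->
  `|\sum_x wt mu x * (z (x u) (x v) * kprod g L x)| <= eta.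
Proof.
move=> g01 uv HL Hz.
rewrite (sum_resample _ (mu_sum u)).
under eq_bigr do rewrite mulr_sumr.
rewrite exchange_big /=.
under eq_bigr => a _.
  under eq_bigr do rewrite mulrCA.
  rewrite -mulr_sumr.
  rewrite (sum_resample (fun x => z (upd x u a u) (upd x u a v) * kprod g L (upd x u a))
    (mu_sum v)).
  rewrite mulr_sumr; over.
rewrite exchange_big /=.
apply: le_trans (ler_norm_sum _ _ _) _.
rewrite -[leRHS]mul1r -(sum_wt mu_sum) mulr_suml; apply: ler_sum => x _.
pose y a b := upd (upd x v b) u a.
(* Edges at [u] avoid [v] and the edges in [B] avoid [u], so putting the same value at both vertices
   is harmless. *)
pose A i := \prod_(e <- L | (e.1 == u) || (e.2 == u)) g e.1 e.2 (y i i e.1) (y i i e.2).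
pose B j := \prod_(e <- L | ~~ ((e.1 == u) || (e.2 == u))) g e.1 e.2 (y j j e.1) (y j j e.2).
have yE i j w : y i j w = if w == u then i else if w == v then j else x w.
  by rewrite !ffunE.
have kE i j : kprod g L (y i j) = A i * B j.
  rewrite /kprod (bigID (fun e => (e.1 == u) || (e.2 == u))) /=; congr (_ * _).
    rewrite [LHS]big_seq_cond [RHS]big_seq_cond; apply: eq_bigr => e /andP[eL eu].
    have /andP[e1 e2] := allP HL _ eL.
    rewrite !yE; case: e {eL} eu e1 e2 => e f /=; rewrite !xpair_eqE.
    case: (eqVneq e u) => [->|eu]; case: (eqVneq f u) => [->|fu] //=; rewrite ?eqxx /= ?andbT.
      by move=> _ /negPf -> _.
    by move=> _ _ /negPf ->.
  apply: eq_bigr => -[e f] /=; rewrite negb_or !yE => /andP[/negPf -> /negPf ->].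
  by [].
have A01 i : 0 <= A i <= 1 by apply: prod01 => e; apply: g01.
have B01 i : 0 <= B i <= 1 by apply: prod01 => e; apply: g01.
apply: le_trans (_ : `|wt mu x * \sum_i \sum_j mu u i * mu v j * z i j * A i * B j| <= _).
  rewrite le_eqVlt; apply/orP; left; apply/eqP; congr (`| _ |).
  rewrite mulr_sumr; apply: eq_bigr => i _.
  rewrite mulrCA; congr (_ * _); rewrite mulr_sumr; apply: eq_bigr => j _.
  rewrite -/(y i j) -/(kprod g L (y i j)) kE !yE !eqxx eq_sym (negPf uv).
  ring.
rewrite normrM (ger0_norm (wt_ge0 x)) ler_wpM2l ?wt_ge0 //.
exact: Hz.
Qed.

(** Telescoping: the edges pass from [g] to [h] one at a time, and each exchange costs [eta] by
    [kprod_edge]. *)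
Lemma counting_lemma (g h : F -> F -> O -> O -> R) (L : seq (F * F)) :
  (forall u v i j, 0 <= g u v i j <= 1) -> (forall u v i j, 0 <= h u v i j <= 1) ->
  simple_pairs L ->
  (forall u v, (u, v) \in L ->
   forall a b : O -> R, (forall i, 0 <= a i <= 1) -> (forall i, 0 <= b i <= 1) ->
    `|\sum_i \sum_j mu u i * mu v j * (g u v i j - h u v i j) * a i * b j| <= eta) ->
  `|\sum_x wt mu x * kprod g L x - \sum_x wt mu x * kprod h L x| <= (size L)%:R * eta.
Proof.
move=> g01 h01.
(* [L0] lists the edges that already carry [h]. *)
suff gen L0 : simple_pairs (L0 ++ L) ->
  (forall u v, (u, v) \in L ->
   forall a b : O -> R, (forall i, 0 <= a i <= 1) -> (forall i, 0 <= b i <= 1) ->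
    `|\sum_i \sum_j mu u i * mu v j * (g u v i j - h u v i j) * a i * b j| <= eta) ->
  `|\sum_x wt mu x * (kprod h L0 x * (kprod g L x - kprod h L x))| <= (size L)%:R * eta.
  move=> simp Hc; apply: le_trans (gen [::] simp Hc).
  rewrite le_eqVlt; apply/orP; left; apply/eqP; congr (`| _ |).
  rewrite -sumrB; by apply: eq_bigr => x _; rewrite [kprod h [::] x]big_nil mul1r mulrBr.
elim: L L0 => [|[u v] L IH] L0 simp Hc.
  by rewrite mul0r big1 ?normr0 // => x _; rewrite /kprod !big_nil subrr !mulr0.
have -> : \sum_x wt mu x * (kprod h L0 x * (kprod g ((u, v) :: L) x - kprod h ((u, v) :: L) x))
   = \sum_x wt mu x * ((g u v (x u) (x v) - h u v (x u) (x v)) * (kprod h L0 x * kprod g L x))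
   + \sum_x wt mu x * (kprod h (rcons L0 (u, v)) x * (kprod g L x - kprod h L x)).
  rewrite -big_split; apply: eq_bigr => x _ /=.
  rewrite /kprod !big_cons -cats1 big_cat big_seq1 /=; ring.
apply: le_trans (ler_normD _ _) _.
rewrite /= -natr1 mulrDl mul1r addrC; apply: lerD.
  apply: IH; first by rewrite cat_rcons.
  by move=> u' v' H'; apply: Hc; rewrite inE H' orbT.
have [simp1 simp2] := andP simp.
have uv : u != v by move: simp1; rewrite all_cat /= => /and3P[].
have HL : all (fun e => (e != (u, v)) && (e != (v, u))) (L0 ++ L).
  move: simp2; rewrite pairwise_cat /= all_cat => /and3P[rel _ /andP[H _]].
  rewrite H andbT; apply/allP => -[e f] eL.
  have := allrelP rel _ _ eL (mem_head _ _).
  by rewrite /= !xpair_eqE ![v == _]eq_sym ![u == _]eq_sym [(f == u) && _]andbC.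
(* A single kernel family for both lists; it is consistent because [simple_pairs] keeps them
   disjoint. *)
pose k e1 e2 := if (e1, e2) \in L0 then h e1 e2 else g e1 e2.
have k01 a b i j : 0 <= k a b i j <= 1 by rewrite /k; case: ifP.
have kE x : kprod h L0 x * kprod g L x = kprod k (L0 ++ L) x.
  rewrite /kprod big_cat /=; congr (_ * _).
    by apply: eq_big_seq => -[a b] H; rewrite /k /= H.
  apply: eq_big_seq => -[a b] H; rewrite /k /=; case: ifP => // H0.
  move: simp2; rewrite pairwise_cat /= => /andP[/allrelP rel _].
  by have := rel (a, b) (a, b) H0; rewrite inE H orbT eqxx => /(_ isT).
under eq_bigr do rewrite kE.
apply: (kprod_edge (z := fun i j => g u v i j - h u v i j) k01 uv HL).
by apply: Hc; rewrite mem_head.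
Qed.

End CountingLemma.
End Counting.

(** * Regularity *)

Section Sums.
Variable R : realFieldType.

(** Lagrange's identity: twice the gap is the sum of the squares [(a i * b j - a j * b i) ^ 2]. *)
Lemma cauchy_schwarz (I : finType) (P : pred I) (a b : I -> R) :
  (\sum_(i | P i) a i * b i) ^+ 2 <=
  (\sum_(i | P i) a i ^+ 2) * (\sum_(i | P i) b i ^+ 2).
Proof.
have : 0 <= \sum_(i | P i) \sum_(j | P j) (a i * b j - a j * b i) ^+ 2.
  by apply: sumr_ge0 => i _; apply: sumr_ge0 => j _; rewrite sqr_ge0.
have -> : \sum_(i | P i) \sum_(j | P j) (a i * b j - a j * b i) ^+ 2 =
   (\sum_(i | P i) a i ^+ 2) * (\sum_(i | P i) b i ^+ 2) *+ 2
   - (\sum_(i | P i) a i * b i) ^+ 2 *+ 2.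
  have E1 : (\sum_(i | P i) a i ^+ 2) * (\sum_(i | P i) b i ^+ 2) =
      \sum_(i | P i) \sum_(j | P j) a i ^+ 2 * b j ^+ 2.
    by rewrite big_distrl; apply: eq_bigr => i _; rewrite big_distrr.
  have E2 : (\sum_(i | P i) a i ^+ 2) * (\sum_(i | P i) b i ^+ 2) =
      \sum_(i | P i) \sum_(j | P j) a j ^+ 2 * b i ^+ 2.
    by rewrite E1 exchange_big.
  have E3 : (\sum_(i | P i) a i * b i) ^+ 2 =
      \sum_(i | P i) \sum_(j | P j) (a i * b i) * (a j * b j).
    by rewrite expr2 big_distrl; apply: eq_bigr => i _; rewrite big_distrr.
  rewrite mulr2n {1}E1 E2 E3 -sumrMnl -big_split -sumrB; apply: eq_bigr => i _.
  rewrite -sumrMnl -big_split -sumrB; apply: eq_bigr => j _ /=; ring.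
by rewrite subr_ge0 ler_pMn2r.
Qed.

Lemma sum_in01_le (I : finType) (a z : I -> R) :
  (forall i, 0 <= a i <= 1) -> \sum_i z i * a i <= \sum_(i | 0 < z i) z i.
Proof.
move=> a01; rewrite [leRHS]big_mkcond; apply: ler_sum => i _.
have /andP[a0 a1] := a01 i; case: ltP => zi.
  by rewrite ler_piMr // ltW.
by rewrite mulr_le0_ge0.
Qed.

(* A bilinear form on [0,1]-valued functions is extremal at indicators. *)
Lemma cut_norm_functions (V : finType) (X : V -> V -> R) (eta : R) :
  (forall A B : {set V}, `|\sum_(i in A) \sum_(j in B) X i j| <= eta) ->
  forall a b : V -> R, (forall i, 0 <= a i <= 1) -> (forall i, 0 <= b i <= 1) ->
  `|\sum_i \sum_j X i j * a i * b j| <= eta.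
Proof.
move=> HX a b a01 b01.
suff upper (Y : V -> V -> R) :
    (forall A B : {set V}, `|\sum_(i in A) \sum_(j in B) Y i j| <= eta) ->
    \sum_i \sum_j Y i j * a i * b j <= eta.
  rewrite ler_norml upper // andbT lerNl.
  have := upper (fun i j => - X i j);
    rewrite (_ : \sum_i \sum_j - X i j * a i * b j = - \sum_i \sum_j X i j * a i * b j).
    apply => A B; rewrite (_ : \sum_(i in A) _ = - \sum_(i in A) \sum_(j in B) X i j) ?normrN //.
    by rewrite -sumrN; apply: eq_bigr => i _; rewrite sumrN.
  rewrite -sumrN; apply: eq_bigr => i _; rewrite -sumrN; apply: eq_bigr => j _.
  by rewrite !mulNr.
move=> HY.
pose z i := \sum_j Y i j * b j.
pose A := [set i | 0 < z i].
pose B := [set j | 0 < \sum_(i in A) Y i j].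
apply: le_trans (_ : \sum_i z i * a i <= _).
  apply: ler_sum => i _; rewrite mulr_suml; apply: ler_sum => j _.
  by rewrite mulrAC.
apply: le_trans (sum_in01_le z a01) _.
apply: le_trans (_ : \sum_j (\sum_(i in A) Y i j) * b j <= _).
  rewrite le_eqVlt; apply/orP; left; apply/eqP.
  under [RHS]eq_bigr do rewrite mulr_suml.
  by rewrite [RHS]exchange_big /=; apply: eq_bigl => i; rewrite inE.
apply: le_trans (sum_in01_le _ b01) _.
apply: le_trans (ler_norm _) _; apply: le_trans (HY A B).
rewrite le_eqVlt; apply/orP; left; apply/eqP; congr (`| _ |).
by rewrite [RHS]exchange_big /=; apply: eq_bigl => j; rewrite inE.
Qed.

End Sums.

(** * Averages over pairs of cells *)

Section Projection.
Variables (R : realFieldType) (V K : finType) (c : V -> K).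
Implicit Types (X g : V -> V -> R).

Definition cls (u : V) : {set V} := [set v | c v == c u].

(** Conditional expectation on products of colour classes. Indexing by vertices keeps every class
    nonempty and weights a pair of classes by the product of its sizes. *)
Definition proj X (u v : V) : R :=
  (\sum_(i in cls u) \sum_(j in cls v) X i j) / (#|cls u|%:R * #|cls v|%:R).

Lemma cls_refl u : u \in cls u. Proof. by rewrite inE. Qed.

Lemma cls_sym u v : (u \in cls v) = (v \in cls u).
Proof. by rewrite !inE eq_sym. Qed.

Lemma cls_eq u v : c u = c v -> cls u = cls v.
Proof. by rewrite /cls => ->. Qed.

Lemma card_cls_gt0 u : 0 < #|cls u|%:R :> R.
Proof. by rewrite ltr0n; apply/card_gt0P; exists u; apply: cls_refl. Qed.

Definition invariant2 g := forall u v u' v', c u = c u' -> c v = c v' -> g u v = g u' v'.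

Lemma proj_invariant X : invariant2 (proj X).
Proof. by move=> u v u' v' Eu Ev; rewrite /proj (cls_eq Eu) (cls_eq Ev). Qed.

(** Averaging is self-adjoint and fixes [g]. The proof exchanges the vertices at which the average
    is taken with those over which it is taken. *)
Lemma sum_proj X g : invariant2 g ->
  \sum_u \sum_v proj X u v * g u v = \sum_u \sum_v X u v * g u v.
Proof.
move=> ginv.
pose f (u v i j : V) : R := X i j * g i j / (#|cls i|%:R * #|cls j|%:R).
transitivity (\sum_u \sum_v \sum_(i in cls u) \sum_(j in cls v) f u v i j).
  apply: eq_bigr => u _; apply: eq_bigr => v _.
  rewrite /proj mulrAC mulr_suml mulr_suml; apply: eq_bigr => i iu.
  rewrite mulr_suml mulr_suml; apply: eq_bigr => j jv.
  move: iu jv; rewrite !inE => /eqP iu /eqP jv.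
  by rewrite /f (cls_eq iu) (cls_eq jv) (ginv _ _ _ _ iu jv).
transitivity (\sum_i \sum_j \sum_(u in cls i) \sum_(v in cls j) f u v i j).
  pose S u v i j := if (i \in cls u) && (j \in cls v) then f u v i j else 0.
  have toS u v : \sum_(i in cls u) \sum_(j in cls v) f u v i j = \sum_i \sum_j S u v i j.
    rewrite big_mkcond; apply: eq_bigr => i _; rewrite /S; case: ifP => _ /=.
      by rewrite big_mkcond.
    by rewrite big1.
  have toS' i j : \sum_(u in cls i) \sum_(v in cls j) f u v i j = \sum_u \sum_v S u v i j.
    rewrite big_mkcond; apply: eq_bigr => u _; rewrite /S cls_sym; case: ifP => _ /=.
      by rewrite big_mkcond; apply: eq_bigr => v _; rewrite cls_sym.
    by rewrite big1.
  under eq_bigr => u _ do under eq_bigr => v _ do rewrite toS.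
  under [RHS]eq_bigr => i _ do under eq_bigr => j _ do rewrite toS'.
  rewrite pair_big [RHS]pair_big /=; under eq_bigr do rewrite pair_big /=.
  under [RHS]eq_bigr do rewrite pair_big /=.
  by rewrite exchange_big.
apply: eq_bigr => i _; apply: eq_bigr => j _; rewrite /f.
rewrite !sumr_const -!mulrnA -[_ *+ (_ * _)]mulr_natr natrM mulrC.
have ci := lt0r_neq0 (card_cls_gt0 i); have cj := lt0r_neq0 (card_cls_gt0 j).
by field; rewrite ci cj.
Qed.

Lemma proj01 X u v : (forall i j, 0 <= X i j <= 1) -> 0 <= proj X u v <= 1.
Proof.
move=> X01; have c0 := mulr_gt0 (card_cls_gt0 u) (card_cls_gt0 v).
apply/andP; split.
  apply: divr_ge0; last exact: ltW.
  by apply: sumr_ge0 => i _; apply: sumr_ge0 => j _; case/andP: (X01 i j).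
rewrite ler_pdivrMr // mul1r.
apply: le_trans (_ : \sum_(i in cls u) \sum_(j in cls v) 1 <= _).
  by apply: ler_sum => i _; apply: ler_sum => j _; case/andP: (X01 i j).
by rewrite !sumr_const -mulrnA natrM mulrC.
Qed.

Lemma sum_proj1 X : \sum_u \sum_v proj X u v = \sum_u \sum_v X u v.
Proof.
have := @sum_proj X (fun _ _ => 1) (fun _ _ _ _ _ _ => erefl).
by under eq_bigr do under eq_bigr do rewrite mulr1;
   under [in RHS]eq_bigr do under eq_bigr do rewrite mulr1.
Qed.

End Projection.

(** * Regular pairs of cells *)

Section Regular.
Variables (R : realFieldType) (V : finType).

(** The deviation is compared with the product of the full class sizes, so for [X] with values in
    [0,1] very small subsets are never witnesses. *)
Definition irregular (K : finType) (delta : R) (c : V -> K) (X : V -> V -> R) (u v : V)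
    (p : {set V} * {set V}) : bool :=
  delta * (#|cls c u|%:R * #|cls c v|%:R) <
  `|\sum_(i in p.1 :&: cls c u) \sum_(j in p.2 :&: cls c v) (X i j - proj c X i j)|.

Definition bad (K : finType) (delta : R) (c : V -> K) (X : V -> V -> R) (u v : V) : bool :=
  [exists p, irregular delta c X u v p].

Lemma regular_functions (K : finType) (delta : R) (c : V -> K) (X : V -> V -> R) u v :
  ~~ bad delta c X u v ->
  forall a b : V -> R, (forall i, 0 <= a i <= 1) -> (forall i, 0 <= b i <= 1) ->
  `|\sum_(i in cls c u) \sum_(j in cls c v) (X i j - proj c X i j) * a i * b j|
    <= delta * (#|cls c u|%:R * #|cls c v|%:R).
Proof.
move=> /existsPn reg a b a01 b01.
pose Y i j := if (i \in cls c u) && (j \in cls c v) then X i j - proj c X i j else 0.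
have YE (Z : V -> V -> R) (A B : {set V}) : \sum_(i in A) \sum_(j in B) Y i j * Z i j =
    \sum_(i in A :&: cls c u) \sum_(j in B :&: cls c v) (X i j - proj c X i j) * Z i j.
  under [RHS]eq_bigl do rewrite inE.
  rewrite big_mkcondr /=; apply: eq_bigr => i _; rewrite /Y.
  case: ifP => _ /=; last by rewrite big1 // => j _; rewrite mul0r.
  under [RHS]eq_bigl do rewrite inE.
  by rewrite [RHS]big_mkcondr /=; apply: eq_bigr => j _; case: ifP; rewrite ?mul0r.
have := cut_norm_functions (X := Y) (eta := delta * (#|cls c u|%:R * #|cls c v|%:R)) _ a01 b01.
rewrite (_ : \sum_i \sum_j Y i j * a i * b j =
  \sum_(i in cls c u) \sum_(j in cls c v) (X i j - proj c X i j) * a i * b j).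
  apply => A B; have := reg (A, B); rewrite -leNgt /=; congr (`| _ | <= _).
  have /= := YE (fun _ _ => 1) A B.
  by under eq_bigr do under eq_bigr do rewrite mulr1;
     under [in RHS]eq_bigr do under eq_bigr do rewrite mulr1.
have := YE (fun i j => a i * b j) setT setT; rewrite !setTI.
under eq_bigl do rewrite inE.
under eq_bigr => i _ do under eq_bigl do rewrite inE.
under eq_bigr => i _ do under eq_bigr => j _ do rewrite mulrA.
by move=> ->; apply: eq_bigr => i _; apply: eq_bigr => j _; rewrite mulrA.
Qed.

(** After averaging over pairs of classes, a regular pair contributes at most [delta] per vertex
    pair and a bad one at most 1. The bad ones have weight at most [delta * #|V| ^ 2], whence the
    factor 2. *)
Lemma regular_cut_norm (K : finType) (delta : R) (c : V -> K) (X : V -> V -> R) :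
  0 <= delta -> (forall i j, 0 <= X i j <= 1) ->
  \sum_u \sum_v (bad delta c X u v)%:R <= delta * #|V|%:R ^+ 2 ->
  forall a b : V -> R, (forall i, 0 <= a i <= 1) -> (forall i, 0 <= b i <= 1) ->
  `|\sum_i \sum_j (X i j - proj c X i j) * a i * b j| <= 2 * delta * #|V|%:R ^+ 2.
Proof.
move=> d0 X01 few a b a01 b01.
rewrite -(sum_proj1 c (fun i j => (X i j - proj c X i j) * a i * b j)).
apply: le_trans (ler_norm_sum _ _ _) _.
apply: le_trans (_ : \sum_u \sum_v (delta + (bad delta c X u v)%:R) <= _); last first.
  under eq_bigr do rewrite big_split /= sumr_const.
  rewrite big_split /= sumr_const -mulrnA -[_ *+ (_ * _)]mulr_natr natrM.
  by rewrite -expr2; move: few; lra.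
apply: ler_sum => u _; apply: le_trans (ler_norm_sum _ _ _) _; apply: ler_sum => v _.
have c0 := mulr_gt0 (card_cls_gt0 R c u) (card_cls_gt0 R c v).
rewrite {1}/proj normrM normfV (gtr0_norm c0) ler_pdivrMr //.
have [bd|reg] := boolP (bad delta c X u v); last by rewrite addr0 regular_functions.
apply: le_trans (_ : 1 * (#|cls c u|%:R * #|cls c v|%:R) <= _); last first.
  by rewrite ler_wpM2r // ?(ltW c0) // mulr1n lerDr.
have -> : 1 * (#|cls c u|%:R * #|cls c v|%:R) =
    \sum_(i in cls c u) \sum_(j in cls c v) (1 : R).
  by rewrite !sumr_const -mulrnA mul1r -natrM mulnC.
apply: le_trans (ler_norm_sum _ _ _) _; apply: ler_sum => i _.
apply: le_trans (ler_norm_sum _ _ _) _; apply: ler_sum => j _.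
have /andP[X0 X1] := X01 i j; have /andP[P0 P1] := proj01 c i j X01.
have /andP[a0 a1] := a01 i; have /andP[b0 b1] := b01 j.
rewrite !normrM (ger0_norm a0) (ger0_norm b0).
rewrite mulr_ile1 ?mulr_ge0 ?normr_ge0 // mulr_ile1 // ler_norml.
by apply/andP; split; lra.
Qed.

End Regular.

(** * Energy of a partition *)

Section Energy.
Variables (R : realFieldType) (V : finType).

Definition energy (K : finType) (c : V -> K) (X : V -> V -> R) : R :=
  \sum_u \sum_v proj c X u v ^+ 2.

Variables (K K' : finType) (c : V -> K) (c' : V -> K') (X : V -> V -> R).
Hypothesis refines : forall u v, c' u = c' v -> c u = c v.

(** [proj c X] is constant on the cells of the refinement [c'], hence orthogonal to
    [proj c' X - proj c X]. *)
Lemma energy_pythagoras :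
  \sum_u \sum_v (proj c' X u v - proj c X u v) ^+ 2 = energy c' X - energy c X.
Proof.
have inv : invariant2 c' (proj c X).
  by move=> u v u' v' /refines Eu /refines Ev; apply: proj_invariant.
have E1 : \sum_u \sum_v proj c' X u v * proj c X u v = energy c X.
  rewrite (sum_proj X inv) -(sum_proj X (proj_invariant (c := c) X)).
  by [].
have -> : energy c' X - energy c X = energy c' X + energy c X -
  \sum_u \sum_v proj c' X u v * proj c X u v *+ 2.
  under eq_bigr do rewrite sumrMnl.
  rewrite sumrMnl E1 mulr2n; ring.
rewrite /energy -big_split -sumrB; apply: eq_bigr => u _.
rewrite -big_split -sumrB; apply: eq_bigr => v _ /=; ring.
Qed.

(** The gain is the squared norm of the difference [D] of the projections. On a bad pair of classes,
    Cauchy-Schwarz against the indicator [g] of the witness shows that the mean of [D ^ 2] is at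
    least [delta ^ 2]. *)
Lemma energy_increment (delta : R) :
  0 <= delta ->
  (forall u v, bad delta c X u v -> exists2 p, irregular delta c X u v p &
     forall i j, c' i = c' j -> (i \in p.1) = (j \in p.1) /\ (i \in p.2) = (j \in p.2)) ->
  energy c X + delta ^+ 2 * \sum_u \sum_v (bad delta c X u v)%:R <= energy c' X.
Proof.
move=> d0 Hbad; rewrite addrC -lerBrDr -energy_pythagoras.
pose D i j := proj c' X i j - proj c X i j.
(* Localisation: [D ^ 2] is replaced by its mean over each pair of classes of [c], so that bad pairs
   can be treated separately. *)
rewrite -[leRHS](sum_proj1 c (fun i j => D i j ^+ 2)).
rewrite mulr_sumr; apply: ler_sum => u _; rewrite mulr_sumr; apply: ler_sum => v _.
have N0 := mulr_gt0 (card_cls_gt0 R c u) (card_cls_gt0 R c v).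
have D2 : 0 <= \sum_(i in cls c u) \sum_(j in cls c v) D i j ^+ 2.
  by apply: sumr_ge0 => i _; apply: sumr_ge0 => j _; apply: sqr_ge0.
have [bd|_] := boolP (bad delta c X u v); last by rewrite mulr0 divr_ge0 // ltW.
have [[A B] irr AB] := Hbad _ _ bd.
rewrite mulr1 ler_pdivlMr //.
pose g i j : R := ((i \in A :&: cls c u) && (j \in B :&: cls c v))%:R.
have restrict Y : \sum_(i in A :&: cls c u) \sum_(j in B :&: cls c v) Y i j =
    \sum_i \sum_j Y i j * g i j :> R.
  rewrite big_mkcond; apply: eq_bigr => i _; rewrite /g; case: ifP => _ /=; last first.
    by rewrite big1 // => j _; rewrite mulr0.
  by rewrite big_mkcond; apply: eq_bigr => j _; case: ifP => _; rewrite ?mulr1 ?mulr0.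
have ginv : invariant2 c' g.
  move=> i j i' j' Ei Ej; rewrite /g !inE (refines Ei) (refines Ej).
  by have [-> _] := AB _ _ Ei; have [_ ->] := AB _ _ Ej.
(* [g] is constant on the cells of [c'], so [X] may be exchanged for [proj c' X] when tested against
   it. *)
have SE : \sum_(i in A :&: cls c u) \sum_(j in B :&: cls c v) (X i j - proj c X i j) =
    \sum_(i in cls c u) \sum_(j in cls c v) g i j * D i j.
  have sumB (Y Z : V -> V -> R) : \sum_i \sum_j (Y i j - Z i j) * g i j =
      \sum_i \sum_j Y i j * g i j - \sum_i \sum_j Z i j * g i j.
    rewrite -sumrB; apply: eq_bigr => i _; rewrite -sumrB; apply: eq_bigr => j _.
    by rewrite mulrBl.
  rewrite restrict sumB -(sum_proj X ginv) -sumB -restrict.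
  rewrite big_mkcond [RHS]big_mkcond; apply: eq_bigr => i _.
  rewrite /g !inE; case: (i \in A); case: eqP => //= _; last by rewrite big1 // => j _;
    rewrite mul0r.
  rewrite big_mkcond [RHS]big_mkcond; apply: eq_bigr => j _; rewrite !inE.
  by case: (j \in B); case: eqP => //= _; rewrite ?mul1r ?mul0r.
have CS : (\sum_(i in cls c u) \sum_(j in cls c v) g i j * D i j) ^+ 2 <=
    (#|cls c u|%:R * #|cls c v|%:R) * \sum_(i in cls c u) \sum_(j in cls c v) D i j ^+ 2.
  rewrite !pair_big; apply: le_trans (cauchy_schwarz _ _ _) _.
  rewrite ler_wpM2r ?sumr_ge0 // => [p _|]; first exact: sqr_ge0.
  rewrite -natrM -cardsX -sumr_const;
    apply: le_trans (_ : \sum_(p | (p.1 \in cls c u) && (p.2 \in cls c v)) 1 <= _).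
    by apply: ler_sum => p _; rewrite /g; case: (_ && _); rewrite ?expr1n ?expr0n.
  by rewrite le_eqVlt; apply/orP; left; apply/eqP/eq_bigl => -[i j]; rewrite in_setX.
rewrite -(ler_pM2l N0); apply: le_trans _ CS; rewrite -SE.
have := irr; rewrite /irregular /= => lt.
rewrite -[leRHS]real_normK ?num_real //.
apply: le_trans (_ : (delta * (#|cls c u|%:R * #|cls c v|%:R)) ^+ 2 <= _); last first.
  by rewrite lerXn2r ?nnegrE ?mulr_ge0 ?normr_ge0 // ltW.
rewrite le_eqVlt; apply/orP; left; apply/eqP; ring.
Qed.

End Energy.

(** * Iterated refinement *)

Section RegularityLemma.

(** A stage records, for each pair of old colours, membership in the two sets of its witness. The
    size of the palette thus depends on the number of stages alone and not on the graph. *)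
Fixpoint refined_color (s : nat) : finType :=
  if s is s'.+1 then
    (refined_color s' * {set refined_color s' * refined_color s'}
                      * {set refined_color s' * refined_color s'})%type
  else unit.

Variables (R : realFieldType) (delta : R) (V : finType) (X : V -> V -> R).

(** One witness per pair of colours, not of vertices, keeps the palette bounded; [irregular_color]
    makes it serve all vertices of these colours. Regular pairs get empty sets, which split
    nothing. *)
Definition witness (K : finType) (c : V -> K) (p : K * K) : {set V} * {set V} :=
  odflt (set0, set0)
    [pick AB | [exists u, exists v, [&& c u == p.1, c v == p.2
                                     & irregular delta c X u v AB]]].

Fixpoint refinement (s : nat) : V -> refined_color s :=
  if s is s'.+1 return V -> refined_color s then
    fun v => (refinement s' v,
      [set p | v \in (witness (refinement s') p).1],
      [set p | v \in (witness (refinement s') p).2])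
  else fun _ => tt.

Lemma irregular_color (K : finType) (c : V -> K) u v u' v' AB :
  c u = c u' -> c v = c v' ->
  irregular delta c X u v AB = irregular delta c X u' v' AB.
Proof. by move=> Eu Ev; rewrite /irregular (cls_eq Eu) (cls_eq Ev). Qed.

Lemma energy_refinement s : 0 <= delta ->
  energy (refinement s) X
    + delta ^+ 2 * \sum_u \sum_v (bad delta (refinement s) X u v)%:R
  <= energy (refinement s.+1) X.
Proof.
move=> d0; apply: energy_increment => //; first by move=> u v /= [].
move=> u v /existsP[AB irr].
exists (witness (refinement s) (refinement s u, refinement s v)).
  rewrite /witness; case: pickP => [AB'|/(_ AB)/existsP[]] /=; last first.
    by exists u; apply/existsP; exists v; rewrite !eqxx.
  move=> /existsP[u' /existsP[v' /and3P[/eqP Eu /eqP Ev]]].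
  by rewrite (irregular_color _ Eu Ev).
move=> i j /= [_ /setP E1 /setP E2]; split.
  by have := E1 (refinement s u, refinement s v); rewrite !inE.
by have := E2 (refinement s u, refinement s v); rewrite !inE.
Qed.

Lemma energy_le (K : finType) (c : V -> K) :
  (forall i j, 0 <= X i j <= 1) -> energy c X <= #|V|%:R ^+ 2.
Proof.
move=> X01; apply: le_trans (_ : \sum_(u : V) \sum_(v : V) 1 <= _).
  apply: ler_sum => u _; apply: ler_sum => v _.
  by have /andP[P0 P1] := proj01 c u v X01; rewrite expr_le1.
by rewrite !sumr_const -mulrnA natrM expr2.
Qed.

End RegularityLemma.

Lemma bad_kernel (R : realFieldType) (V K K' : finType) (delta : R) (c : V -> K)
    (c' : V -> K') X u v :
  (forall i j, (c i == c j) = (c' i == c' j)) ->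
  bad delta c X u v = bad delta c' X u v.
Proof.
move=> E; have EC w : cls c w = cls c' w by apply/setP => i; rewrite !inE.
have P i j : proj c X i j = proj c' X i j by rewrite /proj !EC.
rewrite /bad; apply: eq_existsb => p; rewrite /irregular !EC.
by under eq_bigr do under eq_bigr do rewrite P.
Qed.

Lemma inj_ord (K : finType) k : (#|K| <= k.+1)%N -> exists f : K -> 'I_k.+1, injective f.
Proof.
move=> Kk; exists (fun x => widen_ord Kk (enum_rank x)) => x y /(congr1 val) /= E.
by apply: enum_rank_inj; apply: val_inj.
Qed.

(** If the first [S] partitions were all too irregular, each step would raise the energy by at least
    [delta ^ 3 * #|V| ^ 2], and [S] steps would exceed the bound [#|V| ^ 2]. *)
Lemma regularity (R : realType) (delta : R) : 0 < delta ->
  exists k, forall (V : finType) (X : V -> V -> R), (forall i j, 0 <= X i j <= 1) ->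
  exists c : V -> 'I_k.+1,
    \sum_u \sum_v (bad delta c X u v)%:R <= delta * #|V|%:R ^+ 2.
Proof.
move=> d0; pose S := (Num.truncn (delta ^- 3)).+1.
have HS : 1 < S%:R * delta ^+ 3.
  by rewrite -ltr_pdivrMr ?exprn_gt0 // mul1r; apply: truncnS_gt.
(* The stage that succeeds depends on the graph; the sum bounds the palettes of all stages at
   once. *)
exists (\sum_(s < S) #|refined_color s|)%N => V X X01.
have [V0|Vpos] := posnP #|V|.
  exists (fun=> ord0); rewrite V0 big1; first by rewrite expr0n mulr0.
  by move=> u; have := fintype0 u V0.
pose nbad s := \sum_u \sum_v (bad delta (refinement delta X s) X u v)%:R : R.
have n0 : 0 < #|V|%:R ^+ 2 :> R by rewrite exprn_gt0 // ltr0n.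
have [s sS Hs] : exists2 s, (s < S)%N & nbad s <= delta * #|V|%:R ^+ 2.
  have [/existsP[s Hs]|/existsPn none] := boolP [exists s : 'I_S, nbad s <= delta * #|V|%:R ^+ 2].
    by exists s.
  have grow s : (s <= S)%N -> s%:R * (delta ^+ 3 * #|V|%:R ^+ 2) <= energy (refinement delta X
    s) X.
    elim: s => [|s IH] sS.
      rewrite mul0r; apply: sumr_ge0 => u _; apply: sumr_ge0 => v _; exact: sqr_ge0.
    apply: le_trans (energy_refinement X s (ltW d0)).
    rewrite -natr1 mulrDl mul1r; apply: lerD; first exact: IH (ltnW sS).
    rewrite exprSr -mulrA ler_wpM2l ?sqr_ge0 //.
    by have := none (Ordinal sS); rewrite -ltNge => /ltW.
  have := le_trans (grow S (leqnn S)) (energy_le _ X01).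
  by rewrite mulrA ger_pMl // leNgt HS.
have [f finj] : exists f : refined_color s -> 'I_(\sum_(s < S) #|refined_color s|)%N.+1,
  injective f.
  by apply: inj_ord; rewrite ltnW // ltnS (bigD1 (Ordinal sS)) //= leq_addr.
exists (f \o refinement delta X s); apply: le_trans Hs.
rewrite le_eqVlt; apply/orP; left; apply/eqP.
apply: eq_bigr => u _; apply: eq_bigr => v _; congr ((nat_of_bool _)%:R).
by apply: bad_kernel => i j /=; rewrite inj_eq.
Qed.

(** * Homomorphisms and the reduced graph *)

Definition ghom (T : sgraph) (V : finType) (A : rel V) (x : {ffun T -> V}) : bool :=
  [forall u, forall v, adj u v ==> A (x u) (x v)].

Lemma ghomP (T : sgraph) (V : finType) (A : rel V) (x : {ffun T -> V}) :
  reflect (forall u v, adj u v -> A (x u) (x v)) (ghom A x).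
Proof.
apply: (iffP forallP) => [H u v uv|H u]; first by have /forallP/(_ v)/implyP := H u; apply.
by apply/forallP => v; apply/implyP; apply: H.
Qed.

Definition edge_list (T : sgraph) : seq (T * T) :=
  [seq e <- enum {: T * T} | adj e.1 e.2 && (enum_rank e.1 < enum_rank e.2)%N].

Lemma mem_edge_list (T : sgraph) (u v : T) :
  ((u, v) \in edge_list T) = adj u v && (enum_rank u < enum_rank v)%N.
Proof. by rewrite mem_filter mem_enum andbT. Qed.

Lemma size_edge_list (T : sgraph) : (size (edge_list T) <= #|T| ^ 2)%N.
Proof.
by rewrite size_filter (leq_trans (count_size _ _)) // -cardE card_prod expnS expn1.
Qed.

Lemma simple_edge_list (T : sgraph) : simple_pairs (edge_list T).
Proof.
apply/andP; split.
  apply/allP => -[u v]; rewrite mem_edge_list => /andP[_ lt] /=.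
  by apply: contraTneq lt => ->; rewrite ltnn.
have U : uniq (edge_list T) by rewrite filter_uniq // enum_uniq.
apply: (@sub_in_pairwise _ (mem (edge_list T)) [rel x y | x != y] _ _ _ (allss _));
  last by rewrite -uniq_pairwise.
move=> [a b] [a' b']; rewrite !mem_edge_list /= => /andP[_ ab] /andP[_ ab'] ne.
rewrite eq_sym ne /=; apply: contraTneq ab' => -[-> ->].
by rewrite -leqNgt ltnW.
Qed.

Lemma ghom_kprod (R : realFieldType) (T : sgraph) (V : finType) (A : rel V)
    (x : {ffun T -> V}) :
  symmetric A ->
  kprod (fun _ _ i j => (A i j)%:R) (edge_list T) x = (ghom A x)%:R :> R.
Proof.
move=> Asym; rewrite /kprod; have [/ghomP xA|xN] := boolP (ghom A x).
  rewrite big_seq big1 // => -[u v]; rewrite mem_edge_list => /andP[uv _] /=.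
  by rewrite xA.
have [e eL eN] : exists2 e, e \in edge_list T & ~~ A (x e.1) (x e.2).
  apply/hasP; apply: contraNT xN => /hasPn H; apply/ghomP => u v uv.
  have [lt|gt|E] := ltngtP (enum_rank u) (enum_rank v).
  - by have := H (u, v); rewrite mem_edge_list uv lt => /(_ isT); rewrite negbK.
  - by have := H (v, u); rewrite mem_edge_list adj_sym uv gt => /(_ isT); rewrite negbK Asym.
  - by move: uv; rewrite (enum_rank_inj (val_inj E)) adj_irr.
by rewrite (big_rem e) //= (negPf eN) mul0r.
Qed.

Lemma sum_mem (R : realFieldType) (V : finType) (A : {set V}) :
  \sum_a (a \in A)%:R = #|A|%:R :> R.
Proof. by rewrite -sum1_card natr_sum [RHS]big_mkcond; apply: eq_bigr => a _;
  case: (a \in A). Qed.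

(** * The reduced graph of a regular partition *)

Section Dense.
Variables (R : realFieldType) (U K : finType) (H : rel U) (c : U -> K) (delta eps beta : R).

Let X (i j : U) : R := (H i j)%:R.

Definition dense_pair (u v : U) : bool :=
  [&& ~~ bad delta c X u v, beta * #|U|%:R <= #|cls c u|%:R,
      beta * #|U|%:R <= #|cls c v|%:R & eps <= proj c X u v].

Definition reduced_rel (i j : K) : bool :=
  [exists u, exists v, [&& c u == i, c v == j & dense_pair u v]].

Lemma indicator01 i j : 0 <= X i j <= 1.
Proof. by rewrite /X ler0n lern1 leq_b1. Qed.

(** Four sources of at most [eps * #|U| ^ 2] pairs each: bad pairs, a small class at the first end,
    a small class at the second end, and edges between classes of low density. The last are counted
    by passing to cell averages with [sum_proj]. *)
Lemma uncovered_pairs :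
  0 <= eps -> 0 <= beta -> beta * #|K|%:R <= eps ->
  \sum_u \sum_v (bad delta c X u v)%:R <= eps * #|U|%:R ^+ 2 ->
  \sum_u \sum_v (H u v && ~~ reduced_rel (c u) (c v))%:R <= 4 * eps * #|U|%:R ^+ 2.
Proof.
move=> e0 be0 be few; set n : R := #|U|%:R; rewrite -/n in few.
pose small u : R := (#|cls c u|%:R < beta * n)%R%:R.
pose thin u v : R := (proj c X u v < eps)%R%:R.
have Hsmall : \sum_u small u <= eps * n.
  rewrite (partition_big c xpredT) //=.
  apply: le_trans (_ : \sum_(i : K) beta * n <= _); last first.
    by rewrite sumr_const -mulr_natr mulrAC ler_wpM2r.
  apply: ler_sum => i _.
  have [/existsP[u /andP[/eqP ui lt]]|/existsPn none] :=
    boolP [exists u, (c u == i) && ((#|cls c u|%:R : R) < beta * n)].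
    apply: le_trans (ltW lt); rewrite -sumr_const big_mkcond [leRHS]big_mkcond /=.
    apply: ler_sum => v _; rewrite inE ui; case: ifP => // _.
    by rewrite /small lern1 leq_b1.
  rewrite big1 ?mulr_ge0 // => u ui; have := none u; rewrite ui /small.
  by case: ltP.
have Hthin : \sum_u \sum_v X u v * thin u v <= eps * n ^+ 2.
  rewrite -(sum_proj (c := c)); last first.
    by move=> u v u' v' Eu Ev; rewrite /thin (proj_invariant _ Eu Ev).
  apply: le_trans (_ : \sum_(u : U) \sum_(v : U) eps <= _).
    apply: ler_sum => u _; apply: ler_sum => v _; rewrite /thin.
    by case: ltP => [/ltW|]; rewrite ?mulr1 ?mulr0.
  by rewrite !sumr_const -mulrnA -[_ *+ (_ * _)]mulr_natr natrM expr2.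
apply: le_trans (_ : \sum_u \sum_v ((bad delta c X u v)%:R + small u + small v + X u v * thin u
  v) <= _).
  apply: ler_sum => u _; apply: ler_sum => v _.
  have s0 w : 0 <= small w by rewrite ler0n.
  have t0 : 0 <= X u v * thin u v by rewrite mulr_ge0 ?ler0n.
  have b0 : 0 <= (bad delta c X u v)%:R :> R by rewrite ler0n.
  have su := s0 u; have sv := s0 v.
  have [uv|] := boolP (H u v); last by rewrite /=; lra.
  have [|] := boolP (reduced_rel (c u) (c v)); first by rewrite /=; lra.
  rewrite /reduced_rel => /existsPn/(_ u)/existsPn/(_ v); rewrite !eqxx /= /dense_pair.
  rewrite !negb_and negbK -!ltNge => /or4P[->|lt|lt|lt] /=; first by lra.
  - have -> : small u = 1 by rewrite /small lt.
    by lra.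
  - have -> : small v = 1 by rewrite /small lt.
    by lra.
  - have -> : X u v * thin u v = 1 by rewrite /thin lt /X uv mulr1.
    by lra.
have -> : \sum_u \sum_v ((bad delta c X u v)%:R + small u + small v + X u v * thin u v) =
  \sum_u \sum_v (bad delta c X u v)%:R + n * \sum_u small u + n * \sum_u small u
   + \sum_u \sum_v X u v * thin u v.
  under eq_bigr do rewrite !big_split /=.
  rewrite !big_split /=; congr (_ + _ + _ + _).
    under eq_bigr do rewrite sumr_const.
    by rewrite sumrMnl -mulr_natl.
  by rewrite sumr_const -mulr_natl.
have := ler_wpM2l (ler0n R #|U|) Hsmall; rewrite -/n.
move: few Hthin; rewrite expr2; lra.
Qed.

(** Every vertex of [F] is drawn independently from the class that [h] prescribes. By the counting
    lemma the draw is a homomorphism with probability at least the left side; since only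
    non-injective maps are homomorphisms, this probability is at most the right side. *)
Lemma reduced_embedding (F : sgraph) (h : {ffun F -> K}) :
  symmetric H -> (0 < #|U|)%N -> 0 < beta -> beta <= 1 -> 0 <= eps ->
  ghom reduced_rel h ->
  (forall x : {ffun F -> U}, ghom H x -> ~~ injectiveb x) ->
  eps ^+ size (edge_list F) - (size (edge_list F))%:R * delta <=
  #|F|%:R ^+ 2 * beta ^- #|F| / #|U|%:R.
Proof.
move=> Hsym U0 b0 b1 e0 hh free; set n : R := #|U|%:R.
have n0 : 0 < n by rewrite ltr0n.
(* The colour class prescribed for an isolated vertex of F may be tiny. *)
pose D w : {set U} := if [exists w', adj w w'] then [set u | c u == h w] else setT.
have adjD p q : adj p q -> D p = [set u | c u == h p].
  by move=> pq; rewrite /D; case: ifP => // /existsP[]; exists q.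
have reps p q : adj p q -> exists u, exists v, [/\ c u = h p, c v = h q & dense_pair u v].
  move=> pq; have /existsP[u /existsP[v /and3P[/eqP cu /eqP cv uv]]] := ghomP _ _ hh _ _ pq.
  by exists u, v.
have clsD p q u : adj p q -> c u = h p -> cls c u = D p.
  by move=> pq cu; rewrite (adjD _ _ pq) /cls cu.
have Dsize w : beta * n <= #|D w|%:R.
  have [/existsP[w' ww']|no] := boolP [exists w', adj w w'].
    have [u [v [cu _ /and4P[_ ge _ _]]]] := reps _ _ ww'.
    by rewrite -(clsD _ _ _ ww' cu).
  by rewrite /D (negPf no) cardsT ler_piMl // ltW.
have D0 w : 0 < #|D w|%:R :> R by apply: lt_le_trans (Dsize w); apply: mulr_gt0.
pose mu w a : R := (a \in D w)%:R / #|D w|%:R.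
have mu0 w a : 0 <= mu w a by rewrite divr_ge0 ?ler0n.
have mu1 w : \sum_a mu w a = 1.
  by rewrite -mulr_suml sum_mem divff ?lt0r_neq0.
pose dns p q : R := if [pick uv : U * U | (c uv.1 == h p) && (c uv.2 == h q)] is Some uv
  then proj c X uv.1 uv.2 else 0.
have dns01 p q : 0 <= dns p q <= 1.
  rewrite /dns; case: pickP => [uv _|_]; first exact: proj01 indicator01.
  by rewrite lexx ler01.
have dnsE p q u v : c u = h p -> c v = h q -> dns p q = proj c X u v.
  move=> cu cv; rewrite /dns; case: pickP => [[u' v'] /= /andP[/eqP cu' /eqP cv']|/(_ (u, v))].
    by apply: proj_invariant; rewrite ?cu ?cv.
  by rewrite cu cv !eqxx.
have cut p q : (p, q) \in edge_list F -> forall a b : U -> R,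
    (forall i, 0 <= a i <= 1) -> (forall i, 0 <= b i <= 1) ->
    `|\sum_i \sum_j mu p i * mu q j * (X i j - dns p q) * a i * b j| <= delta.
  rewrite mem_edge_list => /andP[pq _] a b a01 b01.
  have [u [v [cu cv uv]]] := reps _ _ pq.
  have Dp := clsD _ _ _ pq cu; have Dq : cls c v = D q.
    by apply: clsD cv; rewrite adj_sym; apply: pq.
  have /and4P[reg _ _ _] := uv.
  have := regular_functions reg a01 b01.
  rewrite Dp Dq -ler_pdivrMr ?mulr_gt0 //; apply: le_trans.
  rewrite le_eqVlt; apply/orP; left; apply/eqP.
  rewrite -[in RHS](gtr0_norm (mulr_gt0 (D0 p) (D0 q))) -normfV -normrM; congr (`| _ |).
  rewrite mulr_suml [RHS]big_mkcond; apply: eq_bigr => i _; rewrite /mu.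
  case: ifP => iD; last by rewrite big1 // => j _; rewrite !mul0r.
  rewrite mulr_suml [RHS]big_mkcond; apply: eq_bigr => j _.
  case: ifP => jD; last by rewrite mul0r mulr0 !mul0r.
  rewrite (dnsE _ _ _ _ cu cv) (proj_invariant (c := c) X (u := i) (v := j) (u' := u) (v' := v)).
  - rewrite invfM /= ?mulr1n; ring.
  - by move: iD; rewrite -Dp inE => /eqP.
  - by move: jD; rewrite -Dq inE => /eqP.
have := counting_lemma (mu := mu) (eta := delta) (g := fun _ _ => X) mu0 mu1 (fun _ _ =>
  indicator01)
   (fun p q _ _ => dns01 p q) (simple_edge_list F) cut.
have -> : \sum_x wt mu x * kprod (fun p q _ _ => dns p q) (edge_list F) x =
    \prod_(e <- edge_list F) dns e.1 e.2.
  by rewrite -mulr_suml (sum_wt mu1) mul1r.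
have ghomE x : kprod (fun _ _ => X) (edge_list F) x = (ghom H x)%:R by apply: ghom_kprod.
rewrite (eq_bigr (fun x => wt mu x * (ghom H x)%:R)); last by move=> x _; rewrite ghomE.
move=> count.
have lower : eps ^+ size (edge_list F) <= \prod_(e <- edge_list F) dns e.1 e.2.
  have : all (fun e => eps <= dns e.1 e.2) (edge_list F).
    apply/allP => -[p q]; rewrite mem_edge_list => /andP[pq _] /=.
    have [u [v [cu cv /and4P[_ _ _ ge]]]] := reps _ _ pq.
    by rewrite (dnsE _ _ _ _ cu cv).
  elim: (edge_list F) => [|e L IH] /=; first by rewrite big_nil.
  move=> /andP[ge /IH Hl]; rewrite big_cons exprS.
  by apply: ler_pM => //; apply: exprn_ge0.
(* Each map has weight at most [(beta * n) ^- #|F|], and at most a fraction [#|F| ^ 2 / n] of all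
   maps is non-injective. *)
have upper : \sum_x wt mu x * (ghom H x)%:R <= #|F|%:R ^+ 2 * beta ^- #|F| / n.
  apply: le_trans (_ : \sum_(x in [set x : {ffun F -> U} | ~~ injectiveb x]) (beta * n) ^- #|F|
    <= _).
    rewrite [leRHS]big_mkcond /=; apply: ler_sum => x _; rewrite inE.
    have wx : wt mu x <= (beta * n) ^- #|F|.
      have -> : (beta * n) ^- #|F| = \prod_(w : F) (beta * n)^-1.
        by rewrite prodr_const exprVn.
      apply: ler_prod => w _.
      rewrite mu0 /= -[leRHS]mul1r; apply: ler_pM; rewrite ?invr_ge0 ?ler0n //.
        by rewrite lern1 leq_b1.
      by rewrite lef_pV2 ?posrE // mulr_gt0.
    have [hx|_] := boolP (ghom H x); first by rewrite (free _ hx) mulr1.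
    by rewrite mulr0; case: ifP => // _; rewrite invr_ge0 exprn_ge0 // mulr_ge0 // ltW.
  rewrite sumr_const -[_ *+ #|_|]mulr_natr ler_pdivlMr // exprMn invfM [leRHS]mulrC -2!mulrA
    ler_wpM2l //.
    by rewrite invr_ge0 exprn_ge0 // ltW.
  rewrite mulrC ler_pdivrMr ?exprn_gt0 // mulrC -!natrX -!natrM ler_nat.
  exact: card_noninj.
move: count; rewrite ler_norml => /andP[]; lra.
Qed.

End Dense.

Lemma all_sumn (T : Type) (f : T -> nat) (s : seq T) :
  all (fun x => f x <= sumn (map f s))%N s.
Proof.
elim: s => //= x s IH; rewrite leq_addr /=; apply: sub_all IH => y; lia.
Qed.

(** A homomorphism from a forbidden [F] would contradict [reduced_embedding]: by the choice of [d]
    its left side is at least [e1 ^+ E / 2], and for [N <= #|U|] its right side is smaller. [d] is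
    chosen first, since the number of classes depends on it, then the class threshold [b], and [N]
    last. *)
Lemma reduced_graph (R : realType) (Fs : seq sgraph) (eps : R) : 0 < eps ->
  exists k N, forall (U : finType) (H : rel U), symmetric H -> (N <= #|U|)%N ->
  all (fun F : sgraph => [forall x : {ffun F -> U}, ~~ (injectiveb x && ghom H x)]) Fs ->
  exists (c : U -> 'I_k.+1) (Q : rel 'I_k.+1),
    all (fun F : sgraph => [forall h : {ffun F -> 'I_k.+1}, ~~ ghom Q h]) Fs /\
    \sum_u \sum_v (H u v && ~~ Q (c u) (c v))%:R <= eps * #|U|%:R ^+ 2.
Proof.
move=> eps0.
pose e1 := Num.min (eps / 4) 1.
have e10 : 0 < e1 by rewrite lt_min ltr01 andbT divr_gt0.
have e11 : e1 <= 1 by rewrite ge_min lexx orbT.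
have e14 : 4 * e1 <= eps.
  by rewrite mulrC -ler_pdivlMr // /e1 ge_min lexx.
(* [m] bounds the number of vertices and [E] the number of edges of every member, so that one choice
   of constants serves the whole family. *)
pose m := sumn [seq #|vert F| | F <- Fs]; pose E := (m ^ 2)%N.
pose d := Num.min e1 (e1 ^+ E / (2 * E.+1%:R)).
have eE0 : 0 < e1 ^+ E by apply: exprn_gt0.
have d0 : 0 < d by rewrite lt_min e10 divr_gt0 ?mulr_gt0.
have dE : E%:R * d <= e1 ^+ E / 2.
  apply: le_trans (_ : E.+1%:R * (e1 ^+ E / (2 * E.+1%:R)) <= _).
    apply: ler_pM; rewrite ?ler0n ?ler_nat ?(ltW d0) //.
    by rewrite /d ge_min lexx orbT.
  rewrite le_eqVlt; apply/orP; left; apply/eqP; field.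
  by rewrite nat1r pnatr_eq0.
have [k Hk] := regularity d0.
pose b := e1 / k.+1%:R.
have b0 : 0 < b by rewrite divr_gt0.
have b1 : b <= 1 by rewrite ler_pdivrMr // mul1r (le_trans e11) // ler1n.
pose N := (Num.truncn (2 * (m%:R ^+ 2 * b ^- m) / e1 ^+ E)).+1.
exists k, N => U H Hsym UN free.
have U0 : (0 < #|U|)%N by apply: leq_trans UN.
have HN : 2 * (m%:R ^+ 2 * b ^- m) < e1 ^+ E * #|U|%:R.
  rewrite [ltRHS]mulrC -ltr_pdivrMr //.
  apply: lt_le_trans (truncnS_gt _) _.
  by rewrite ler_nat.
have [c few] := Hk U (fun i j => (H i j)%:R) (indicator01 R H).
exists c, (reduced_rel H c d e1 b); split; last first.
  apply: le_trans (uncovered_pairs (ltW e10) (ltW b0) _ _) _.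
  - by rewrite card_ord /b divfK ?pnatr_eq0.
  - by apply: le_trans few _; rewrite ler_wpM2r ?exprn_ge0 // /d ge_min lexx.
  - by rewrite ler_wpM2r ?exprn_ge0.
have := all_sumn (fun F : sgraph => #|F|) Fs; rewrite -/m => sizes.
have : all (predI (fun F : sgraph => #|F| <= m)%N
  (fun F : sgraph => [forall x : {ffun F -> U}, ~~ (injectiveb x && ghom H x)])) Fs.
  by rewrite all_predI sizes.
apply: sub_all => F /andP[/= Fm /forallP Ffree].
apply/forallP => h; apply/negP => hh.
have ninj (x : {ffun F -> U}) : ghom H x -> ~~ injectiveb x by move=> hx; have := Ffree x;
  rewrite hx andbT.
have := reduced_embedding Hsym U0 b0 b1 (ltW e10) hh ninj.
apply/negP; rewrite -ltNge.
set L := size _.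
have LE : (L <= E)%N.
  by apply: leq_trans (size_edge_list F) _; rewrite leq_exp2r.
apply: le_lt_trans (_ : m%:R ^+ 2 * b ^- m / #|U|%:R < _).
  rewrite ler_wpM2r ?invr_ge0 //; apply: ler_pM.
  - by rewrite exprn_ge0.
  - by rewrite invr_ge0 exprn_ge0 // ltW.
  - by rewrite lerXn2r ?nnegrE // ler_nat.
  rewrite lef_pV2 ?posrE ?exprn_gt0 //.
  by apply: ler_wiXn2l => //; apply: ltW.
rewrite ltr_pdivrMr ?ltr0n //.
apply: lt_le_trans (_ : e1 ^+ E / 2 * #|U|%:R <= _); first by lra.
rewrite ler_wpM2r //.
have H1 : e1 ^+ E <= e1 ^+ L by apply: ler_wiXn2l => //; apply: ltW.
have H2 : L%:R * d <= E%:R * d by rewrite ler_wpM2r ?(ltW d0) // ler_nat.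
lra.
Qed.

(** * Sampling *)

Section CutNorm.
Variables (R : realFieldType) (O : finType).
Implicit Types (z : O -> O -> R) (a b : O -> R).

Definition cut_le (eta : R) z : Prop :=
  forall a b, (forall i, 0 <= a i <= 1) -> (forall i, 0 <= b i <= 1) ->
  `|\sum_i \sum_j z i j * a i * b j| <= eta.

(** Splitting [a] and [b] into positive and negative parts gives four admissible pairs. *)
Lemma cut_le_signed eta z : cut_le eta z ->
  forall a b, (forall i, `|a i| <= 1) -> (forall i, `|b i| <= 1) ->
  `|\sum_i \sum_j z i j * a i * b j| <= 4 * eta.
Proof.
move=> Hz a b a1 b1.
pose pos (f : O -> R) i := Num.max (f i) 0; pose neg (f : O -> R) i := Num.max (- f i) 0.
have pos01 f : (forall i, `|f i| <= 1) -> forall i, 0 <= pos f i <= 1.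
  move=> f1 i; rewrite /pos le_max lexx orbT /= ge_max ler01 andbT.
  exact: le_trans (ler_norm _) (f1 i).
have neg01 f : (forall i, `|f i| <= 1) -> forall i, 0 <= neg f i <= 1.
  move=> f1 i; rewrite /neg le_max lexx orbT /= ge_max ler01 andbT.
  by apply: le_trans (ler_norm _) _; rewrite normrN.
have split f i : f i = pos f i - neg f i.
  by rewrite /pos /neg; case: (leP (f i) 0) => h; case: (leP (- f i) 0) => h'; lra.
have -> : \sum_i \sum_j z i j * a i * b j =
    (\sum_i \sum_j z i j * pos a i * pos b j - \sum_i \sum_j z i j * pos a i * neg b j)
  - (\sum_i \sum_j z i j * neg a i * pos b j - \sum_i \sum_j z i j * neg a i * neg b j).
  rewrite -!sumrB; apply: eq_bigr => i _; rewrite -!sumrB; apply: eq_bigr => j _.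
  by rewrite {1}(split a) {1}(split b); ring.
have pp := Hz _ _ (pos01 _ a1) (pos01 _ b1); have pn := Hz _ _ (pos01 _ a1) (neg01 _ b1).
have np := Hz _ _ (neg01 _ a1) (pos01 _ b1); have nn := Hz _ _ (neg01 _ a1) (neg01 _ b1).
move: pp pn np nn; rewrite !ler_norml => /andP[? ?] /andP[? ?] /andP[? ?] /andP[? ?].
by apply/andP; split; lra.
Qed.

Definition fourcycles z : R := \sum_j \sum_j' (\sum_i z i j * z i j') ^+ 2.

(** Cauchy-Schwarz twice: the first application removes [a], the second removes [b]. *)
Lemma cut_fourcycles z a b : (forall i, 0 <= a i <= 1) -> (forall i, 0 <= b i <= 1) ->
  (\sum_i \sum_j z i j * a i * b j) ^+ 4 <= #|O|%:R ^+ 4 * fourcycles z.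
Proof.
move=> a01 b01; have sq01 x : 0 <= x <= 1 -> x ^+ 2 <= 1 :> R.
  by move=> /andP[x0 x1]; rewrite expr_le1.
have sumle (f : O -> R) : (forall i, 0 <= f i <= 1) -> \sum_i f i ^+ 2 <= #|O|%:R.
  move=> f01; rewrite -sum1_card natr_sum; apply: ler_sum => i _; exact: sq01.
have step1 : (\sum_i \sum_j z i j * a i * b j) ^+ 2 <=
    #|O|%:R * \sum_j \sum_j' b j * b j' * (\sum_i z i j * z i j').
  have -> : \sum_i \sum_j z i j * a i * b j = \sum_i a i * \sum_j z i j * b j.
    apply: eq_bigr => i _; rewrite mulr_sumr; apply: eq_bigr => j _; ring.
  apply: le_trans (cauchy_schwarz _ _ _) _.
  apply: ler_pM; [| |exact: sumle|].
  - by apply: sumr_ge0 => i _; apply: sqr_ge0.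
  - by apply: sumr_ge0 => i _; apply: sqr_ge0.
  rewrite le_eqVlt; apply/orP; left; apply/eqP.
  under [RHS]eq_bigr do under eq_bigr do rewrite mulr_sumr.
  under [RHS]eq_bigr do rewrite exchange_big.
  rewrite [RHS]exchange_big; apply: eq_bigr => i _.
  rewrite expr2 mulr_suml; apply: eq_bigr => j _.
  rewrite mulr_sumr; apply: eq_bigr => j' _; ring.
have nn : 0 <= #|O|%:R :> R by rewrite ler0n.
have step2 : (\sum_j \sum_j' b j * b j' * (\sum_i z i j * z i j')) ^+ 2 <=
    #|O|%:R ^+ 2 * fourcycles z.
  rewrite pair_big; apply: le_trans (cauchy_schwarz _ _ _) _.
  rewrite /fourcycles [in leRHS]pair_big ler_wpM2r //.
    by apply: sumr_ge0 => p _; rewrite sqr_ge0.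
  have -> : #|O|%:R ^+ 2 = #|{: O * O}|%:R :> R by rewrite card_prod natrM expr2.
  rewrite -sum1_card natr_sum; apply: ler_sum => p _; apply: sq01.
  by rewrite mulr_ge0 ?mulr_ile1 //; case/andP: (b01 p.1); case/andP: (b01 p.2).
rewrite (exprM _ 2 2); apply: le_trans (_ : (#|O|%:R * \sum_j \sum_j' b j * b j' * (\sum_i z i
  j * z i j')) ^+ 2 <= _).
  rewrite lerXn2r ?nnegrE ?sqr_ge0 //; exact: le_trans (sqr_ge0 _) step1.
rewrite exprMn (exprM _ 2 2) [in leRHS]expr2 -mulrA.
by rewrite ler_wpM2l ?exprn_ge0.
Qed.

Definition ord4 (i : nat) (lt : (i < 4)%N) : 'I_4 := Ordinal lt.

(** Points 0 and 1 form one side of the four-cycle, 2 and 3 the other. As a function of four points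
    it can be averaged over samples. *)
Definition cycle4 z (y : {ffun 'I_4 -> O}) : R :=
  z (y (@ord4 0 isT)) (y (@ord4 2 isT)) * z (y (@ord4 0 isT)) (y (@ord4 3 isT)) *
  (z (y (@ord4 1 isT)) (y (@ord4 2 isT)) * z (y (@ord4 1 isT)) (y (@ord4 3 isT))).

Lemma fourcyclesE z : fourcycles z = \sum_y cycle4 z y.
Proof.
pose h (p : O * O * (O * O)) : {ffun 'I_4 -> O} :=
  [ffun i : 'I_4 => nth p.1.1 [:: p.2.1; p.2.2; p.1.1; p.1.2] i].
pose h' (y : {ffun 'I_4 -> O}) : O * O * (O * O) :=
  ((y (@ord4 2 isT), y (@ord4 3 isT)), (y (@ord4 0 isT), y (@ord4 1 isT))).
have hK : cancel h h' by move=> [[a b] [c d]]; rewrite /h /h' !ffunE.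
have hK' : cancel h' h.
  move=> y; apply/ffunP => -[[|[|[|[|//]]]] lt]; rewrite ffunE /=; congr (y _); exact: val_inj.
rewrite (reindex h); last by apply: onW_bij; exists h'.
rewrite /fourcycles pair_big /= -(pair_big xpredT xpredT (fun p q => cycle4 z (h (p, q)))) /=.
apply: eq_bigr => -[j j'] _ /=; rewrite expr2 mulr_suml.
rewrite -(pair_big xpredT xpredT (fun i i' => cycle4 z (h ((j, j'), (i, i'))))) /=.
apply: eq_bigr => i _; rewrite mulr_sumr; apply: eq_bigr => i' _.
by rewrite /cycle4 !ffunE.
Qed.

(** For fixed [i'] and [j'] the sum over [i] and [j] tests [z] against [z i j'] and [z i' j], signed
    functions bounded by 1. *)
Lemma fourcycles_cut eta z : (forall i j, `|z i j| <= 1) -> cut_le eta z ->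
  fourcycles z <= #|O|%:R ^+ 2 * (4 * eta).
Proof.
move=> z1 Hz.
have -> : fourcycles z = \sum_i' \sum_j' z i' j' * \sum_i \sum_j z i j * z i j' * z i' j.
  transitivity (\sum_j \sum_j' \sum_i \sum_i' z i j * z i j' * (z i' j * z i' j')).
    apply: eq_bigr => j _; apply: eq_bigr => j' _; rewrite expr2 mulr_suml.
    by apply: eq_bigr => i _; rewrite mulr_sumr.
  transitivity (\sum_i' \sum_j' \sum_i \sum_j z i j * z i j' * (z i' j * z i' j')); last first.
    apply: eq_bigr => i' _; apply: eq_bigr => j' _; rewrite mulr_sumr.
    apply: eq_bigr => i _; rewrite mulr_sumr; apply: eq_bigr => j _; ring.
  rewrite exchange_big /= [RHS]exchange_big /=; apply: eq_bigr => j' _.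
  under eq_bigr do rewrite exchange_big /=.
  rewrite exchange_big /=; apply: eq_bigr => i' _.
  by rewrite exchange_big.
apply: le_trans (_ : \sum_(i' : O) \sum_(j' : O) 4 * eta <= _); last first.
  by rewrite !sumr_const -mulrnA -[_ *+ (_ * _)]mulr_natl natrM expr2.
apply: ler_sum => i' _; apply: ler_sum => j' _.
apply: le_trans (ler_norm _) _; rewrite normrM -[leRHS]mul1r; apply: ler_pM => //.
exact: cut_le_signed.
Qed.

(* x <= e + x^4 / e^3 by comparing x with e. *)
Lemma fourcycles_cut_le (e C : R) z : (0 < #|O|)%N -> 0 < e ->
  fourcycles z <= C * #|O|%:R ^+ 4 ->
  cut_le ((e + C / e ^+ 3) * #|O|%:R ^+ 2) z.
Proof.
move=> O0 e0 HC a b a01 b01.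
have n0 : 0 < #|O|%:R :> R by rewrite ltr0n.
set S := \sum_i _; pose y := `|S| / #|O|%:R ^+ 2.
have y0 : 0 <= y by rewrite divr_ge0 ?exprn_ge0.
have -> : `|S| = y * #|O|%:R ^+ 2 by rewrite /y divfK // expf_neq0 ?lt0r_neq0.
rewrite ler_wpM2r ?exprn_ge0 //.
have yC : y ^+ 4 <= C.
  have /le_trans/(_ (ler_wpM2l (exprn_ge0 4 (ltW n0)) HC)) := cut_fourcycles z a01 b01.
  rewrite -/S; rewrite mulrCA -exprD => H.
  rewrite /y expr_div_n -exprM ler_pdivrMr ?exprn_gt0 // -normrX ger0_norm //.
  by rewrite -[4%N]/(2 * 2)%N exprM sqr_ge0.
have [ye|ey] := lerP y e.
  have C0 : 0 <= C by apply: le_trans yC; apply: exprn_ge0.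
  by apply: le_trans ye _; rewrite lerDl divr_ge0 // exprn_ge0 // ltW.
apply: le_trans (_ : C / e ^+ 3 <= _); last by rewrite lerDr ltW.
rewrite ler_pdivlMr ?exprn_gt0 //; apply: le_trans yC.
by rewrite (exprS y 3) ler_wpM2l // lerXn2r ?nnegrE // ltW.
Qed.

End CutNorm.

(** * Colourings and the counting lemma *)

Section Colors.
Variables (R : realFieldType) (C : finType) (Q : {set C * C}).

(** [Q] is any set of ordered pairs; asking for both orders makes the condition symmetric in [i] and
    [j]. *)
Definition allowed (O : finType) (c : O -> C) (i j : O) : bool :=
  ((c i, c j) \in Q) && ((c j, c i) \in Q).

Definition colored (T O : finType) (c : O -> C) (X : O -> O -> R) (_ _ : T) (i j : O) : R :=
  X i j * (allowed c i j)%:R.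

(** Splitting by the colours of [i] and [j] gives [#|C| ^ 2] terms, each testing [z] against [a] and
    [b] cut down to colour classes. *)
Lemma cut_allowed (O : finType) (c : O -> C) eta (z : O -> O -> R) : cut_le eta z ->
  cut_le (#|C|%:R ^+ 2 * eta) (fun i j => z i j * (allowed c i j)%:R).
Proof.
move=> Hz a b a01 b01.
pose cut p := \sum_i \sum_j z i j * (a i * (c i == p.1)%:R) * (b j * (c j == p.2)%:R).
have -> : \sum_i \sum_j z i j * (allowed c i j)%:R * a i * b j =
    \sum_(p : C * C) ((p \in Q) && ((p.2, p.1) \in Q))%:R * cut p.
  under [RHS]eq_bigr do rewrite mulr_sumr.
  rewrite [RHS]exchange_big; apply: eq_bigr => i _.
  under [RHS]eq_bigr do rewrite mulr_sumr.
  rewrite [RHS]exchange_big; apply: eq_bigr => j _ /=.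
  rewrite (bigD1 (c i, c j)) //= !eqxx big1 ?addr0; first by rewrite /allowed /= !mulr1; ring.
  by move=> [p q]; rewrite xpair_eqE negb_and => /orP[] /negPf /=; rewrite eq_sym => ->;
    rewrite !(mulr0, mul0r).
apply: le_trans (ler_norm_sum _ _ _) _.
apply: le_trans (_ : \sum_(p : C * C) eta <= _); last first.
  by rewrite sumr_const card_prod -[_ *+ (_ * _)]mulr_natl natrM expr2.
have e0 : 0 <= eta.
  have H0 (i : O) : 0 <= (0 : R) <= 1 by rewrite lexx ler01.
  exact: le_trans (normr_ge0 _) (Hz (fun=> 0) (fun=> 0) H0 H0).
apply: ler_sum => p _; rewrite normrM.
have Hp : `|cut p| <= eta.
  apply: Hz => i.
    by have := a01 i; case: eqP => _ /=; rewrite ?mulr1 // mulr0 lexx ler01.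
  by have := b01 i; case: eqP => _ /=; rewrite ?mulr1 // mulr0 lexx ler01.
by case: (_ && _); rewrite ?normr1 ?normr0 ?mul1r ?mul0r.
Qed.

Lemma colored01 (T O : finType) (c : O -> C) (X : O -> O -> R) :
  (forall i j, 0 <= X i j <= 1) ->
  forall (u v : T) i j, 0 <= colored c X u v i j <= 1.
Proof.
move=> X01 u v i j; have /andP[X0 X1] := X01 i j.
by rewrite /colored; case: (allowed c i j); rewrite ?mulr1 ?X0 // mulr0 lexx ler01.
Qed.

Lemma wt_uniform (T O : finType) (f : {ffun T -> O}) :
  wt (fun _ _ => #|O|%:R^-1) f = #|O|%:R ^- #|T| :> R.
Proof. by rewrite /wt prodr_const exprVn. Qed.

(** The bound is the same for every [c], as needed for a maximum over colourings that may depend on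
    the sample. *)
Lemma colored_counting (T : sgraph) (O : finType) (c : O -> C) (X Y : O -> O -> R) eta :
  (0 < #|O|)%N -> (forall i j, 0 <= X i j <= 1) -> (forall i j, 0 <= Y i j <= 1) ->
  cut_le (eta * #|O|%:R ^+ 2) (fun i j => X i j - Y i j) ->
  `|(\sum_f kprod (@colored T O c X) (edge_list T) f) / #|O|%:R ^+ #|T|
    - (\sum_f kprod (@colored T O c Y) (edge_list T) f) / #|O|%:R ^+ #|T| |
  <= #|T|%:R ^+ 2 * (#|C|%:R ^+ 2 * eta).
Proof.
move=> O0 X01 Y01 Hz.
have n0 : 0 < #|O|%:R :> R by rewrite ltr0n.
pose mu (_ : T) (_ : O) : R := #|O|%:R^-1.
have mu0 u i : 0 <= mu u i by rewrite invr_ge0.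
have mu1 u : \sum_i mu u i = 1.
  by rewrite sumr_const -[_ *+ _]mulr_natl mulfV ?lt0r_neq0.
have e0 : 0 <= eta.
  have H0 (i : O) : 0 <= (0 : R) <= 1 by rewrite lexx ler01.
  have := le_trans (normr_ge0 _) (Hz (fun=> 0) (fun=> 0) H0 H0).
  by rewrite pmulr_lge0 // exprn_gt0.
have cut u v : (u, v) \in edge_list T -> forall a b : O -> R,
    (forall i, 0 <= a i <= 1) -> (forall i, 0 <= b i <= 1) ->
    `|\sum_i \sum_j mu u i * mu v j * (@colored T O c X u v i j - @colored T O c Y u v i j) * a
      i * b j|
      <= #|C|%:R ^+ 2 * eta.
  move=> _ a b a01 b01.
  have := @cut_allowed O c _ _ Hz a b a01 b01.
  rewrite mulrA -ler_pdivrMr ?exprn_gt0 //; apply: le_trans.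
  rewrite le_eqVlt; apply/orP; left; apply/eqP.
  rewrite -[X in _ / X]ger0_norm ?exprn_ge0 // -normfV -normrM; congr (`| _ |).
  rewrite mulr_suml; apply: eq_bigr => i _; rewrite mulr_suml; apply: eq_bigr => j _.
  by rewrite /colored /mu expr2 invfM; ring.
have := counting_lemma mu0 mu1 (colored01 c X01) (colored01 c Y01) (simple_edge_list T) cut.
have E g : \sum_f wt mu f * kprod g (edge_list T) f =
   (\sum_f kprod g (edge_list T) f) / #|O|%:R ^+ #|T|.
  by rewrite mulr_suml; apply: eq_bigr => f _; rewrite wt_uniform mulrC.
rewrite !E => /le_trans; apply.
rewrite ler_wpM2r ?mulr_ge0 ?exprn_ge0 // -natrX ler_nat.
exact: size_edge_list.
Qed.

End Colors.

(** * From a colouring of the sample to one of the graph *)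

Section Transfer.
Variables (R : realFieldType) (C V K : finType) (Q : {set C * C}) (kappa : V -> K).
Variables (q : nat) (x : {ffun 'I_q -> V}) (c : 'I_q -> C).

Let cellV (i : K) : {set V} := [set v | kappa v == i].
Let cellS (i : K) : {set 'I_q} := [set j | kappa (x j) == i].

(* The samples of a cell are dealt round-robin to the vertices of the cell. *)
Definition deal (j0 : 'I_q) (v : V) : 'I_q :=
  nth j0 (enum (cellS (kappa v))) (index v (enum (cellV (kappa v))) %% #|cellS (kappa v)|).

(** Vertices of a cell without samples are dealt the default [j0]; the condition on [kappa] keeps
    them out. *)
Definition dealt (j0 j : 'I_q) : {set V} :=
  [set v | (kappa v == kappa (x j)) && (deal j0 v == j)].

(** With [m] samples in the cell, [j] receives the positions congruent to its index modulo [m], one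
    in each full round. *)
Lemma dealt_large j0 j :
  (#|cellV (kappa (x j))| %/ #|cellS (kappa (x j))| <= #|dealt j0 j|)%N.
Proof.
set i := kappa (x j); set N := #|cellV i|; set m := #|cellS i|.
have jS : j \in cellS i by rewrite inE.
have m0 : (0 < m)%N by apply/card_gt0P; exists j.
have jm : (index j (enum (cellS i)) < m)%N by rewrite /m cardE index_mem mem_enum.
have ltN (k : 'I_(N %/ m)) : (k * m + index j (enum (cellS i)) < size (enum (cellV i)))%N.
  rewrite -cardE -/N; apply: leq_trans (leq_trunc_div N m).
  apply: leq_trans (_ : k.+1 * m <= _)%N; first by rewrite mulSn addnC ltn_add2r.
  by rewrite leq_mul2r ltn_ord orbT.
have [v0 _|noV] := pickP (pred_of_simpl (@predT V)); last first.
  have N0 : N = 0%N by apply: eq_card0 => v; have := noV v.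
  by rewrite N0 div0n.
pose g (k : 'I_(N %/ m)) := nth v0 (enum (cellV i)) (k * m + index j (enum (cellS i))).
have ginj : injective g.
  move=> k k' /eqP; rewrite nth_uniq ?enum_uniq // eqn_add2r eqn_pmul2r // => /eqP.
  exact: val_inj.
rewrite -[(N %/ m)%N]card_ord -(card_imset _ ginj); apply: subset_leq_card.
apply/subsetP => v /imsetP[k _ ->].
have gV : g k \in cellV i by rewrite -mem_enum mem_nth.
have gi : kappa (g k) = i by move: gV; rewrite inE => /eqP.
rewrite inE gi eqxx /= /deal gi index_uniq ?enum_uniq // -/m.
by rewrite modnMDl modn_small // nth_index // mem_enum.
Qed.

Definition discrepancy : R :=
  \sum_(i : K) `|#|cellS i|%:R / q%:R - #|cellV i|%:R / #|V|%:R|.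

(** The shortage of a cell is divided evenly among its samples and sums to at most the discrepancy;
    rounding costs at most one vertex per sample, hence [q / #|V|]. *)
Lemma deal_deficit j0 : (0 < #|V|)%N ->
  \sum_j (q%:R^-1 - Num.min q%:R^-1 (#|dealt j0 j|%:R / #|V|%:R)) <=
  discrepancy + q%:R / #|V|%:R :> R.
Proof.
move=> V0; have n0 : 0 < #|V|%:R :> R by rewrite ltr0n.
have q0 : 0 < q%:R :> R by rewrite ltr0n; case: (q) j0 => [[]|].
pose D i : R := `|#|cellS i|%:R / q%:R - #|cellV i|%:R / #|V|%:R|.
apply: le_trans (_ : \sum_(j : 'I_q) (D (kappa (x j)) / #|cellS (kappa (x j))|%:R + #|V|%:R^-1)
  <= _).
  apply: ler_sum => j _; set i := kappa (x j).
  have mpos : (0 < #|cellS i|)%N.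
    by apply/card_gt0P; exists j; rewrite inE.
  have m0 : 0 < #|cellS i|%:R :> R by rewrite ltr0n.
  have Dm0 : 0 <= D i / #|cellS i|%:R + #|V|%:R^-1.
    by rewrite addr_ge0 ?invr_ge0 // divr_ge0 ?normr_ge0.
  have [_|_] := leP q%:R^-1 (#|dealt j0 j|%:R / #|V|%:R : R); first by rewrite subrr.
  have big : #|cellV i|%:R <= (#|dealt j0 j|%:R + 1) * #|cellS i|%:R :> R.
    rewrite natr1 -natrM ler_nat; apply: leq_trans (ltnW (ltn_ceil _ mpos)) _.
    by rewrite leq_mul2r ltnS dealt_large orbT.
  have : #|cellS i|%:R / q%:R - #|cellV i|%:R / #|V|%:R <= D i by apply: ler_norm.
  move=> H.
  have := ler_wpM2r (ltW n0) H; rewrite mulrBl divfK ?lt0r_neq0 // => {}H.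
  rewrite lerBlDr -(ler_pM2r m0) -(ler_pM2r n0); move: H big m0.
  set M := #|cellS i|%:R; set Nn := #|cellV i|%:R; set F := #|dealt j0 j|%:R => H big m0.
  have -> : (D i / M + #|V|%:R^-1 + F / #|V|%:R) * M * #|V|%:R =
     D i * #|V|%:R + (F + 1) * M.
    by field; rewrite !lt0r_neq0.
  rewrite [q%:R^-1 * _]mulrC; lra.
rewrite big_split /= sumr_const card_ord -[_^-1 *+ _]mulr_natl lerD2r.
rewrite (partition_big (fun j => kappa (x j)) xpredT) //=; apply: ler_sum => i _.
rewrite (eq_bigr (fun=> D i / #|cellS i|%:R)) => [|j /eqP -> //].
rewrite sumr_const -[_ *+ _]mulr_natr.
have [->|m0] := eqVneq #|cellS i| 0%N; first by rewrite invr0 mulr0 mul0r normr_ge0.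
rewrite (_ : #|_| = #|cellS i|); last by apply: eq_card => j; rewrite !inE.
by rewrite divfK // pnatr_eq0.
Qed.

Lemma bernoulli_le (y : R) t : 0 <= y <= 1 -> 1 - (1 - y) ^+ t <= t%:R * y.
Proof.
move=> /andP[y0 y1]; elim: t => [|t IH]; first by rewrite expr0 subrr mul0r.
have p0 : 0 <= (1 - y) ^+ t by rewrite exprn_ge0 // subr_ge0.
have p1 : (1 - y) ^+ t <= 1 by rewrite exprn_ile1 ?subr_ge0 // lerBlDr lerDl.
rewrite exprS -natr1; nra.
Qed.

(** A coupling: draw a vertex of [V] uniformly and look at the sample point dealt to it. Since [X]
    is constant on cells, replacing the vertex by a sample point of the same cell changes no edge
    weight, and only the mass missing from the uniform distribution on the sample is lost. *)
Lemma transfer (T : sgraph) (X : V -> V -> R) j0 :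
  (0 < #|V|)%N -> (forall u v, 0 <= X u v <= 1) -> invariant2 kappa X ->
  (\sum_f kprod (@colored R C Q T _ c (fun i j => X (x i) (x j))) (edge_list T) f) / q%:R ^+ #|T|
  <= (\sum_f kprod (@colored R C Q T _ (c \o deal j0) X) (edge_list T) f) / #|V|%:R ^+ #|T|
   + #|T|%:R * (discrepancy + q%:R / #|V|%:R).
Proof.
move=> V0 X01 Xinv; have n0 : 0 < #|V|%:R :> R by rewrite ltr0n.
have q0 : 0 < q%:R :> R by rewrite ltr0n; case: (q) j0 => [[]|].
(* The mass common to the uniform distribution on the sample and the distribution of dealt
   vertices. *)
pose lam j : R := Num.min q%:R^-1 (#|dealt j0 j|%:R / #|V|%:R).
have lam0 j : 0 <= lam j by rewrite le_min invr_ge0 divr_ge0 ?ler0n.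
have lamq j : lam j <= q%:R^-1 by rewrite ge_min lexx.
pose G : {ffun T -> 'I_q} -> R :=
  kprod (@colored R C Q T _ c (fun i j => X (x i) (x j))) (edge_list T).
pose GV : {ffun T -> V} -> R := kprod (@colored R C Q T _ (c \o deal j0) X) (edge_list T).
suff: (\sum_f G f) / q%:R ^+ #|T| <= (\sum_f GV f) / #|V|%:R ^+ #|T|
  + #|T|%:R * (discrepancy + q%:R / #|V|%:R) by [].
have G01 f : 0 <= G f <= 1.
  by apply: prod01 => e; apply: colored01 => i j; apply: X01.
have sumlam : \sum_j lam j = 1 - \sum_j (q%:R^-1 - lam j).
  by rewrite sumrB sumr_const card_ord -[_ *+ _]mulr_natl mulfV ?lt0r_neq0 // subKr.
have lower : \sum_(f : {ffun T -> 'I_q}) (\prod_w lam (f w)) * G f <= (\sum_f GV f) / #|V|%:R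
  ^+ #|T|.
  apply: le_trans (_ : \sum_(f : {ffun T -> 'I_q}) (\prod_w (#|dealt j0 (f w)|%:R / #|V|%:R)) *
    G f <= _).
    apply: ler_sum => f _; rewrite ler_wpM2r //; first by case/andP: (G01 f).
    by apply: ler_prod => w _; rewrite lam0 /= ge_min lexx orbT.
  rewrite [leRHS]mulr_suml.
  under eq_bigr do rewrite big_split /= prodr_const exprVn mulrAC.
  rewrite -!mulr_suml ler_wpM2r ?invr_ge0 ?exprn_ge0 //.
  have E (f : {ffun T -> 'I_q}) : \prod_w #|dealt j0 (f w)|%:R = \sum_(g : {ffun T -> V})
    \prod_w (g w \in dealt j0 (f w))%:R :> R.
    rewrite -(bigA_distr_bigA (fun w v => (v \in dealt j0 (f w))%:R)) /=.
    by apply: eq_bigr => w _; rewrite sum_mem.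
  under eq_bigr do rewrite E mulr_suml.
  rewrite exchange_big /=; apply: ler_sum => g _.
  have GV0 : 0 <= GV g.
    by case/andP: (prod01 (edge_list T) xpredT (f := fun e => @colored R C Q T _ (c \o deal j0)
      X e.1 e.2 (g e.1) (g e.2)) (fun e => colored01 Q _ X01 _ _ _ _)).
  (* A map [g] is counted only for the [f] obtained by dealing its values. *)
  pose f0 : {ffun T -> 'I_q} := [ffun w => deal j0 (g w)].
  pose Z (f : {ffun T -> 'I_q}) : R := (\prod_w (g w \in dealt j0 (f w))%:R) * G f.
  suff: \sum_f Z f <= GV g by [].
  rewrite (bigD1 f0) //= [X in _ + X]big1 ?addr0; last first.
    move=> f fN; have [w fw] : exists w : T, fun_of_fin f w != deal j0 (g w).
      apply/existsP; apply: contraNT fN => /existsPn H; apply/eqP/ffunP => w.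
      by rewrite ffunE; apply/eqP; rewrite -[_ == _]negbK H.
    by rewrite /Z (bigD1 w) //= inE [_ == f w]eq_sym (negPf fw) andbF !mul0r.
  have [good|/existsPn none] := boolP [exists w, g w \notin dealt j0 (deal j0 (g w))].
    have /existsP[w wN] := good.
    by rewrite /Z (bigD1 w) //= ffunE (negPf wN) !mul0r.
  have kg w : kappa (g w) = kappa (x (deal j0 (g w))).
    by have := none w; rewrite negbK inE => /andP[/eqP].
  rewrite /Z big1 ?mul1r => [|w _]; last by rewrite ffunE (negbNE (none w)).
  rewrite le_eqVlt; apply/orP; left; apply/eqP.
  rewrite /G /GV /kprod; apply: eq_bigr => e _; rewrite /colored /allowed !ffunE /=.
  by congr (_ * _); apply: Xinv; rewrite kg.
(* [G] is at most 1, so the loss is at most the missing mass [1 - (1 - y) ^ t], where [y] is the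
   deficit of a single draw. *)
have diff : \sum_f q%:R ^- #|T| * G f - \sum_(f : {ffun T -> 'I_q}) (\prod_w lam (f w)) * G f <=
    #|T|%:R * (discrepancy + q%:R / #|V|%:R).
  apply: le_trans (_ : \sum_(f : {ffun T -> 'I_q}) (q%:R ^- #|T| - \prod_w lam (f w)) <= _).
    rewrite -sumrB; apply: ler_sum => f _; rewrite -mulrBl ler_piMr //;
      last by case/andP: (G01 f).
    have -> : q%:R ^- #|T| = \prod_(w : T) q%:R^-1 :> R by rewrite prodr_const exprVn.
    by rewrite subr_ge0; apply: ler_prod => w _; rewrite lam0 lamq.
  rewrite sumrB sumr_const card_ffun card_ord -[_ *+ _]mulr_natl natrX mulfV ?expf_neq0
    ?lt0r_neq0 //.
  rewrite -(bigA_distr_bigA (fun (_ : T) j => lam j)) /= prodr_const sumlam.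
  have def := deal_deficit j0 V0.
  apply: le_trans (bernoulli_le _ _) _.
    rewrite sumr_ge0 => [|j _]; last by rewrite subr_ge0.
    by rewrite -subr_ge0 -sumlam sumr_ge0.
  by rewrite ler_wpM2l.
rewrite [leLHS]mulrC mulr_sumr; lra.
Qed.

End Transfer.

(** * The optimum of a sample and of the whole graph *)

Section Optimum.
Variables (T : sgraph) (C : finType).

Definition compat (Q : {set C * C}) (V : finType) (c : V -> C) (A : rel V) : rel V :=
  fun u v => A u v && allowed Q c u v.

Definition homs (Q : {set C * C}) (V : finType) (c : V -> C) (A : rel V) : nat :=
  #|[set y : {ffun T -> V} | ghom (compat Q c A) y]|.

Definition opt (RR : {set {set C * C}}) (V : finType) (A : rel V) : nat :=
  \max_(Q in RR) \max_(c : {ffun V -> C}) homs Q c A.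

Definition sample (V : finType) (q : nat) (A : rel V) (x : {ffun 'I_q -> V}) : rel 'I_q :=
  fun i j => A (x i) (x j).

Lemma homs_le_opt (RR : {set {set C * C}}) (V : finType) (A : rel V) Q (c : {ffun V -> C}) :
  Q \in RR -> (homs Q c A <= opt RR A)%N.
Proof.
by move=> QR; apply: leq_trans (leq_bigmax_cond _ QR); apply: (leq_bigmax c).
Qed.

Lemma opt_le (R : realFieldType) (RR : {set {set C * C}}) (V : finType) (A : rel V) (z : R) :
  0 <= z -> (forall Q (c : {ffun V -> C}), Q \in RR -> (homs Q c A)%:R <= z) ->
  (opt RR A)%:R <= z.
Proof.
move=> z0 H; rewrite /opt.
have maxle (a b : nat) : a%:R <= z -> b%:R <= z -> (maxn a b)%:R <= z.
  by case: (leqP a b).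
elim/big_ind: _ => // Q QR; elim/big_ind: _ => // c _; exact: H.
Qed.

Lemma homs_kprod (R : realFieldType) (Q : {set C * C}) (V : finType) (c : V -> C) (A : rel V) :
  symmetric A ->
  (homs Q c A)%:R =
    \sum_f kprod (@colored R C Q T V c (fun i j => (A i j)%:R)) (edge_list T) f.
Proof.
move=> Asym; have csym : symmetric (compat Q c A).
  by move=> u v; rewrite /compat Asym /allowed andbC [in RHS]andbC; congr (_ && _); rewrite andbC.
rewrite /homs -sum1_card natr_sum big_mkcond; apply: eq_bigr => f _; rewrite inE.
transitivity ((ghom (compat Q c A) f)%:R : R); first by case: ghom.
rewrite -(ghom_kprod _ _ csym) /kprod; apply: eq_bigr => e _.
by rewrite /colored /compat; case: (A _ _); rewrite ?mul1r ?mul0r.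
Qed.

Variables (R : realFieldType) (V : finType) (q : nat).
Hypotheses (V0 : (0 < #|V|)%N) (q0 : (0 < q)%N).

Lemma sample_lower RR (A : rel V) :
  (opt RR A)%:R / #|V|%:R ^+ #|T| <=
  (\sum_(x : {ffun 'I_q -> V}) (opt RR (sample A x))%:R) / (#|V|%:R ^+ q * q%:R ^+ #|T|)
   + 2 * #|T|%:R ^+ 2 / q%:R :> R.
Proof.
have n0 : 0 < #|V|%:R :> R by rewrite ltr0n.
have q0' : 0 < q%:R :> R by rewrite ltr0n.
rewrite ler_pdivrMr ?exprn_gt0 //; apply: opt_le => [|Q c QR].
  rewrite mulr_ge0 ?exprn_ge0 ?ler0n // addr_ge0 // divr_ge0 ?mulr_ge0 ?exprn_ge0 ?sumr_ge0
    ?ler0n //.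
rewrite -ler_pdivrMr ?exprn_gt0 //.
pose Y (y : {ffun T -> V}) : R := (ghom (compat Q c A) y)%:R.
have Y1 y : `|Y y| <= 1 by rewrite /Y; case: ghom; rewrite ?normr1 ?normr0.
have I0 : (0 < #|'I_q|)%N by rewrite card_ord.
have := sampling_average I0 V0 Y1; rewrite card_ord ler_norml => /andP[+ _].
have sumY : \sum_y Y y = (homs Q c A)%:R.
  rewrite /homs -sum1_card natr_sum [RHS]big_mkcond; apply: eq_bigr => y _; rewrite inE /Y.
  by case: ghom.
rewrite sumY lerBrDl lerBlDr => /le_trans; apply.
rewrite lerD2r ler_wpM2r ?invr_ge0 ?mulr_ge0 ?exprn_ge0 ?ler0n //.
apply: ler_sum => x _.
apply: le_trans (_ : (homs Q [ffun i => c (x i)] (sample A x))%:R <= _); last first.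
  by rewrite ler_nat homs_le_opt.
rewrite /homs -sum1_card natr_sum [leRHS]big_mkcond; apply: ler_sum => f _; rewrite inE /Y.
rewrite (_ : ghom _ _ = ghom (compat Q [ffun i => c (x i)] (sample A x)) f); first by case: ghom.
apply: eq_forallb => u; apply: eq_forallb => v.
by rewrite /compat /allowed /sample !ffunE.
Qed.

(** A second moment bound: the centred indicator [z] of a cell has sum 0, so its squared sample mean
    averages to at most [2 * 2 ^ 2 / q]. The inequality [|y| <= e + y ^ 2 / e] turns this into a
    first moment without square roots. *)
Lemma discrepancy_mean (K : finType) (kappa : V -> K) (e : R) : 0 < e ->
  (\sum_(x : {ffun 'I_q -> V}) discrepancy R kappa x) / #|V|%:R ^+ q <=
  #|K|%:R * (e + 8 / (q%:R * e)).
Proof.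
move=> e0; have n0 : 0 < #|V|%:R :> R by rewrite ltr0n.
have q0' : 0 < q%:R :> R by rewrite ltr0n.
rewrite exchange_big /= mulr_suml.
apply: le_trans (_ : \sum_(i : K) (e + 8 / (q%:R * e)) <= _);
  last by rewrite sumr_const [leRHS]mulr_natl.
apply: ler_sum => i _.
set beta := #|_|%:R / #|V|%:R.
pose z v : R := (kappa v == i)%:R - beta.
have b01 : 0 <= beta <= 1.
  rewrite /beta divr_ge0 ?ler0n //= ler_pdivrMr // mul1r ler_nat.
  exact: max_card.
have z1 v : `|z v| <= 1.
  by move/andP: b01 => [b0 b1]; rewrite /z ler_norml; case: eqP => _ /=; apply/andP; split; lra.
have z0 : \sum_v z v = 0.
  rewrite sumrB sumr_const -[_ *+ _]mulr_natr /beta divfK ?lt0r_neq0 //.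
  apply/eqP; rewrite subr_eq0; apply/eqP; rewrite -sum_mem; apply: eq_bigr => v _.
  by rewrite inE.
pose Y (y : {ffun bool -> V}) := z (y true) * z (y false).
have sum2 (O : finType) (g : O -> R) :
    \sum_(y : {ffun bool -> O}) g (y true) * g (y false) = (\sum_a g a) ^+ 2.
  rewrite (sum_ffun_bool (fun a b => g a * g b)) expr2 mulr_suml.
  by apply: eq_bigr => a _; rewrite mulr_sumr.
have Y1 y : `|Y y| <= 1 by rewrite /Y normrM mulr_ile1.
have I0 : (0 < #|'I_q|)%N by rewrite card_ord.
have := sampling_average I0 V0 Y1; rewrite sum2 z0 expr0n /= mul0r subr0 card_bool card_ord.
rewrite (eq_bigr (fun x : {ffun 'I_q -> V} => (\sum_j z (x j)) ^+ 2)); last first.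
  by move=> x _; rewrite -sum2; apply: eq_bigr => f _; rewrite /Y !ffunE.
move=> /(le_trans (ler_norm _)) H.
pose a (x : {ffun 'I_q -> V}) : R := (\sum_j z (x j)) / q%:R.
have aE (x : {ffun 'I_q -> V}) : #|[set j : 'I_q | kappa (x j) == i]|%:R / q%:R - beta = a x.
  rewrite /a sumrB sumr_const card_ord -[beta *+ q]mulr_natr mulrBl mulfK ?lt0r_neq0 //.
  congr (_ / _ - _); rewrite -sum_mem; apply: eq_bigr => j _; by rewrite inE.
under eq_bigr do rewrite aE.
have absle (y : R) : `|y| <= e + y ^+ 2 / e.
  have [ye|ey] := lerP `|y| e; first by apply: le_trans ye _;
    rewrite lerDl divr_ge0 ?sqr_ge0 // ltW.
  apply: le_trans (_ : y ^+ 2 / e <= _); last by rewrite lerDr ltW.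
  by rewrite ler_pdivlMr // -real_normK ?num_real // expr2 ler_wpM2l // ltW.
apply: le_trans (_ : (\sum_(x : {ffun 'I_q -> V}) (e + a x ^+ 2 / e)) / #|V|%:R ^+ q <= _).
  by rewrite ler_wpM2r ?invr_ge0 ?exprn_ge0 ?ler0n //; apply: ler_sum.
rewrite big_split /= sumr_const card_ffun card_ord -[_ *+ (_ ^ _)]mulr_natr natrX.
rewrite mulrDl mulfK ?expf_neq0 ?lt0r_neq0 // lerD2l -mulr_suml.
rewrite mulrAC invfM mulrA ler_wpM2r ?invr_ge0 ?(ltW e0) //.
apply: le_trans (le_trans H _); last by rewrite -natrX -natrM.
rewrite invfM [_^-1 * _^-1]mulrC mulrA; apply: ler_wpM2r; first by rewrite invr_ge0 exprn_ge0.
rewrite mulr_suml; apply: ler_sum => x _.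
by rewrite /a expr_div_n.
Qed.

Lemma fourcycles_mean (z : V -> V -> R) : (forall i j, `|z i j| <= 1) ->
  (\sum_(x : {ffun 'I_q -> V}) fourcycles (fun i j => z (x i) (x j)) / q%:R ^+ 4) / #|V|%:R ^+ q
  <= fourcycles z / #|V|%:R ^+ 4 + 32 / q%:R.
Proof.
move=> z1; have Y1 y : `|cycle4 z y| <= 1.
  by rewrite /cycle4 !normrM !mulr_ile1 ?mulr_ge0 ?normr_ge0.
have I0 : (0 < #|'I_q|)%N by rewrite card_ord.
have := sampling_average I0 V0 Y1; rewrite -fourcyclesE !card_ord.
move=> /(le_trans (ler_norm _)); rewrite lerBlDl.
have -> : 2 * 4%:R ^+ 2 / q%:R = 32 / q%:R :> R by congr (_ / _); rewrite -natrX -natrM.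
apply: le_trans; rewrite le_eqVlt; apply/orP; left; apply/eqP.
rewrite [in RHS]invfM [in RHS]mulrA [RHS]mulrAC; congr (_ / _).
rewrite mulr_suml; apply: eq_bigr => x _; congr (_ / _).
rewrite fourcyclesE; apply: eq_bigr => f _.
by rewrite /cycle4 !ffunE.
Qed.

End Optimum.

Lemma eq_homs (T : sgraph) (C : finType) (Q : {set C * C}) (V : finType) (c c' : V -> C)
    (A : rel V) : c =1 c' -> homs T Q c A = homs T Q c' A.
Proof.
move=> E; apply: eq_card => y; rewrite !inE.
by apply: eq_forallb => u; apply: eq_forallb => v; rewrite /compat /allowed !E.
Qed.

(** For a colouring [c] of the sample: pass from [A] to its cell averages on the sample, deal [c]
    out to [V], and pass back to [A] on [V]. The three error terms are the four-cycle bound on the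
    sample, the loss in [transfer], and the cut norm on [V]. *)
Lemma sample_upper (R : realFieldType) (T : sgraph) (C : finType) (RR : {set {set C * C}})
    (V K : finType) (q : nat) (A : rel V) (kappa : V -> K) (x : {ffun 'I_q -> V})
    (delta e : R) :
  let X i j : R := (A i j)%:R in
  let z i j := X i j - proj kappa X i j in
  symmetric A -> (0 < #|V|)%N -> (0 < q)%N -> 0 < e ->
  cut_le (delta * #|V|%:R ^+ 2) z ->
  (opt T RR (sample A x))%:R / q%:R ^+ #|T| <=
  (opt T RR A)%:R / #|V|%:R ^+ #|T|
  + #|T|%:R ^+ 2 * (#|C|%:R ^+ 2 *
      (e + (fourcycles (fun i j => z (x i) (x j)) / q%:R ^+ 4) / e ^+ 3))
  + #|T|%:R * (discrepancy R kappa x + q%:R / #|V|%:R)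
  + #|T|%:R ^+ 2 * (#|C|%:R ^+ 2 * delta).
Proof.
move=> X z Asym V0 q0 e0 Hz.
have n0 : 0 < #|V|%:R :> R by rewrite ltr0n.
have q0' : 0 < q%:R :> R by rewrite ltr0n.
have X01 i j : 0 <= X i j <= 1 by rewrite /X ler0n lern1 leq_b1.
have W01 i j : 0 <= proj kappa X i j <= 1 by apply: proj01.
set B := (_ + _).
have bound Q (c : {ffun 'I_q -> C}) : Q \in RR ->
    (homs T Q c (sample A x))%:R / q%:R ^+ #|T| <= B.
  move=> QR; pose j0 := Ordinal q0.
  have I0 : (0 < #|'I_q|)%N by rewrite card_ord.
  have s1 := @fourcycles_cut_le R 'I_q e
    (fourcycles (fun i j => z (x i) (x j)) / q%:R ^+ 4) (fun i j => z (x i) (x j)) I0 e0.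
  rewrite card_ord divfK ?expf_neq0 ?lt0r_neq0 // in s1.
  have := @colored_counting R C Q T 'I_q c (fun i j => X (x i) (x j))
    (fun i j => proj kappa X (x i) (x j)) (e + (fourcycles (fun i j => z (x i) (x j)) / q%:R ^+
      4) / e ^+ 3) I0 (fun i j => X01 _ _) (fun i j => W01 _ _).
  rewrite !card_ord => /(_ (s1 (lexx _))).
  rewrite -(@homs_kprod T C R Q 'I_q c (sample A x)) => [|i j]; last exact: Asym.
  have s2 := @transfer R C V K Q kappa q x c T (proj kappa X) j0 V0 W01 (proj_invariant (c :=
    kappa) X).
  have := @colored_counting R C Q T V (c \o deal kappa x j0) X (proj kappa X) delta V0 X01 W01 Hz.
  rewrite -(@homs_kprod T C R Q V _ A Asym).
  have s3 : (homs T Q (c \o deal kappa x j0) A)%:R / #|V|%:R ^+ #|T| <= (opt T RR A)%:R /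
    #|V|%:R ^+ #|T| :> R.
    rewrite ler_wpM2r ?invr_ge0 ?exprn_ge0 ?ler0n // ler_nat.
    rewrite (@eq_homs _ _ _ _ _ [ffun v => c (deal kappa x j0 v)]); last by move=> v;
      rewrite ffunE.
    exact: homs_le_opt.
  rewrite !ler_norml => /andP[s4 _] /andP[_ s5].
  rewrite /B; lra.
have d0 : 0 <= delta.
  have H0 (i : V) : 0 <= (0 : R) <= 1 by rewrite lexx ler01.
  have := le_trans (normr_ge0 _) (Hz (fun=> 0) (fun=> 0) H0 H0).
  by rewrite pmulr_lge0 // exprn_gt0.
have f0 : 0 <= fourcycles (fun i j => z (x i) (x j)) / q%:R ^+ 4.
  rewrite divr_ge0 ?exprn_ge0 ?ler0n //.
  by apply: sumr_ge0 => i _; apply: sumr_ge0 => j _; apply: sqr_ge0.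
have disc0 : 0 <= discrepancy R kappa x by apply: sumr_ge0.
have B0 : 0 <= B.
  rewrite /B; apply: addr_ge0; [apply: addr_ge0; [apply: addr_ge0|]|].
  - by rewrite divr_ge0 ?exprn_ge0 ?ler0n.
  - rewrite !mulr_ge0 ?exprn_ge0 ?ler0n // addr_ge0 ?(ltW e0) //.
    by rewrite divr_ge0 ?exprn_ge0 ?(ltW e0).
  - by rewrite mulr_ge0 ?addr_ge0 ?divr_ge0 ?ler0n.
  - by rewrite !mulr_ge0 ?exprn_ge0 ?ler0n.
rewrite ler_pdivrMr ?exprn_gt0 //; apply: opt_le => [|Q' c QR'].
  by rewrite mulr_ge0 ?exprn_ge0 ?ler0n.
by rewrite -ler_pdivrMr ?exprn_gt0 // bound.
Qed.

(** The constants are chosen in the order [e], [d0], [k], [e2], [q], [N]: regularity for [d0] fixes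
    the number of cells, this fixes the tolerance [e2] for cell sizes, and only then can the sample
    size be chosen. *)
Theorem opt_sampling (R : realType) (T : sgraph) (C : finType) (RR : {set {set C * C}}) (eps :
  R) :
  0 < eps -> exists q N, (0 < q)%N /\
  forall (V : finType) (A : rel V), symmetric A -> (0 < #|V|)%N -> (N <= #|V|)%N ->
  `|(\sum_(x : {ffun 'I_q -> V}) (opt T RR (sample A x))%:R) / (#|V|%:R ^+ q * q%:R ^+ #|T|)
    - (opt T RR A)%:R / #|V|%:R ^+ #|T| | <= eps.
Proof.
move=> eps0.
pose t : R := #|T|%:R; pose B : R := t ^+ 2 * #|C|%:R ^+ 2 + 1.
have t0 : 0 <= t by rewrite ler0n.
have B0 : 0 < B by rewrite ltr_wpDl // mulr_ge0 ?exprn_ge0.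
pose e := eps / (8 * B); have e0 : 0 < e by rewrite divr_gt0 ?mulr_gt0.
have Be : B * e = eps / 8 by rewrite /e; field; rewrite lt0r_neq0.
clearbody e.
have e30 : 0 < e ^+ 3 by apply: exprn_gt0.
pose d0 := Num.min e (e * e ^+ 3) / 16.
have d00 : 0 < d0 by rewrite divr_gt0 // lt_min e0 mulr_gt0.
have d01 : 2 * d0 <= e.
  have : d0 * 16 <= e by rewrite /d0 divfK ?pnatr_eq0 // ge_min lexx.
  by move: d00; lra.
have d02 : 8 * d0 / e ^+ 3 <= e.
  have : d0 * 16 <= e * e ^+ 3 by rewrite /d0 divfK ?pnatr_eq0 // ge_min lexx orbT.
  by rewrite ler_pdivrMr //; move: d00; lra.
clearbody d0; have [k Hk] := regularity d00.
pose e2 := eps / (8 * (t + 1) * k.+1%:R).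
have e20 : 0 < e2 by rewrite divr_gt0 // !mulr_gt0 // ltr_wpDl.
have kt : t * (k.+1%:R * (e2 + e2)) <= eps / 4.
  rewrite (_ : t * _ = (t / (t + 1)) * (eps / 4)); last first.
    by rewrite /e2; field; rewrite nat1r pnatr_eq0 andbT lt0r_neq0 // ltr_wpDl.
  rewrite -[leRHS]mul1r ler_wpM2r ?divr_ge0 ?(ltW eps0) //.
  by rewrite ler_pdivrMr ?mul1r ?lerDl // ltr_wpDl.
clearbody e2.
(* The three summands make the sampling errors of the four-cycles, of the cell sizes and of
   [sample_lower] small, in this order. *)
pose big := 32 / e ^+ 3 / e + 8 / e2 / e2 + 2 * t ^+ 2 / eps.
pose q := (Num.truncn big).+1; have bq : big < q%:R by apply: truncnS_gt.
pose N := (Num.truncn (8 * t * q%:R / eps)).+1.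
exists q, N; split=> // V A Asym V0 NV.
have n0 : 0 < #|V|%:R :> R by rewrite ltr0n.
have q0 : 0 < q%:R :> R by rewrite ltr0n.
have big1 : 0 <= 32 / e ^+ 3 / e by rewrite divr_ge0 ?divr_ge0 ?(ltW e30) ?(ltW e0).
have big2 : 0 <= 8 / e2 / e2 by rewrite divr_ge0 ?divr_ge0 ?(ltW e20).
have big3 : 0 <= 2 * t ^+ 2 / eps by rewrite divr_ge0 ?mulr_ge0 ?exprn_ge0 ?(ltW eps0).
have q1 : 32 / q%:R / e ^+ 3 <= e.
  rewrite mulrAC ler_pdivrMr // -ler_pdivrMl // mulrC; move: bq; rewrite /big; lra.
have q2 : 8 / (q%:R * e2) <= e2.
  rewrite invfM mulrA mulrAC ler_pdivrMr // -ler_pdivrMl // mulrC; move: bq; rewrite /big; lra.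
have q3 : 2 * t ^+ 2 / q%:R <= eps.
  rewrite ler_pdivrMr // -ler_pdivrMl // mulrC; move: bq; rewrite /big; lra.
have n1 : t * (q%:R / #|V|%:R) <= eps / 8.
  rewrite mulrA ler_pdivrMr //.
  have : 8 * t * q%:R / eps <= #|V|%:R.
    by apply: le_trans (ltW (truncnS_gt _)) _; rewrite ler_nat.
  rewrite ler_pdivrMr //; lra.
rewrite ler_norml; apply/andP; split.
  have := sample_lower T R V0 (ltn0Sn _ : (0 < q)%N) RR A.
  by rewrite -/t; lra.
have [kappa few] := Hk V (fun i j => (A i j)%:R) (indicator01 R A).
pose z i j : R := (A i j)%:R - proj kappa (fun i j => (A i j)%:R) i j.
have Hz : cut_le (2 * d0 * #|V|%:R ^+ 2) z.
  by move=> a b a01 b01; apply: (regular_cut_norm (ltW d00) (indicator01 R A) few a01 b01).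
have z1 i j : `|z i j| <= 1.
  rewrite /z; have /andP[? ?] := indicator01 R A i j;
    have /andP[? ?] := proj01 kappa i j (indicator01 R A).
  by rewrite ler_norml; apply/andP; split; lra.
have C4 : fourcycles z / #|V|%:R ^+ 4 <= 8 * d0.
  rewrite ler_pdivrMr ?exprn_gt0 //; apply: le_trans (fourcycles_cut z1 Hz) _.
  by rewrite -[4%N]/(2 + 2)%N exprD; lra.
rewrite lerBlDr.
pose err (x : {ffun 'I_q -> V}) := t ^+ 2 * (#|C|%:R ^+ 2 *
      (e + (fourcycles (fun i j => z (x i) (x j)) / q%:R ^+ 4) / e ^+ 3))
  + t * (discrepancy R kappa x + q%:R / #|V|%:R)
  + t ^+ 2 * (#|C|%:R ^+ 2 * (2 * d0)).
set h := (opt T RR A)%:R / _.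
apply: le_trans (_ : (\sum_(x : {ffun 'I_q -> V}) (h + err x)) / #|V|%:R ^+ q <= _).
  rewrite invfM mulrA mulrAC ler_wpM2r ?invr_ge0 ?exprn_ge0 ?ler0n // mulr_suml.
  apply: ler_sum => x _.
  have := sample_upper (delta := 2 * d0) T RR x Asym V0 (ltn0Sn _) e0 Hz.
  by rewrite /err -/t -/h -/z; lra.
have nq : #|V|%:R ^+ q != 0 :> R by rewrite expf_neq0 ?lt0r_neq0.
have mean_const (y : R) : (\sum_(x : {ffun 'I_q -> V}) y) / #|V|%:R ^+ q = y.
  by rewrite sumr_const card_ffun card_ord -[_ *+ (_ ^ _)]mulr_natr natrX mulfK.
(* The error of a sample is affine in its four-cycle density and its discrepancy, so only the means
   of these two enter. *)
have mean_affine (a b c : R) (f g : {ffun 'I_q -> V} -> R) :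
    (\sum_x (c + a * f x + b * g x)) / #|V|%:R ^+ q =
    c + a * ((\sum_x f x) / #|V|%:R ^+ q) + b * ((\sum_x g x) / #|V|%:R ^+ q).
  by rewrite !big_split /= -!mulr_sumr 2!mulrDl mean_const -!mulrA.
pose F (x : {ffun 'I_q -> V}) := fourcycles (fun i j => z (x i) (x j)) / q%:R ^+ 4.
pose M1 := (\sum_x F x) / #|V|%:R ^+ q.
pose M2 := (\sum_(x : {ffun 'I_q -> V}) discrepancy R kappa x) / #|V|%:R ^+ q.
have m1 : M1 <= fourcycles z / #|V|%:R ^+ 4 + 32 / q%:R := @fourcycles_mean R V q V0 isT z z1.
have m2 : M2 <= k.+1%:R * (e2 + 8 / (q%:R * e2)).
  by have := @discrepancy_mean R V q V0 isT _ kappa e2 e20; rewrite card_ord.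
have -> : (\sum_(x : {ffun 'I_q -> V}) (h + err x)) / #|V|%:R ^+ q =
  h + t ^+ 2 * (#|C|%:R ^+ 2 * (e + M1 / e ^+ 3)) + t * (M2 + q%:R / #|V|%:R)
   + t ^+ 2 * (#|C|%:R ^+ 2 * (2 * d0)).
  have [c0 c0E] : exists c0, c0 = h + t ^+ 2 * (#|C|%:R ^+ 2 * e)
    + t * (q%:R / #|V|%:R) + t ^+ 2 * (#|C|%:R ^+ 2 * (2 * d0)) by eexists.
  rewrite (eq_bigr (fun x => c0 + t ^+ 2 * #|C|%:R ^+ 2 / e ^+ 3 * F x + t * discrepancy R
    kappa x)).
    by rewrite mean_affine -/M1 -/M2 c0E; clearbody M1 M2; ring.
  by move=> x _; rewrite /err c0E -/(F x); ring.
clearbody M1 M2.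
have M1le : M1 / e ^+ 3 <= e + e.
  apply: le_trans (_ : (8 * d0 + 32 / q%:R) / e ^+ 3 <= _).
    by rewrite ler_wpM2r ?invr_ge0 ?(ltW e30) //; lra.
  by rewrite mulrDl; lra.
have p1 : t ^+ 2 * (#|C|%:R ^+ 2 * (e + M1 / e ^+ 3)) <= B * (3 * e).
  rewrite mulrA; apply: le_trans (_ : t ^+ 2 * #|C|%:R ^+ 2 * (3 * e) <= _).
    by rewrite ler_wpM2l ?mulr_ge0 ?exprn_ge0 //; lra.
  by rewrite ler_wpM2r ?mulr_ge0 ?(ltW e0) // /B lerDl.
have p2 : t ^+ 2 * (#|C|%:R ^+ 2 * (2 * d0)) <= B * e.
  rewrite [leLHS]mulrA; apply: le_trans (_ : t ^+ 2 * #|C|%:R ^+ 2 * e <= _).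
    by rewrite ler_wpM2l ?mulr_ge0 ?exprn_ge0.
  by rewrite ler_wpM2r ?(ltW e0) // /B lerDl.
have p3 : t * M2 <= eps / 4.
  apply: le_trans kt; rewrite ler_wpM2l //; apply: le_trans m2 _.
  by rewrite ler_wpM2l ?lerD2l.
(* The errors sum to at most 3/8 + 1/8 + 1/4 + 1/8 of [eps]. *)
rewrite mulrDr; lra.
Qed.

Local Open Scope nat_scope.

(** * Copies and injective homomorphisms *)

Lemma set2_eq (V : finType) (a b c d : V) :
  [set a; b] = [set c; d] -> (a = c /\ b = d) \/ (a = d /\ b = c).
Proof.
move=> /setP E.
have := E a; rewrite !inE eqxx /= => /esym/orP[]/eqP Ha;
have := E b; rewrite !inE eqxx orbT => /esym/orP[]/eqP Hb;
have := E c; have := E d; rewrite !inE !eqxx ?orbT;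
move=> /orP[]/eqP Hd /orP[]/eqP Hc; subst; auto.
Qed.

Section Copies.
Variables (T : sgraph) (V : finType).
Implicit Types (H : subg V) (f : {ffun T -> V}).

Definition link H : rel V := fun u v => [set u; v] \in H.2.

(** The image condition keeps the isolated vertices of [T] inside the vertex set of [H]. *)
Definition inj_homs H : {set {ffun T -> V}} :=
  [set f : {ffun T -> V} | [&& injectiveb f, f @: [set: T] \subset H.1 & ghom (link H) f]].

Definition copy_of f : subg V :=
  (f @: [set: T], [set [set f p.1; f p.2] | p : T * T & adj p.1 p.2]).

Definition automorphisms : {set {ffun T -> T}} :=
  [set a : {ffun T -> T} | injectiveb a && [forall x, forall y, adj x y == adj (a x) (a y)]].

Lemma automorphisms_gt0 : 0 < #|automorphisms|.
Proof.
apply/card_gt0P; exists [ffun x => x]; rewrite inE; apply/andP; split.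
  by apply/injectiveP => x y; rewrite !ffunE.
by apply/forallP => x; apply/forallP => y; rewrite !ffunE.
Qed.

Lemma link_sym H : symmetric (link H).
Proof. by move=> u v; rewrite /link setUC. Qed.

Lemma copy_edge f x y : injective f ->
  ([set f x; f y] \in (copy_of f).2) = adj x y.
Proof.
move=> finj; apply/imsetP/idP => [[[p q]] | xy]; last by exists (x, y); rewrite ?inE.
rewrite inE /= => pq /set2_eq[] [/finj -> /finj ->] //.
by rewrite adj_sym.
Qed.

Lemma automorphism_onto (a : {ffun T -> T}) : injective a -> forall x, exists y, a y = x.
Proof. by move=> /injF_bij [b _ bK] x; exists (b x). Qed.

(** Two injective maps with the same image graph differ by a permutation of [T]; by [copy_edge] the
    image determines adjacency, so the permutation is an automorphism. *)
Lemma fiber_copy H f0 : f0 \in inj_homs H ->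
  [set f in inj_homs H | copy_of f == copy_of f0] =
  [set [ffun x => f0 (a x)] | a : {ffun T -> T} in automorphisms].
Proof.
rewrite inE => /and3P[/injectiveP inj0 sub0 /ghomP hom0].
apply/setP => f; rewrite !inE; apply/andP/imsetP.
  move=> [/and3P[/injectiveP injf subf /ghomP homf] /eqP E].
  have E1 : f @: [set: T] = f0 @: [set: T] by case: E.
  pose a : {ffun T -> T} := [ffun x => odflt x [pick y | f0 y == f x]].
  have aE x : f0 (a x) = f x.
    rewrite ffunE; case: pickP => [y /eqP //|none].
    have : f x \in f0 @: [set: T] by rewrite -E1 imset_f.
    by move=> /imsetP[y _ fy]; have := none y; rewrite fy eqxx.
  exists a; last by apply/ffunP => x; rewrite ffunE aE.
  rewrite inE; apply/andP; split.
    by apply/injectiveP => x y axy; apply: injf; rewrite -!aE axy.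
  apply/forallP => x; apply/forallP => y.
  by rewrite -(copy_edge _ _ injf) -(copy_edge _ _ inj0) !aE E.
move=> [a]; rewrite inE => /andP[/injectiveP ainj /forallP aadj] ->.
have adjE x y : adj x y = adj (a x) (a y) by have /forallP/(_ y)/eqP := aadj x.
split.
  apply/and3P; split.
  - by apply/injectiveP => x y; rewrite !ffunE => /inj0/ainj.
  - by apply/subsetP => _ /imsetP[x _ ->]; rewrite ffunE (subsetP sub0) ?imset_f.
  - by apply/ghomP => x y xy; rewrite !ffunE; apply: hom0; rewrite -adjE.
apply/eqP; rewrite /copy_of; congr pair.
  apply/setP => v; apply/imsetP/imsetP => -[x _ ->].
    by exists (a x); rewrite ?ffunE.
  by have [y <-] := automorphism_onto ainj x; exists y; rewrite ?ffunE.
apply/setP => e; apply/imsetP/imsetP => -[[x y]]; rewrite inE /= => xy ->.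
  by exists (a x, a y); rewrite ?inE /= -?adjE ?ffunE.
have [x' Ex] := automorphism_onto ainj x; have [y' Ey] := automorphism_onto ainj y.
by exists (x', y'); rewrite ?inE /= ?ffunE ?Ex ?Ey // adjE Ex Ey.
Qed.

End Copies.

Section InGraph.
Variables (G : sgraph) (H : subg G).
Hypothesis HG : H \in subgraphs (whole G).

Lemma copiesE (T : sgraph) : copies T H = @copy_of T G @: inj_homs T H.
Proof.
move: HG; rewrite inE => /and3P[_ HE /forallP Hin].
apply/setP => S; rewrite inE; apply/andP/imsetP.
  rewrite inE => -[/and3P[S1 S2 /forallP Sin] /existsP[f /and3P[finj /eqP fS /forallP fadj]]].
  have adjE x y : adj x y = ([set f x; f y] \in S.2) by have /forallP/(_ y)/eqP := fadj x.
  exists f.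
    rewrite inE finj fS S1; apply/ghomP => x y; rewrite adjE.
    exact: (subsetP S2).
  case: S S1 S2 Sin fS fadj adjE => S1 S2 /= sub1 sub2 Sin fS _ adjE.
  rewrite /copy_of fS; congr pair; apply/setP => e; apply/idP/imsetP.
    (* Both ends of an edge of [S] lie in [S.1], the image of [f], so the edge comes from a pair of
       vertices of [T]. *)
    move=> eS; have /imsetP[[u v]] := subsetP HE _ (subsetP sub2 _ eS).
    rewrite inE /= => uv E; have := Sin e; rewrite eS /= E => /subsetP sub.
    have : u \in S1 by apply: sub; rewrite !inE eqxx.
    have : v \in S1 by apply: sub; rewrite !inE eqxx orbT.
    rewrite -fS => /imsetP[y _ vy] /imsetP[x _ ux].
    by exists (x, y); rewrite ?inE /= -?ux -?vy // adjE -ux -vy -E.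
  by move=> [[x y]]; rewrite inE /= adjE => + ->.
move=> [f]; rewrite inE => /and3P[/injectiveP finj fH /ghomP fhom] ->.
split.
  rewrite inE; apply/and3P; split => //=.
    by apply/subsetP => e /imsetP[[x y]]; rewrite inE /= => xy ->; apply: fhom.
  apply/forallP => e; apply/implyP => /imsetP[[x y] _ ->] /=.
  by apply/subsetP => v; rewrite !inE => /orP[]/eqP->; rewrite imset_f.
apply/existsP; exists f; rewrite eqxx /=; apply/andP; split; first exact/injectiveP.
by apply/forallP => x; apply/forallP => y; rewrite (copy_edge _ _ finj).
Qed.

(** The fibres of [copy_of] are orbits of the automorphisms, and distinct automorphisms give
    distinct maps because [f0] is injective. *)
Lemma card_copies (T : sgraph) : #|copies T H| * #|automorphisms T| = #|inj_homs T H|.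
Proof.
rewrite -[RHS]sum1_card (partition_big_imset (@copy_of T G)) -copiesE /= -sum_nat_const.
apply: eq_bigr => S; rewrite copiesE => /imsetP[f0 f0H ->].
have := f0H; rewrite inE => /and3P[/injectiveP inj0 _ _].
rewrite (eq_bigl (fun f => f \in [set f in inj_homs T H | copy_of f == copy_of f0]));
  last by move=> f; rewrite [RHS]inE.
rewrite fiber_copy // sum1_card card_imset => [|a a' /ffunP E].
  by rewrite -sum1_card; apply: eq_bigl => a; rewrite inE.
by apply/ffunP => x; have := E x; rewrite !ffunE => /inj0.
Qed.

Lemma copies_eq0 (T : sgraph) : (copies T H == set0) = (inj_homs T H == set0).
Proof. by rewrite copiesE imset_eq0. Qed.

End InGraph.

Lemma family_freeE (G : sgraph) (Fs : seq sgraph) (H : subg G) :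
  H \in subgraphs (whole G) ->
  family_free Fs H = all (fun F => inj_homs F H == set0) Fs.
Proof. by move=> HG; apply: eq_all => F; rewrite (copies_eq0 HG). Qed.

(** * Transport of subgraphs along embeddings *)

Section Embedding.
Variables (G G' : sgraph) (g : G -> G').
Hypotheses (ginj : injective g) (gadj : forall x y, adj x y -> adj (g x) (g y)).
Variable H : subg G.
Hypothesis HG : H \in subgraphs (whole G).

Definition push : subg G' := (g @: H.1, (fun e : {set G} => g @: e) @: H.2).

Lemma imset2 u v : g @: [set u; v] = [set g u; g v].
Proof. by rewrite imsetU !imset_set1. Qed.

Lemma push_subgraph : push \in subgraphs (whole G').
Proof.
move: HG; rewrite !inE => /and3P[_ HE /forallP Hin]; rewrite subsetT /=.
apply/andP; split.
  apply/subsetP => _ /imsetP[e eH ->].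
  have /imsetP[[u v]] := subsetP HE _ eH; rewrite inE /= => uv ->.
  by rewrite imset2; apply/imsetP; exists (g u, g v); rewrite ?inE /= ?gadj.
apply/forallP => e'; apply/implyP => /imsetP[e eH ->] /=.
by apply: imsetS; have := Hin e; rewrite eH.
Qed.

Lemma link_push u v : link push (g u) (g v) = link H u v.
Proof. by rewrite /link /= -imset2 mem_imset //; apply: imset_inj. Qed.

Lemma inj_homs_push (F : sgraph) :
  inj_homs F push = [set [ffun x => g (f x)] | f : {ffun F -> G} in inj_homs F H].
Proof.
apply/setP => h; apply/idP/imsetP.
  rewrite inE => /and3P[/injectiveP hinj hH /ghomP hhom].
  have pre x : exists u, (u \in H.1) && (h x == g u).
    have : h x \in push.1 by rewrite (subsetP hH) ?imset_f.
    by move=> /imsetP[u uH hu]; exists u; rewrite uH hu eqxx.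
  pose f : {ffun F -> G} := [ffun x => xchoose (pre x)].
  have fH x : f x \in H.1 by rewrite ffunE; case/andP: (xchooseP (pre x)).
  have gf x : g (f x) = h x by rewrite ffunE; case/andP: (xchooseP (pre x)) => _ /eqP.
  exists f; last by apply/ffunP => x; rewrite ffunE gf.
  rewrite inE; apply/and3P; split.
  - by apply/injectiveP => x y E; apply: hinj; rewrite -!gf E.
  - by apply/subsetP => _ /imsetP[x _ ->].
  - by apply/ghomP => x y xy; rewrite -link_push !gf; apply: hhom.
move=> [f]; rewrite !inE => /and3P[/injectiveP finj fH /ghomP fhom] ->.
apply/and3P; split.
- by apply/injectiveP => x y; rewrite !ffunE => /ginj/finj.
- apply/subsetP => _ /imsetP[x _ ->]; rewrite ffunE imset_f //.
  by rewrite (subsetP fH) ?imset_f.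
- by apply/ghomP => x y xy; rewrite !ffunE link_push; apply: fhom.
Qed.

Lemma card_inj_homs_push (F : sgraph) : #|inj_homs F push| = #|inj_homs F H|.
Proof.
rewrite inj_homs_push card_imset // => f f' /ffunP E.
by apply/ffunP => x; have := E x; rewrite !ffunE => /ginj.
Qed.

End Embedding.

(** Pushing a subgraph forward preserves the numbers of injective homomorphisms, hence both freeness
    and the number of copies. Used in both directions it gives invariance under isomorphism. *)
Lemma ex_count_embedding (G G' T : sgraph) (Fs : seq sgraph) (g : G -> G') :
  injective g -> (forall x y, adj x y -> adj (g x) (g y)) ->
  ex_count G T Fs <= ex_count G' T Fs.
Proof.
move=> ginj gadj; apply/bigmax_leqP => H /andP[HG free].
have HG' := push_subgraph gadj HG.
have free' : family_free Fs (push g H).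
  move: free; rewrite !family_freeE //; apply: sub_all => F.
  by rewrite -!cards_eq0 card_inj_homs_push.
have := leq_bigmax_cond (F := fun H => #|copies T H|)
  (P := fun H => (H \in subgraphs (whole G')) && family_free Fs H) (push g H).
rewrite HG' free' => /(_ isT); apply: leq_trans.
rewrite -(leq_pmul2r (automorphisms_gt0 T)) !card_copies //.
by rewrite card_inj_homs_push.
Qed.

Lemma ex_count_bound (R : realFieldType) (G T : sgraph) (Fs : seq sgraph) (z : R) :
  (0 <= z)%R ->
  (forall H, H \in subgraphs (whole G) -> all (fun F => inj_homs F H == set0) Fs ->
     (#|inj_homs T H|%:R <= z)%R) ->
  ((ex_count G T Fs * #|automorphisms T|)%:R <= z)%R.
Proof.
move=> z0 Hz; rewrite /ex_count; elim/big_ind: _ => //.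
  by move=> a b; case: (leqP a b).
move=> H /andP[HG]; rewrite family_freeE // => free.
by rewrite card_copies // Hz.
Qed.

Lemma inj_homs_le_ex_count (G T : sgraph) (Fs : seq sgraph) (H : subg G) :
  H \in subgraphs (whole G) -> all (fun F => inj_homs F H == set0) Fs ->
  #|inj_homs T H| <= ex_count G T Fs * #|automorphisms T|.
Proof.
move=> HG free; rewrite -card_copies // leq_mul2r; apply/orP; right.
apply: (leq_bigmax_cond (F := fun H => #|copies T H|)).
by rewrite HG family_freeE.
Qed.

(** All homomorphisms are excluded, since distinct vertices of a copy of [F] may have the same
    colour. *)
Definition hom_free (C : finType) (Fs : seq sgraph) : {set {set C * C}} :=
  [set Q : {set C * C} | all (fun F : sgraph => [forall h : {ffun F -> C}, ~~ ghom (fun i j =>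
    (i, j) \in Q) h]) Fs].

Definition restricted (G : sgraph) (C : finType) (Q : {set C * C}) (c : G -> C) : subg G :=
  ([set: G], [set [set p.1; p.2] | p : G * G & compat Q c (@adj G) p.1 p.2]).

Section Restricted.
Variables (G : sgraph) (C : finType) (Q : {set C * C}) (c : G -> C).

Lemma compat_sym : symmetric (compat Q c (@adj G)).
Proof.
by move=> u v; rewrite /compat adj_sym /allowed; congr (_ && _); rewrite andbC.
Qed.

Lemma restricted_subgraph : restricted Q c \in subgraphs (whole G).
Proof.
rewrite !inE subxx /=; apply/andP; split.
  apply/subsetP => e /imsetP[[u v]]; rewrite inE /= => /andP[uv _] ->.
  by apply/imsetP; exists (u, v); rewrite ?inE.
by apply/forallP => e; rewrite subsetT implybT.
Qed.

Lemma link_restricted u v : link (restricted Q c) u v = compat Q c (@adj G) u v.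
Proof.
apply/imsetP/idP => [[[p q]]|uv]; last by exists (u, v); rewrite ?inE.
by rewrite inE /= => pq /set2_eq[] [-> ->] //; rewrite compat_sym.
Qed.

Lemma inj_homs_restricted (F : sgraph) :
  inj_homs F (restricted Q c) =
  [set f : {ffun F -> G} | injectiveb f && ghom (compat Q c (@adj G)) f].
Proof.
apply/setP => f; rewrite !inE subsetT /=; congr (_ && _).
by apply: eq_forallb => u; apply: eq_forallb => v; rewrite link_restricted.
Qed.

End Restricted.

(** A copy of [F] in the restricted graph, followed by [c], would be a homomorphism into [Q]. The
    last term pays for the non-injective homomorphisms that [opt] counts; the factor [#|G|] avoids a
    division. *)
Lemma opt_le_ex_count (G T : sgraph) (Fs : seq sgraph) (C : finType) :
  (0 < #|G|) ->
  #|G| * opt T (hom_free C Fs) (@adj G) <=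
  #|G| * (ex_count G T Fs * #|automorphisms T|) + #|T| ^ 2 * #|G| ^ #|T|.
Proof.
move=> G0; apply: leq_trans (leq_add (leqnn _) (card_noninj T G)).
rewrite -mulnDr leq_mul2l; apply/orP; right.
apply/bigmax_leqP => Q; rewrite inE => Qfree; apply/bigmax_leqP => c _.
apply: leq_trans (leq_add (inj_homs_le_ex_count T (H := restricted Q c) (restricted_subgraph _
  _) _) (leqnn _)).
  rewrite inj_homs_restricted /homs -cardsUI; apply: leq_trans (leq_addr _ _).
  apply: subset_leq_card; apply/subsetP => f; rewrite !inE => ->.
  by rewrite andbT orbN.
apply: sub_all Qfree => F /forallP Ffree; apply/eqP/setP => f.
rewrite inj_homs_restricted !inE; apply/negP => /andP[_ /ghomP fhom].
have := Ffree [ffun x => c (f x)]; apply/negP; rewrite negbK.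
by apply/ghomP => x y xy; rewrite !ffunE; have /andP[_ /andP[]] := fhom _ _ xy.
Qed.

Local Open Scope ring_scope.

Lemma card_two_coordinates (R : realFieldType) (T V : finType) (x y : T) (B : rel V) : x != y ->
  #|V|%:R ^+ 2 * #|[set f : {ffun T -> V} | B (f x) (f y)]|%:R =
  #|V|%:R ^+ #|T| * \sum_a \sum_b (B a b)%:R :> R.
Proof.
move=> xy; pose h (b : bool) := if b then x else y.
have hinj : injective h by move=> [] [] //= E; rewrite E eqxx in xy.
have := sum_comp_inj (fun z : {ffun bool -> V} => (B (z true) (z false))%:R : R) hinj.
rewrite card_bool (sum_ffun_bool (fun a b => (B a b)%:R)) => <-; congr (_ * _).
rewrite -sum1_card natr_sum big_mkcond; apply: eq_bigr => f _.
by rewrite inE !ffunE; case: (B _ _).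
Qed.

(** Colour [H] by its reduced graph. A map counted on the left either respects [Q] or sends some
    edge of [T] to an exceptional pair; a union bound over the pairs of vertices of [T] explains the
    tolerance [eps / t ^ 2]. *)
Lemma inj_homs_le_opt (R : realType) (T : sgraph) (Fs : seq sgraph) (eps : R) :
  0 < eps -> (0 < #|T|)%N ->
  exists k N, forall (G : sgraph), (N <= #|G|)%N ->
  forall H : subg G, H \in subgraphs (whole G) -> all (fun F => inj_homs F H == set0) Fs ->
  #|inj_homs T H|%:R <=
    (opt T (hom_free 'I_k.+1 Fs) (@adj G))%:R + eps * #|G|%:R ^+ #|T|.
Proof.
move=> eps0 T0.
pose t : R := #|T|%:R; have t0 : 0 < t by rewrite ltr0n.
have [k [N0 HN0]] := reduced_graph Fs (divr_gt0 eps0 (exprn_gt0 2 t0)).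
exists k, (Num.truncn ((N0%:R : R) ^+ #|T| / eps)).+1 => G GN H HG free.
have G0 : (0 < #|G|)%N by apply: leq_trans GN.
set n : R := #|G|%:R; have n0 : 0 < n by rewrite ltr0n.
have n1 : 1 <= n by rewrite ler1n.
(* Isolated vertices of forbidden graphs must be embedded in H.1, not in G. *)
pose U : finType := {x : G | x \in H.1}.
(* If [H] has fewer than [N0] vertices, it admits at most [N0 ^ #|T|] maps, which is below [eps * n]
   for large [n]. *)
have [small|large] := ltnP #|U| N0.
  apply: le_trans (_ : eps * n ^+ #|T| <= _); last by rewrite lerDr ler0n.
  apply: le_trans (_ : N0%:R ^+ #|T| <= _).
    rewrite -natrX ler_nat; apply: leq_trans (_ : #|H.1| ^ #|T| <= _)%N; last first.
      by rewrite leq_exp2r // -[#|H.1|](card_sig (mem H.1)) ltnW.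
    rewrite -card_ffun_on; apply: subset_leq_card; apply/subsetP => f.
    rewrite inE => /and3P[_ /subsetP fH _].
    by apply/ffun_onP => x; rewrite fH ?imset_f.
  apply: le_trans (_ : eps * n <= _).
    rewrite mulrC -ler_pdivrMr //; apply: le_trans (ltW (truncnS_gt _)) _.
    by rewrite ler_nat.
  by rewrite ler_wpM2l ?(ltW eps0) // ler_eXnr.
pose A : rel U := fun u v => link H (val u) (val v).
have Asym : symmetric A by move=> u v; apply: link_sym.
have Afree : all (fun F : sgraph => [forall x : {ffun F -> U}, ~~ (injectiveb x && ghom A x)]) Fs.
  apply: sub_all free => F /eqP none; apply/forallP => x;
    apply/negP => /andP[/injectiveP xinj /ghomP xhom].
  suff : [ffun u => val (x u)] \in inj_homs F H by rewrite none inE.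
  rewrite inE; apply/and3P; split.
  - by apply/injectiveP => u v; rewrite !ffunE => /val_inj/xinj.
  - by apply/subsetP => _ /imsetP[u _ ->]; rewrite ffunE; apply: valP.
  - by apply/ghomP => u v uv; rewrite !ffunE; apply: xhom.
have [c [Q [Qfree few]]] := HN0 U A Asym large Afree.
(* Vertices outside [H.1] get an arbitrary colour: the maps to be covered stay inside [H.1]. *)
pose cG : {ffun G -> 'I_k.+1} := [ffun v => if insub v is Some u then c (u : U) else ord0].
pose Qs : {set 'I_k.+1 * 'I_k.+1} := [set p | Q p.1 p.2].
have QsR : Qs \in hom_free 'I_k.+1 Fs.
  rewrite inE; apply: sub_all Qfree => F /forallP Ffree; apply/forallP => h.
  by apply: contra (Ffree h) => /ghomP hh; apply/ghomP => u v uv; have := hh _ _ uv; rewrite inE.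
pose B : rel G := fun a b => [&& a \in H.1, b \in H.1, link H a b & ~~ Q (cG a) (cG b)].
have cover : (#|inj_homs T H| <= homs T Qs cG (@adj G) +
    \sum_(p : T * T | p.1 != p.2) #|[set f : {ffun T -> G} | B (f p.1) (f p.2)]|)%N.
  pose bad_maps := \bigcup_(p : T * T | p.1 != p.2) [set f : {ffun T -> G} | B (f p.1) (f p.2)].
  apply: leq_trans (_ : #|[set y : {ffun T -> G} | ghom (compat Qs cG (@adj G)) y] :|:
    bad_maps| <= _)%N.
    apply: subset_leq_card; apply/subsetP => f;
      rewrite inE => /and3P[/injectiveP finj /subsetP fH /ghomP fhom].
    have fin x : f x \in H.1 by rewrite fH ?imset_f.
    have [good|] := boolP [forall x, forall y, adj x y ==> Q (cG (f x)) (cG (f y))].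
      rewrite inE; apply/orP; left; rewrite inE; apply/ghomP => x y xy.
      have adjf : adj (f x) (f y).
        move: HG; rewrite inE => /and3P[_ /subsetP HE _].
        have /imsetP[[u v]] := HE _ (fhom _ _ xy); rewrite inE /= => uv /set2_eq[] [-> ->] //.
        by rewrite adj_sym.
      have Qxy u v : adj u v -> Q (cG (f u)) (cG (f v)).
        by move=> uv; have /forallP/(_ v)/implyP := (forallP good) u; apply.
      by rewrite /compat adjf /allowed !inE /= !Qxy // adj_sym.
    move=> /forallPn[x /forallPn[y]]; rewrite negb_imply => /andP[xy nQ].
    rewrite inE; apply/orP; right; apply/bigcupP; exists (x, y) => /=.
      by apply: contraTneq xy => ->; rewrite adj_irr.
    by rewrite inE /= /B !fin nQ andbT; apply: fhom.
  apply: leq_trans (leq_card_setU _ _) _; rewrite leq_add2l /bad_maps.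
  elim/big_ind2: _ => [|D a E b Da Eb|p _]; rewrite ?cards0 //.
  by apply: leq_trans (leq_card_setU _ _) (leq_add Da Eb).
have Bfew : \sum_a \sum_b (B a b)%:R <= eps / t ^+ 2 * n ^+ 2 :> R.
  have toU (f : G -> R) : (forall a, a \notin H.1 -> f a = 0) -> \sum_a f a = \sum_(u : U) f
    (val u).
    move=> f0; rewrite (bigID (mem H.1)) /= addrC big1 ?add0r; last by move=> a; apply: f0.
    rewrite (reindex_omap (val : U -> G) insub) /=; last by move=> a aH; rewrite insubT.
    by apply: eq_bigl => u; rewrite valK eqxx andbT; apply: valP.
  rewrite toU => [|a aN]; last by rewrite big1 // => b _; rewrite /B (negPf aN).
  have inner (u : U) : \sum_b (B (val u) b)%:R = \sum_(v : U) (B (val u) (val v))%:R :> R.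
    by apply: toU => b bN; rewrite /B (negPf bN) andbF.
  rewrite (eq_bigr _ (fun u _ => inner u)).
  apply: le_trans (le_trans few _); last first.
    rewrite ler_wpM2l ?divr_ge0 ?exprn_ge0 ?(ltW eps0) ?(ltW t0) //.
    by rewrite lerXn2r ?nnegrE // ler_nat card_sig max_card.
  apply: ler_sum => u _; apply: ler_sum => v _; rewrite ler_nat /B !ffunE !valK.
  by rewrite (valP u) (valP v).
apply: le_trans (_ : (homs T Qs cG (@adj G))%:R + \sum_(p : T * T | p.1 != p.2) eps / t ^+ 2 *
  n ^+ #|T| <= _).
  apply: le_trans (_ : (homs T Qs cG (@adj G) + \sum_(p : T * T | p.1 != p.2)
     #|[set f : {ffun T -> G} | B (f p.1) (f p.2)]|)%N%:R <= _); first by rewrite ler_nat.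
  rewrite natrD lerD2l natr_sum; apply: ler_sum => -[x y] /= xy.
  rewrite -(ler_pM2l (exprn_gt0 2 n0)) card_two_coordinates // [leRHS]mulrA [leRHS]mulrC.
  by rewrite ler_wpM2l ?exprn_ge0 ?(ltW n0) // [leRHS]mulrC.
apply: lerD; first by rewrite ler_nat homs_le_opt.
apply: le_trans (_ : \sum_(p : T * T) eps / t ^+ 2 * n ^+ #|T| <= _).
  rewrite [leLHS]big_mkcond /=; apply: ler_sum => p _; case: ifP => // _.
  by rewrite mulr_ge0 ?divr_ge0 ?exprn_ge0 ?(ltW eps0) ?(ltW t0) ?(ltW n0).
rewrite sumr_const card_prod -[_ *+ (_ * _)]mulr_natl natrM -/t.
rewrite le_eqVlt; apply/orP; left; apply/eqP; field; exact: lt0r_neq0.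
Qed.

Local Open Scope nat_scope.

(** * The approximation algorithm *)

Lemma eq_nsum n k F F' s :
  (forall r, size r = size s + k -> F r = F' r) -> nsum n k F s = nsum n k F' s.
Proof.
elim: k s => [|k IH] s H /=; first by apply: H; rewrite addn0.
by apply: eq_bigr => v _; apply: IH => r; rewrite size_rcons => E; apply: H; rewrite E addSnnS.
Qed.

Lemma nsum_add n k l F s : nsum n (k + l) F s = nsum n k (nsum n l F) s.
Proof. by elim: k s => //= k IH s; apply: eq_bigr => v _. Qed.

Lemma nsum_const n l F s z : (forall r, F (s ++ r) = z) -> nsum n l F s = n ^ l * z.
Proof.
elim: l s => [|l IH] s H /=; first by rewrite mul1n -(H [::]) cats0.
rewrite (eq_bigr (fun=> n ^ l * z)) => [|v _]; last by apply: IH => r; rewrite cat_rcons.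
by rewrite sum_nat_const card_ord mulnA expnS.
Qed.

Lemma nsum_tuple n k F s :
  nsum n k F s = \sum_(u : k.-tuple 'I_n) F (s ++ map val u).
Proof.
elim: k s => [|k IH] s /=.
  rewrite (bigD1 [tuple]) //= cats0 big1 ?addn0 // => u /eqP[].
  exact: tuple0.
under eq_bigr do rewrite IH.
rewrite pair_big /= (reindex (fun p : 'I_n * k.-tuple 'I_n => [tuple of p.1 :: p.2])) /=.
  by apply: eq_bigr => -[v u] _; rewrite cat_rcons.
apply: onW_bij; exists (fun u : k.+1.-tuple 'I_n => (thead u, [tuple of behead u])).
  by move=> [v u]; congr pair; apply: val_inj.
by move=> u; rewrite [RHS]tuple_eta.
Qed.

(** * Passing between bit tables and graphs *)

Lemma adj_matrix_ord (G : sgraph) (i j : 'I_#|G|) :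
  adj_matrix G i j = adj (enum_val i) (enum_val j).
Proof.
apply/existsP/idP => [[x /existsP[y]]|ij].
  by move=> /and3P[/eqP/val_inj -> /eqP/val_inj ->]; rewrite !enum_rankK.
by exists (enum_val i); apply/existsP; exists (enum_val j); rewrite !enum_valK !eqxx.
Qed.

Lemma nsum_adj_matrix (G : sgraph) q (w : (nat -> nat -> bool) -> nat) (W : rel 'I_q -> nat) :
  (forall (b : nat -> nat -> bool) (A : rel 'I_q), (forall i j : 'I_q, b i j = A i j) -> w b =
    W A) ->
  nsum #|G| q (fun s => w (fun i j => adj_matrix G (nth 0 s i) (nth 0 s j))) [::] =
  \sum_(x : {ffun 'I_q -> G}) W (sample (@adj G) x).
Proof.
move=> wW; rewrite nsum_tuple.
rewrite (reindex (fun u : q.-tuple 'I_#|G| => [ffun i => enum_val (tnth u i)])) /=; last first.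
  apply: onW_bij; exists (fun x : {ffun 'I_q -> G} => [tuple enum_rank (x i) | i < q]).
    by move=> u; apply: eq_from_tnth => i; rewrite tnth_mktuple ffunE enum_valK.
  by move=> x; apply/ffunP => i; rewrite ffunE tnth_mktuple enum_rankK.
apply: eq_bigr => u _; apply: wW => i j.
have nthE (l : 'I_q) : nth 0 [seq val v | v <- u] l = tnth u l.
  by rewrite (nth_map (tnth u l)) ?size_tuple // -tnth_nth.
by rewrite !nthE adj_matrix_ord /sample !ffunE.
Qed.

(** Symmetrised and cleared on the diagonal, so that every bit table defines a graph. *)
Definition matrix_adj (n : nat) (m : nat -> nat -> bool) : rel 'I_n :=
  fun i j => (i != j) && (m i j || m j i).

Lemma matrix_adj_sym n m : symmetric (@matrix_adj n m).
Proof. by move=> i j; rewrite /matrix_adj eq_sym orbC. Qed.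

Lemma matrix_adj_irr n m : irreflexive (@matrix_adj n m).
Proof. by move=> i; rewrite /matrix_adj eqxx. Qed.

Definition matrix_graph (n : nat) (m : nat -> nat -> bool) : sgraph :=
  SGraph (@matrix_adj_sym n m) (@matrix_adj_irr n m).

Lemma ex_count_matrix_ext (T : sgraph) Fs n m m' :
  (forall i j, i < n -> j < n -> m i j = m' i j) ->
  ex_count (matrix_graph n m) T Fs = ex_count (matrix_graph n m') T Fs.
Proof.
move=> E; apply/eqP; rewrite eqn_leq; apply/andP; split.
  apply: (@ex_count_embedding (matrix_graph n m) (matrix_graph n m') T Fs id) => // x y.
  by rewrite /= /matrix_adj !E.
apply: (@ex_count_embedding (matrix_graph n m') (matrix_graph n m) T Fs id) => // x y.
by rewrite /= /matrix_adj !E.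
Qed.

Lemma ex_count_adj_matrix (G T : sgraph) Fs :
  ex_count (matrix_graph #|G| (adj_matrix G)) T Fs = ex_count G T Fs.
Proof.
have mE (i j : 'I_#|G|) : matrix_adj (adj_matrix G) i j = adj (enum_val i) (enum_val j).
  rewrite /matrix_adj !adj_matrix_ord (adj_sym (enum_val j)) orbb.
  by apply: andb_idl; apply: contraTneq => ->; rewrite adj_irr.
apply/eqP; rewrite eqn_leq; apply/andP; split.
  apply: (@ex_count_embedding (matrix_graph _ _) G T Fs (@enum_val _ _) enum_val_inj) => i j.
  by rewrite /= mE.
apply: (@ex_count_embedding G (matrix_graph _ _) T Fs enum_rank enum_rank_inj) => x y.
by rewrite /= mE !enum_rankK.
Qed.

Lemma eq_opt (T : sgraph) (C : finType) RR (V : finType) (A A' : rel V) :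
  A =2 A' -> @opt T C RR V A = opt T RR A'.
Proof.
move=> E; apply: eq_bigr => Q _; apply: eq_bigr => c _; apply: eq_card => y.
by rewrite !inE; apply: eq_forallb => u; apply: eq_forallb => v; rewrite /compat E.
Qed.

Definition empty_graph : sgraph :=
  @SGraph void (fun _ _ => false) (fun _ _ => erefl) (fun _ => erefl).

(** The empty subgraph is the only possible copy, so the value is 1 if some free subgraph exists and
    0 otherwise. The only possible obstruction is a forbidden graph without vertices, which excludes
    every host alike. *)
Lemma ex_count_no_vertex (G T : sgraph) Fs : #|T| = 0 ->
  ex_count G T Fs = ex_count empty_graph T Fs.
Proof.
move=> T0; apply/eqP; rewrite eqn_leq; apply/andP; split; last first.
  by apply: (@ex_count_embedding empty_graph G T Fs (fun x : void => match x with end)); case.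
have noT (x : T) : False by have := fintype0 x T0.
apply/bigmax_leqP => H /andP[HG]; rewrite family_freeE // => free.
apply: leq_trans (_ : 1 <= _).
  rewrite -(leq_pmul2r (automorphisms_gt0 T)) card_copies //.
  apply: leq_trans (_ : 1 <= _); last by rewrite mul1n automorphisms_gt0.
  by apply: leq_trans (max_card _) _; rewrite card_ffun T0.
suff : 0 < ex_count empty_graph T Fs * #|automorphisms T| by rewrite muln_gt0 => /andP[].
pose H0 : subg empty_graph := (set0, set0).
apply: leq_trans (inj_homs_le_ex_count T (Fs := Fs) (H := H0) _ _).
- apply/card_gt0P; exists [ffun x : T => match noT x with end]; rewrite inE.
  apply/and3P; split; first by apply/injectiveP => x; case: (noT x).
    by apply/subsetP => v /imsetP[x]; case: (noT x).
  by apply/ghomP => x; case: (noT x).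
- rewrite !inE !sub0set /=; apply/forallP => e; apply/implyP; rewrite inE //.
apply: sub_all free => F /eqP none; apply/eqP/setP => f; rewrite in_set0; apply/negP => _.
have noF (x : F) : False by case: (f x).
suff : [ffun x : F => match noF x with end] \in inj_homs F H by rewrite none inE.
rewrite inE; apply/and3P; split; first by apply/injectiveP => x; case: (noF x).
  by apply/subsetP => v /imsetP[x]; case: (noF x).
by apply/ghomP => x; case: (noF x).
Qed.

Local Open Scope ring_scope.

Theorem theorem1p4 (R : realType) (eps : R) (Fs : seq sgraph) (T : sgraph) :
  0 < eps ->
  exists f : sgraph -> rat,
    poly_time_computable f /\
    forall G : sgraph,
      `|ratr (f G) - (ex_count G T Fs)%:R| <= eps * #|G|%:R ^+ #|T|.
Proof.
move=> eps0.
have [T0|T0] := posnP #|T|.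
  (* Here n ^ 0 = 1, so no error vanishes for large n. *)
  pose c := ex_count empty_graph T Fs; eexists; split.
    apply: (@computable_quotient 0 0 0 1 (fun _ _ => 0%N) (fun _ => c)) => //.
  move=> G; rewrite /num_value /den_value /= divr1 ratr_nat.
  by rewrite (ex_count_no_vertex G Fs T0) subrr normr0 T0 expr0 mulr1 ltW.
(* One third each for passing from [H] to a colouring, for non-injective homomorphisms, and for
   sampling. *)
pose e := eps / 3; have e0 : 0 < e by rewrite divr_gt0.
have [k [N1 HN1]] := inj_homs_le_opt Fs e0 T0.
pose RR := hom_free 'I_k.+1 Fs.
have [q [N2 [q0 HN2]]] := opt_sampling T RR e0.
pose N := (N1 + N2 + (Num.truncn (#|T|%:R ^+ 2 / e)).+1)%N.
pose a := #|automorphisms T|; have a0 : (0 < a)%N := automorphisms_gt0 T.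
pose w (b : nat -> nat -> bool) := opt T RR (fun i j : 'I_q => b i j).
eexists; split.
  (* The [#|T|] extra loops supply the factor [n ^ #|T|]; the constant [q ^ #|T| * a] normalises the
     homomorphism counts of a sample and divides by the number of automorphisms. *)
  apply: (@computable_quotient N q #|T| (q ^ #|T| * a)
    (fun n m => ex_count (matrix_graph n m) T Fs) w).
  - by move=> n b b'; apply: ex_count_matrix_ext.
  - by move=> b b' E; apply: eq_opt => i j; apply: E.
  - move=> n; rewrite /den_value; have [//|Nn] := ltnP n N.
    by rewrite (nsum_const _ _ (z := (q ^ #|T| * a)%N)) // !muln_gt0 !expn_gt0 q0 a0; lia.
move=> G; rewrite /num_value /den_value; case: ltnP => [_|large].
  rewrite ex_count_adj_matrix divr1 ratr_nat subrr normr0.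
  by rewrite mulr_ge0 ?exprn_ge0 // ltW.
have G0 : (0 < #|G|)%N by lia.
set n : R := #|G|%:R; have n0 : 0 < n by rewrite ltr0n.
set E := \sum_(x : {ffun 'I_q -> G}) opt T RR (sample (@adj G) x).
have -> : nsum #|G| (q + #|T|) (fun s => w (fun i j => adj_matrix G (nth 0 s i) (nth 0 s j))) [::]
    = (#|G| ^ #|T| * E)%N.
  rewrite nsum_add (@eq_nsum _ _ _ (fun s => #|G| ^ #|T| * w (fun i j => adj_matrix G (nth 0 s
    i) (nth 0 s j)))%N).
    rewrite nsum_tuple -big_distrr /= -(nsum_tuple _ _ (fun s => w (fun i j => adj_matrix G
      (nth 0 s i) (nth 0 s j))) [::]); congr (_ * _)%N.
    by apply: nsum_adj_matrix => b A bA; apply: eq_opt.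
  move=> r; rewrite add0n => rq; apply: nsum_const => r'.
  by apply: eq_opt => i j; rewrite !nth_cat rq !ltn_ord.
rewrite (nsum_const _ _ (z := (q ^ #|T| * a)%N)) //.
rewrite fmorph_div /= !ratr_nat !natrM !natrX natr_sum -/n.
have := HN2 G (@adj G) (@adj_sym G) G0 (leq_trans (leq_addl N1 N2) (leq_trans (leq_addr _ _)
  large)).
set avg := (\sum_x _) / _; set o : R := (opt T RR _)%:R; rewrite -/n => close.
have nt : 0 < n ^+ #|T| by apply: exprn_gt0.
have a1 : 1 <= a%:R :> R by rewrite ler1n.
have -> : n ^+ #|T| * (\sum_(x : {ffun 'I_q -> G}) (opt T RR (sample (@adj G) x))%:R) /
    (n ^+ q * (q%:R ^+ #|T| * a%:R)) = n ^+ #|T| * avg / a%:R.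
  by rewrite /avg mulrA !invfM !mulrA.
set ex : R := (ex_count G T Fs)%:R.
have ex_le : ex * a%:R <= o + e * n ^+ #|T|.
  rewrite -natrM; apply: ex_count_bound => [|H HG free].
    by rewrite addr_ge0 // mulr_ge0 // ltW.
  by apply: HN1 => //; apply: leq_trans large; rewrite /N -addnA leq_addr.
have o_le : o <= ex * a%:R + e * n ^+ #|T|.
  have := opt_le_ex_count T Fs 'I_k.+1 G0.
  rewrite -(ler_nat R) natrD !natrM !natrX -/n -/o -/ex -/a => H.
  rewrite -(ler_pM2l n0) mulrDr; apply: le_trans H _;
    rewrite lerD2l [leRHS]mulrA ler_wpM2r ?(ltW nt) //.
  rewrite -ler_pdivrMr //; apply: le_trans (ltW (truncnS_gt _)) _.
  by rewrite /n ler_nat; apply: leq_trans large; rewrite /N leq_addl.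
have avgn : `|n ^+ #|T| * avg - o| <= e * n ^+ #|T|.
  have -> : n ^+ #|T| * avg - o = (avg - o / n ^+ #|T|) * n ^+ #|T|.
    by rewrite mulrBl divfK ?lt0r_neq0 // mulrC.
  by rewrite normrM (gtr0_norm nt) ler_wpM2r // ltW.
have : `|n ^+ #|T| * avg - ex * a%:R| <= eps * n ^+ #|T|.
  have -> : eps * n ^+ #|T| = e * n ^+ #|T| + e * n ^+ #|T| + e * n ^+ #|T| by rewrite /e; field.
  have ent : 0 <= e * n ^+ #|T| by rewrite mulr_ge0 // ltW.
  move: avgn; rewrite !ler_norml => /andP[? ?]; apply/andP; split; lra.
have a0' : 0 < a%:R :> R by rewrite ltr0n.
have -> : n ^+ #|T| * avg / a%:R - ex = (n ^+ #|T| * avg - ex * a%:R) / a%:R.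
  by rewrite mulrBl mulfK ?lt0r_neq0.
move=> H; rewrite normrM normfV (gtr0_norm a0') ler_pdivrMr //.
(* Dividing by [a], which is at least 1, does not increase the error. *)
apply: le_trans H _; rewrite ler_peMr // mulr_ge0 ?ltW //.
Qed.
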